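(* Let $\sigma\in\{-1,0,1\}$ and $\theta_L,\theta_R\in\Theta$. Let $\boldsymbol\beta=\{\beta_x:x\in V\}$ and $\boldsymbol\beta'=\{\beta'_x:x\in V\}$ be two sets of real numbers such that $\theta_R+\beta_x(\theta_L-\theta_R)\in\Theta$ and $\theta_R+\beta'_x(\theta_L-\theta_R)\in\Theta$ for all $x\in V$. Then, for all $\xi\in\widehat{\mathcal Y}$ and $t\ge0$, $$\mathbb E_{\mu_{\theta_L,\theta_R,\boldsymbol\beta}}\left[D^{or}_{\theta_L,\theta_R,\boldsymbol\beta'}(\xi,\eta_t)\right]=(\theta_L-\theta_R)^{|\xi|}\,\psi_{t,\boldsymbol\beta,\boldsymbol\beta'}(\xi),$$ where $$\psi_{t,\boldsymbol\beta,\boldsymbol\beta'}(\xi):=\sum_{\zeta\le\xi}(-1)^{|\xi|-|\zeta|}\left(\prod_{x\in V}\binom{\xi(x)}{\zeta(x)}(\beta_x')^{\xi(x)-\zeta(x)}\right)\widehat{\mathbb E}_\zeta\left[\mathbf 1_{\{\zeta_t(R)=0\}}\prod_{x\in V}(\beta_x)^{\zeta_t(x)}\right],$$ and $\psi_{t,\boldsymbol\beta,\boldsymbol\beta'}(\xi)$ depends on neither $\theta_L$ nor $\theta_R$, but only on $\boldsymbol\beta$, $\boldsymbol\beta'$, $\sigma$ and the underlying geometry (the parameters $\omega_{\{x,y\}}$, $\alpha_x$, $\omega_L,\omega_R,\alpha_L,\alpha_R$). Moreover, if $\omega_L\vee\omega_R>0$, then (letting $t\to\infty$) for all $\xi\in\widehat{\mathcal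 Y}$, $$\mathbb E_{\mu_{\theta_L,\theta_R}}\left[D^{or}_{\theta_L,\theta_R,\boldsymbol\beta'}(\xi,\eta)\right]=(\theta_L-\theta_R)^{|\xi|}\,\psi_{\boldsymbol\beta'}(\xi),$$ where $$\psi_{\boldsymbol\beta'}(\xi):=\sum_{\zeta\le\xi}(-1)^{|\xi|-|\zeta|}\left(\prod_{x\in V}\binom{\xi(x)}{\zeta(x)}(\beta'_x)^{\xi(x)-\zeta(x)}\right)\widehat{\mathbb P}_\zeta\left(\zeta_\infty(L)=|\zeta|\right),$$ which is again independent of $\theta_L$ and $\theta_R$.
   Context: Setting. $\mathbb N=\{1,2,\dots\}$, $\mathbb N_0=\mathbb N\cup\{0\}$. Let $N\in\mathbb N$, $V=\{1,\dots,N\}$. Symmetric conductances $\omega_{\{x,y\}}\in[0,\infty)$, $x,y\in V$, with $\omega_{\{x,x\}}=0$; write $x\sim y$ if $\omega_{\{x,y\}}\neq0$ and assume the graph $(V,\sim)$ is connected. Site parameters $\alpha_x\in\mathbb N$. Boundary parameters $\omega_L,\omega_R\ge0$, $\alpha_L,\alpha_R>0$. $\Theta=[0,1]$ if $\sigma=-1$ and $\Theta=[0,\infty)$ if $\sigma\in\{0,1\}$. Convention $0^0=1$. Boundary driven process. $\mathcal X=\prod_{x\in V}\{0,\dots,\alpha_x\}$ if $\sigma=-1$, $\mathcal X=\mathbb N_0^V$ otherwise. $\{\eta_t\}$ is the Markov process on $\mathcal X$ with generator $\mathcal L=\sum_{\{x,y\}:x\sim y}\omega_{\{x,y\}}\mathcal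 L_{\{x,y\}}+\omega_L\mathcal L_L+\omega_R\mathcal L_R$ (sum over unordered pairs), where $\mathcal L_{\{x,y\}}f(\eta)=\eta(x)(\alpha_y+\sigma\eta(y))(f(\eta-\delta_x+\delta_y)-f(\eta))+\eta(y)(\alpha_x+\sigma\eta(x))(f(\eta-\delta_y+\delta_x)-f(\eta))$, $\mathcal L_Lf(\eta)=\eta(1)\alpha_L(1+\sigma\theta_L)(f(\eta-\delta_1)-f(\eta))+\alpha_L\theta_L(\alpha_1+\sigma\eta(1))(f(\eta+\delta_1)-f(\eta))$, $\mathcal L_Rf(\eta)=\eta(N)\alpha_R(1+\sigma\theta_R)(f(\eta-\delta_N)-f(\eta))+\alpha_R\theta_R(\alpha_N+\sigma\eta(N))(f(\eta+\delta_N)-f(\eta))$. $\mathbb E_\mu[f(\eta_t)]$ is expectation for the process started from law $\mu$; $\mathbb E_\mu[f(\eta)]=\sum_\eta f(\eta)\mu(\eta)$. For $\omega_L\vee\omega_R>0$ the process has a unique stationary measure $\mu_{\theta_L,\theta_R}$. Dual process. $\widehat{\mathcal X}=\mathcal X\times\mathbb N_0^{\{L,R\}}$; $\widehat{\mathcal Y}=\{\xi\in\widehat{\mathcal X}:\xi(L)=\xi(R)=0\}$; $|\xi|=\xi(L)+\xi(R)+\sum_{x\in V}\xi(x)$. $\{\xi_t\}$ is the Markov process on $\widehat{\mathcal X}$ with generator $\widehat{\mathcal L}f(\xi)=\sum_{\{x,y\}:x\sim y}\omega_{\{x,y\}}\{\xi(x)(\alpha_y+\sigma\xi(y))(f(\xi-\delta_x+\delta_y)-f(\xi))+\xi(y)(\alpha_x+\sigma\xi(x))(f(\xi-\delta_y+\delta_x)-f(\xi))\}+\omega_L\alpha_L\xi(1)(f(\xi-\delta_1+\delta_L)-f(\xi))+\omega_R\alpha_R\xi(N)(f(\xi-\delta_N+\delta_R)-f(\xi))$.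 $\widehat{\mathbb P}_\zeta,\widehat{\mathbb E}_\zeta$ are its law and expectation started from $\zeta$; the trajectory is then written $\zeta_t$, and (for $\omega_L\vee\omega_R>0$) $\zeta_\infty$ is its a.s. limit, in which all particles sit in $\{L,R\}$. $\zeta\le\xi$ means $\zeta\in\widehat{\mathcal X}$ and $\zeta(x)\le\xi(x)$ for all $x\in V\cup\{L,R\}$. Interpolating product measure: $\mu_{\theta_L,\theta_R,\boldsymbol\beta}=\otimes_{x\in V}\nu_{x,\theta_x}$ with $\theta_x=\theta_R+\beta_x(\theta_L-\theta_R)$, where $\nu_{x,\theta}$ is Binomial$(\alpha_x,\theta)$ if $\sigma=-1$, Poisson$(\alpha_x\theta)$ if $\sigma=0$, and if $\sigma=1$ the Negative-Binomial law $\nu_{x,\theta}(n)=\frac{\Gamma(\alpha_x+n)}{\Gamma(\alpha_x)\,n!}\left(\frac{\theta}{1+\theta}\right)^n(1+\theta)^{-\alpha_x}$. Interpolating orthogonal functions: $D^{or}_{\theta_L,\theta_R,\boldsymbol\beta'}(\xi,\eta)=0^{\xi(L)}\left(\prod_{x\in V}d^{or}_{x,\theta'_x}(\xi(x),\eta(x))\right)0^{\xi(R)}$ with $\theta'_x=\theta_R+\beta'_x(\theta_L-\theta_R)$, where $d^{or}_{x,\theta}(k,n)=\sum_{\ell=0}^k\binom k\ell d^{c\ell}_x(\ell,n)(-\theta)^{k-\ell}$, $d^{c\ell}_x(\ell,n)=\frac{n!}{(n-\ell)!}\frac1{w_x(\ell)}\mathbf 1_{\{\ell\le n\}}$, and $w_x(\ell)=\frac{\alpha_x!}{(\alpha_x-\ell)!}$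 (for $\ell\le\alpha_x$) if $\sigma=-1$, $w_x(\ell)=\alpha_x^\ell$ if $\sigma=0$, $w_x(\ell)=\frac{\Gamma(\alpha_x+\ell)}{\Gamma(\alpha_x)}$ if $\sigma=1$. *)

(* Defs.v *)
From HB Require Import structures.
From mathcomp Require Import all_boot all_order all_algebra.
From mathcomp Require Import all_classical all_reals all_analysis.

Set Implicit Arguments.
Unset Strict Implicit.
Unset Printing Implicit Defensive.

Import Order.TTheory GRing.Theory Num.Theory.
Import numFieldNormedType.Exports.

Local Open Scope classical_set_scope.
Local Open Scope ring_scope.

(* The sum of a real family over D.  Since [+oo - +oo = -oo] in [\bar R],
   [csum D f = r%:E] entails that f is (absolutely) summable over D. *)
Definition csum (R : realType) (S : countType) (D : set S) (f : S -> R) : \bar R :=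
  (\esum_(x in D) (EFin \o f)^\+ x - \esum_(x in D) (EFin \o f)^\- x)%E.

Definition is_pmf (R : realType) (S : countType) (D : set S) (mu : S -> R) : Prop :=
  (forall x, D x -> 0 <= mu x) /\ (\esum_(x in D) (mu x)%:E = 1)%E.

(* p is the (honest) transition semigroup, on the countable state space D, of
   the Markov process with generator L: L is the pointwise right derivative at
   time 0 of the semigroup acting on bounded functions.  Only times t >= 0 and
   states in D are constrained. *)
Record markov_semigroup (R : realType) (S : countType) (D : set S)
    (p : R -> S -> S -> R) (L : (S -> R) -> S -> R) : Prop := MarkovSemigroup {
  semigroup_pmf : forall (t : R) x, 0 <= t -> D x -> is_pmf D (p t x);
  semigroup0 : forall x y, D x -> D y -> p 0 x y = (x == y)%:R;
  semigroupD : forall (s t : R) x z, 0 <= s -> 0 <= t -> D x -> D z ->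
    (\esum_(y in D) (p s x y * p t y z)%:E = (p (s + t) x z)%:E)%E;
  semigroup_generator : forall (f : S -> R),
    (exists M : R, forall y, D y -> `|f y| <= M) ->
    forall x, D x ->
      (fun t => t^-1 * (fine (csum D (fun y => p t x y * f y)) - f x))
        @ 0^'+ --> L f x }.

(* Under P, the D-valued process (X t)_(t >= 0) is Markov with transition
   semigroup p and initial law mu. *)
Record markov_process (R : realType) (S : countType) (D : set S)
    (p : R -> S -> S -> R) (mu : S -> R) (d : measure_display)
    (Omega : measurableType d) (P : probability Omega R) (X : R -> Omega -> S) :
    Prop := MarkovProcess {
  process_state : forall (t : R) w, 0 <= t -> D (X t w);
  process_measurable : forall (t : R) x, 0 <= t -> measurable [set w | X t w = x];
  process_fdd : forall (k : nat) (t : nat -> R) (x : nat -> S),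
    t 0%N = 0 -> (forall i, (i < k)%N -> t i <= t i.+1) ->
    (forall i, (i <= k)%N -> D (x i)) ->
    (P [set w | forall i, (i <= k)%N -> X (t i) w = x i] =
     (mu (x 0%N) * \prod_(i < k) p (t i.+1 - t i) (x i) (x i.+1))%:E)%E }.

Definition stationary (R : realType) (S : countType) (D : set S)
    (p : R -> S -> S -> R) (mu : S -> R) : Prop :=
  is_pmf D mu /\
  forall (t : R) y, 0 <= t -> D y -> (\esum_(x in D) (mu x * p t x y)%:E = (mu y)%:E)%E.

(* The vertex set {1, ..., N} is ['I_n.+1] with N = n.+1; the sites 1 and N are
   [ord0] and [ord_max]. *)
Record geometry (R : realType) (n : nat) := Geometry {
  omega : 'I_n.+1 -> 'I_n.+1 -> R;
  alpha : 'I_n.+1 -> nat;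
  omegaL : R;
  omegaR : R;
  alphaL : R;
  alphaR : R;
  omega_ge0 : forall x y, 0 <= omega x y;
  omega_sym : forall x y, omega x y = omega y x;
  omega_diag : forall x, omega x x = 0;
  omega_connected : forall x y, connect (fun u v => omega u v != 0) x y;
  alpha_gt0 : forall x, (0 < alpha x)%N;
  omegaL_ge0 : 0 <= omegaL;
  omegaR_ge0 : 0 <= omegaR;
  alphaL_gt0 : 0 < alphaL;
  alphaR_gt0 : 0 < alphaR }.

Definition Theta (R : realType) (sigma : int) : set R :=
  if sigma == -1 then [set` `[0, 1]] else [set` `[0, +oo[].

Definition interp (R : realType) (n : nat) (thetaL thetaR : R)
    (beta : 'I_n.+1 -> R) (x : 'I_n.+1) : R :=
  thetaR + beta x * (thetaL - thetaR).

Definition config (n : nat) := {ffun 'I_n.+1 -> nat}.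

Definition confs (R : realType) (n : nat) (sigma : int) (G : geometry R n) :
    set (config n) :=
  [set eta | sigma = -1 -> forall x, (eta x <= alpha G x)%N].

Definition addp (n : nat) (eta : config n) (x : 'I_n.+1) : config n :=
  [ffun z => (eta z + (z == x))%N].

(* The subtraction is truncated, but in the generators below the rate of a
   removal from an empty site, like that of a jump out of [confs], is 0. *)
Definition remp (n : nat) (eta : config n) (x : 'I_n.+1) : config n :=
  [ffun z => (eta z - (z == x))%N].

Definition occ_rate (R : realType) (n : nat) (sigma : int) (G : geometry R n)
    (eta : config n) (x : 'I_n.+1) : R :=
  (alpha G x)%:R + sigma%:~R * (eta x)%:R.

Definition genE (R : realType) (n : nat) (sigma : int) (G : geometry R n)
    (x y : 'I_n.+1) (f : config n -> R) (eta : config n) : R :=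
  (eta x)%:R * occ_rate sigma G eta y * (f (addp (remp eta x) y) - f eta) +
  (eta y)%:R * occ_rate sigma G eta x * (f (addp (remp eta y) x) - f eta).

(* Unordered pairs {x, y} are represented by x < y. *)
Definition gen_bulk (R : realType) (n : nat) (sigma : int) (G : geometry R n)
    (f : config n -> R) (eta : config n) : R :=
  \sum_(x < n.+1) \sum_(y < n.+1 | (x < y)%N && (omega G x y != 0))
    omega G x y * genE sigma G x y f eta.

Definition gen_reservoir (R : realType) (n : nat) (sigma : int) (G : geometry R n)
    (a theta : R) (x : 'I_n.+1) (f : config n -> R) (eta : config n) : R :=
  (eta x)%:R * a * (1 + sigma%:~R * theta) * (f (remp eta x) - f eta) +
  a * theta * occ_rate sigma G eta x * (f (addp eta x) - f eta).

Definition gen (R : realType) (n : nat) (sigma : int) (G : geometry R n)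
    (thetaL thetaR : R) (f : config n -> R) (eta : config n) : R :=
  gen_bulk sigma G f eta +
  omegaL G * gen_reservoir sigma G (alphaL G) thetaL ord0 f eta +
  omegaR G * gen_reservoir sigma G (alphaR G) thetaR ord_max f eta.

(* (xi, l, r): xi is the configuration on the vertices, l = xi(L), r = xi(R). *)
Definition dconfig (n : nat) := (config n * nat * nat)%type.

Definition bulk (n : nat) (xi : dconfig n) : config n := xi.1.1.
Definition atL (n : nat) (xi : dconfig n) : nat := xi.1.2.
Definition atR (n : nat) (xi : dconfig n) : nat := xi.2.

Definition dsize (n : nat) (xi : dconfig n) : nat :=
  (atL xi + atR xi + \sum_(x < n.+1) bulk xi x)%N.

Definition dle (n : nat) (zeta xi : dconfig n) : Prop :=
  [/\ forall x, (bulk zeta x <= bulk xi x)%N,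
      (atL zeta <= atL xi)%N & (atR zeta <= atR xi)%N].

Definition dconfs (R : realType) (n : nat) (sigma : int) (G : geometry R n) :
    set (dconfig n) :=
  [set xi | confs sigma G (bulk xi)].

Definition dconfs0 (R : realType) (n : nat) (sigma : int) (G : geometry R n) :
    set (dconfig n) :=
  [set xi | [/\ dconfs sigma G xi, atL xi = 0%N & atR xi = 0%N]].

Definition dgen (R : realType) (n : nat) (sigma : int) (G : geometry R n)
    (f : dconfig n -> R) (xi : dconfig n) : R :=
  gen_bulk sigma G (fun c => f (c, atL xi, atR xi)) (bulk xi) +
  omegaL G * alphaL G * (bulk xi ord0)%:R *
    (f (remp (bulk xi) ord0, (atL xi).+1, atR xi) - f xi) +
  omegaR G * alphaR G * (bulk xi ord_max)%:R *
    (f (remp (bulk xi) ord_max, atL xi, (atR xi).+1) - f xi).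

(* Z is the dual process, [Ph zeta] being its law when it starts from zeta. *)
Definition dual_process (R : realType) (n : nat) (sigma : int) (G : geometry R n)
    (d : measure_display) (Omega : measurableType d)
    (Ph : dconfig n -> probability Omega R) (Z : R -> Omega -> dconfig n) : Prop :=
  exists2 p : R -> dconfig n -> dconfig n -> R,
    markov_semigroup (dconfs sigma G) p (dgen sigma G) &
    forall zeta, dconfs sigma G zeta ->
      markov_process (dconfs sigma G) p (fun z => (z == zeta)%:R) (Ph zeta) Z.

(* Zinf is a random variable which is the almost sure limit of Z, in the
   discrete state space, whatever the initial state. *)
Definition dual_limit (R : realType) (n : nat) (sigma : int) (G : geometry R n)
    (d : measure_display) (Omega : measurableType d)
    (Ph : dconfig n -> probability Omega R) (Z : R -> Omega -> dconfig n)
    (Zinf : Omega -> dconfig n) : Prop :=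
  (forall z, measurable [set w | Zinf w = z]) /\
  forall zeta, dconfs sigma G zeta ->
    {ae Ph zeta, forall w, exists T : R, forall t : R, T <= t -> Z t w = Zinf w}.

(* The Poisson law is written out because [poisson_pmf 0] is not the Dirac mass
   at 0.  For sigma = 1, Gamma(a + k) = (a + k - 1)! as a is a positive natural. *)
Definition nu (R : realType) (sigma : int) (a : nat) (theta : R) (k : nat) : R :=
  if sigma == -1 then binomial_pmf a theta k
  else if sigma == 0 then
    (a%:R * theta) ^+ k / k`!%:R * expR (- (a%:R * theta))
  else
    ((a + k).-1)`!%:R / ((a.-1)`!%:R * k`!%:R) *
    (theta / (1 + theta)) ^+ k * (1 + theta) ^- a.

Definition mu_interp (R : realType) (n : nat) (sigma : int) (G : geometry R n)
    (thetaL thetaR : R) (beta : 'I_n.+1 -> R) (eta : config n) : R :=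
  \prod_(x < n.+1) nu sigma (alpha G x) (interp thetaL thetaR beta x) (eta x).

(* For sigma = -1 only l <= a is relevant. *)
Definition w_ (R : realType) (sigma : int) (a l : nat) : R :=
  if sigma == -1 then a`!%:R / (a - l)`!%:R
  else if sigma == 0 then a%:R ^+ l
  else ((a + l).-1)`!%:R / (a.-1)`!%:R.

Definition d_cl (R : realType) (sigma : int) (a l k : nat) : R :=
  if (l <= k)%N then k`!%:R / (k - l)`!%:R / w_ R sigma a l else 0.

Definition d_or (R : realType) (sigma : int) (a : nat) (theta : R) (k m : nat) : R :=
  \sum_(l < k.+1) 'C(k, l)%:R * d_cl R sigma a l m * (- theta) ^+ (k - l).

Definition D_or (R : realType) (n : nat) (sigma : int) (G : geometry R n)
    (thetaL thetaR : R) (beta : 'I_n.+1 -> R) (xi : dconfig n) (eta : config n) : R :=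
  0 ^+ atL xi *
  (\prod_(x < n.+1)
     d_or sigma (alpha G x) (interp thetaL thetaR beta x) (bulk xi x) (eta x)) *
  0 ^+ atR xi.

Definition psi_weight (R : realType) (n : nat) (beta' : 'I_n.+1 -> R)
    (xi zeta : dconfig n) : R :=
  (-1) ^+ (dsize xi - dsize zeta) *
  \prod_(x < n.+1)
    ('C(bulk xi x, bulk zeta x)%:R * beta' x ^+ (bulk xi x - bulk zeta x)).

Definition psi (R : realType) (n : nat) (d : measure_display)
    (Omega : measurableType d) (Ph : dconfig n -> probability Omega R)
    (Z : R -> Omega -> dconfig n) (t : R) (beta beta' : 'I_n.+1 -> R)
    (xi : dconfig n) : R :=
  \sum_(zeta \in [set zeta | dle zeta xi])
    psi_weight beta' xi zeta *
    fine 'E_(Ph zeta)[fun w =>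
      (atR (Z t w) == 0%N)%:R * \prod_(x < n.+1) beta x ^+ bulk (Z t w) x].

Definition psi_inf (R : realType) (n : nat) (d : measure_display)
    (Omega : measurableType d) (Ph : dconfig n -> probability Omega R)
    (Zinf : Omega -> dconfig n) (beta' : 'I_n.+1 -> R) (xi : dconfig n) : R :=
  \sum_(zeta \in [set zeta | dle zeta xi])
    psi_weight beta' xi zeta *
    fine (Ph zeta [set w | atL (Zinf w) = dsize zeta]).

(* Main.v *)
(* D^or(xi, .) is the binomial transform, with weights - theta'_x, of the
   classical duality functions D^cl(zeta, .), zeta <= xi.  By duality,
   E[D^cl(zeta, eta_t)] = E^_zeta[prod_x theta_x^(zeta_t(x))], where the
   reservoirs carry the parameters theta_L and theta_R.  All these parameters
   have the form theta_R + beta_x (theta_L - theta_R), and the dual process is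
   consistent: removing particles commutes with its dynamics, so that the
   constant theta_R can be taken out by another binomial transform with weight
   theta_R.  The two transforms compose to the one with weights
   - beta'_x (theta_L - theta_R), whence the homogeneous factor
   (theta_L - theta_R)^|xi|.

   Semigroups are only known through their action on bounded functions.  The
   unbounded functions D^cl are reached by truncation and a comparison principle
   for right-differentiable subsolutions of u' <= L u.  As t tends to infinity
   the dual particles are absorbed at L and R, and stationarity identifies the
   moments of the stationary measure. *)
Require Import Defs.
From HB Require Import structures.
From mathcomp Require Import all_boot all_order all_algebra.
From mathcomp Require Import all_classical all_reals all_analysis.
From mathcomp Require Import measurable_realfun ring lra.

Set Implicit Arguments.
Unset Strict Implicit.
Unset Printing Implicit Defensive.

Import Order.TTheory GRing.Theory Num.Theory.
Import numFieldNormedType.Exports.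

Local Open Scope classical_set_scope.
Local Open Scope ring_scope.

(** * Summable families *)

(** The only analytic information on a semigroup is a right derivative at time 0. The semigroup
    property moves it to every time, as a backward equation with one-sided derivatives; left
    continuity must be supplied separately, by a bound on increments that is uniform in time. With
    one-sided derivatives the mean value theorem is out of reach, so estimates are propagated by
    induction along the half-line. The dual side is finite: absorbed particles included, the number
    of dual particles is conserved, so each initial state lives in a finite closed class, where
    functions of any sign and size satisfy both Kolmogorov equations and uniqueness. Consistency is
    an identity between operators: the binomial transform is the exponential of a multiple of the
    annihilation operator, and the bulk generator contains creation operators only through their
    differences. For the stationary measure, finiteness of the moments has to be proved before
    duality can be integrated against it. *)

Lemma esumZl (R : realType) (T : choiceType) (D : set T) (c : R) (a : T -> \bar R) :
  0 <= c -> (forall x, D x -> 0 <= a x)%E ->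
  (\esum_(x in D) (c%:E * a x) = c%:E * \esum_(x in D) a x)%E.
Proof.
(* This inequality for every positive factor also yields the converse one, by taking the factor
   [c^-1]. *)
have le (e : R) (b : T -> \bar R) : 0 < e -> (forall x, D x -> 0 <= b x)%E ->
    (\esum_(x in D) (e%:E * b x) <= e%:E * \esum_(x in D) b x)%E.
  move=> e0 b0; apply: ge_ereal_sup => /= _ [X [finX XD] <-].
  have -> : (\sum_(x \in X) (e%:E * b x) = e%:E * \sum_(x \in X) b x)%E.
    rewrite !fsbig_finite//= !big_seq ge0_sume_distrr// => x.
    by rewrite in_fset_set// inE => /XD/b0.
  by rewrite lee_wpmul2l ?lee_fin ?(ltW e0)//; apply: ereal_sup_ubound; exists X.
rewrite le_eqVlt => /predU1P[<- _|c0 a0].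
  by rewrite mul0e esum1// => x _; rewrite mul0e.
apply/eqP; rewrite eq_le le//=.
rewrite -lee_pdivlMl//; apply: le_trans (le c^-1 _ _ _); rewrite ?invr_gt0//.
  by apply: le_esum => x Dx; rewrite muleA -EFinM mulVf ?gt_eqF// mul1e.
by move=> x Dx; rewrite mule_ge0 ?a0// lee_fin ltW.
Qed.

Lemma esum_exchange (R : realType) (T1 T2 : choiceType) (I : set T1) (J : set T2)
    (a : T1 -> T2 -> \bar R) : (forall i j, I i -> J j -> 0 <= a i j)%E ->
  (\esum_(i in I) \esum_(j in J) a i j = \esum_(j in J) \esum_(i in I) a i j)%E.
Proof.
move=> a0; rewrite (esum_esum (J := fun=> J))// (esum_esum (J := fun=> I))//; last first.
  by move=> j i Jj Ii; exact: a0.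
rewrite (reindex_esum (J `*`` (fun=> I)) _ (fun x => (x.2, x.1)))//; split=> //=.
- by move=> [i j] [/=].
- by move=> [i1 j1] [i2 j2] /= _ _ [-> ->].
- by move=> [i j] [Ii Jj] /=; exists (j, i).
Qed.

(** [csum] uses positive and negative parts, which are not additive. Any splitting into two
    nonnegative summable families yields the same value, and such splittings can be added and scaled
    term by term. *)
Definition hassum (R : realType) (T : countType) (D : set T) (f : T -> R) (r : R) :=
  exists g h a b, [/\ forall x, D x -> 0 <= g x /\ 0 <= h x,
    (\esum_(x in D) (g x)%:E = a%:E)%E, (\esum_(x in D) (h x)%:E = b%:E)%E,
    forall x, D x -> f x = g x - h x & r = a - b].

Lemma hassum_csum (R : realType) (T : countType) (D : set T) (f : T -> R) r :
  hassum D f r -> csum D f = r%:E.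
Proof.
move=> [g [h [a [b [gh0 ga hb fE ->]]]]]; rewrite /csum.
have sm (k : T -> R) c : (forall x, D x -> 0 <= k x) ->
    (\esum_(x in D) (k x)%:E = c%:E)%E -> summable D (EFin \o k).
  move=> k0 kc; rewrite /summable (_ : esum _ _ = c%:E) ?ltry// -kc.
  by apply: eq_esum => x Dx; rewrite /= ger0_norm ?k0.
have g0 x : D x -> 0 <= g x by move=> /gh0[].
have h0 x : D x -> 0 <= h x by move=> /gh0[].
rewrite EFinB -ga -hb.
have := @esumB _ _ D (EFin \o g) (EFin \o h) (sm _ _ g0 ga) (sm _ _ h0 hb).
rewrite /comp /=.
move=> <-; [|by move=> i Di; rewrite lee_fin g0|by move=> i Di; rewrite lee_fin h0].
by congr (_ - _)%E; apply: eq_esum => x Dx; rewrite ?funeposE ?funenegE fE// EFinB.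
Qed.

Lemma csum_ge0 (R : realType) (T : countType) (D : set T) (f : T -> R) :
  (forall x, D x -> 0 <= f x) -> csum D f = (\esum_(x in D) (f x)%:E)%E.
Proof.
move=> f0; rewrite /csum [X in (_ - X)%E]esum1 ?sube0.
  by apply: eq_esum => x Dx; rewrite funeposE max_l// lee_fin f0.
by move=> x Dx; rewrite funenegE max_r// /comp -EFinN lee_fin oppr_le0 f0.
Qed.

Lemma ge0_hassum (R : realType) (T : countType) (D : set T) (f : T -> R) r :
  (forall x, D x -> 0 <= f x) -> (\esum_(x in D) (f x)%:E = r%:E)%E -> hassum D f r.
Proof.
move=> f0 fr; exists f, (fun=> 0), r, 0; split => //; rewrite ?subr0//.
- by move=> x Dx; split; [exact: f0|].
- exact: esum1.
- by move=> x _; rewrite subr0.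
Qed.

Lemma eq_hassum (R : realType) (T : countType) (D : set T) (f f' : T -> R) r :
  (forall x, D x -> f x = f' x) -> hassum D f r -> hassum D f' r.
Proof.
move=> ff' [g [h [a [b [gh0 ga hb fE ->]]]]]; exists g, h, a, b; split=> //.
by move=> x Dx; rewrite -ff'// fE.
Qed.

Lemma hassum0 (R : realType) (T : countType) (D : set T) :
  hassum D (fun=> 0 : R) 0.
Proof. by apply: ge0_hassum => //; rewrite esum1. Qed.

Lemma hassumD (R : realType) (T : countType) (D : set T) (f f' : T -> R) r r' :
  hassum D f r -> hassum D f' r' -> hassum D (fun x => f x + f' x) (r + r').
Proof.
move=> [g [h [a [b [gh0 ga hb fE ->]]]]] [g' [h' [a' [b' [gh'0 ga' hb' fE' ->]]]]].
exists (fun x => g x + g' x), (fun x => h x + h' x), (a + a'), (b + b'); split.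
- by move=> x Dx; have [? ?] := gh0 x Dx; have [? ?] := gh'0 x Dx; rewrite !addr_ge0.
- rewrite EFinD -ga -ga' -esumD => [||].
  + by apply: eq_esum => x _; rewrite EFinD.
  + by move=> x /gh0[]; rewrite lee_fin.
  + by move=> x /gh'0[]; rewrite lee_fin.
- rewrite EFinD -hb -hb' -esumD => [||].
  + by apply: eq_esum => x _; rewrite EFinD.
  + by move=> x /gh0[]; rewrite lee_fin.
  + by move=> x /gh'0[]; rewrite lee_fin.
- by move=> x Dx; rewrite fE// fE'//; lra.
- by lra.
Qed.

Lemma hassumZ (R : realType) (T : countType) (D : set T) (f : T -> R) (c r : R) :
  hassum D f r -> hassum D (fun x => c * f x) (c * r).
Proof.
move=> [g [h [a [b [gh0 ga hb fE ->]]]]].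
have Z (k : T -> R) (e : R) (s : R) : 0 <= e -> (forall x, D x -> 0 <= k x) ->
    (\esum_(x in D) (k x)%:E = s%:E)%E -> (\esum_(x in D) (e * k x)%:E = (e * s)%:E)%E.
  move=> e0 k0 ks; rewrite EFinM -ks -esumZl//.
have g0 x : D x -> 0 <= g x by move=> /gh0[].
have h0 x : D x -> 0 <= h x by move=> /gh0[].
have [c0|c0] := leP 0 c.
  exists (fun x => c * g x), (fun x => c * h x), (c * a), (c * b); split.
  - by move=> x Dx; rewrite !mulr_ge0// ?g0 ?h0.
  - exact: Z.
  - exact: Z.
  - by move=> x Dx; rewrite fE// mulrBr.
  - by rewrite mulrBr.
have {}c0 : 0 <= - c by lra.
exists (fun x => - c * h x), (fun x => - c * g x), (- c * b), (- c * a); split.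
- by move=> x Dx; rewrite !mulr_ge0// ?g0 ?h0.
- exact: Z.
- exact: Z.
- by move=> x Dx; rewrite fE//; lra.
- by lra.
Qed.

Lemma hassum_sum (R : realType) (T : countType) (D : set T) (I : Type) (s : seq I)
    (P : pred I) (f : I -> T -> R) (r : I -> R) :
  (forall i, P i -> hassum D (f i) (r i)) ->
  hassum D (fun x => \sum_(i <- s | P i) f i x) (\sum_(i <- s | P i) r i).
Proof.
move=> fr; elim: s => [|i s IH].
  by rewrite big_nil; apply: eq_hassum (hassum0 R D) => x _; rewrite big_nil.
rewrite big_cons; case: ifPn => [Pi|nPi].
  by apply: eq_hassum (hassumD (fr i Pi) IH) => x _; rewrite big_cons Pi.
by apply: eq_hassum IH => x _; rewrite big_cons (negbTE nPi).
Qed.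

(** * Jump generators and the comparison principle *)

(** Finitely many nonnegative rates out of [x]. Only targets of nonzero rate must lie in [D]:
    truncated subtraction and full sites produce meaningless targets, but with rate 0. *)
Definition jump_at (R : realType) (S : countType) (D : set S)
    (L : (S -> R) -> S -> R) (x : S) : Prop :=
  exists J : seq (R * S),
    (forall q, q \in J -> 0 <= q.1 /\ (q.1 != 0 -> D q.2)) /\
    forall f, L f x = \sum_(q <- J) q.1 * (f q.2 - f x).

Lemma jump_at_sum (R : realType) (S : countType) (D : set S) (L : (S -> R) -> S -> R)
    (x : S) (I : Type) (s : seq I) (c : I -> R) (f : I -> S -> R) :
  jump_at D L x -> L (fun y => \sum_(i <- s) c i * f i y) x = \sum_(i <- s) c i * L (f i) x.
Proof.
move=> [J [_ LE]]; rewrite LE.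
under [RHS]eq_bigr do rewrite LE mulr_sumr.
rewrite exchange_big /=; apply: eq_bigr => q _.
rewrite -sumrB mulr_sumr; apply: eq_bigr => i _; ring.
Qed.

Lemma jump_atB (R : realType) (S : countType) (D : set S) (L : (S -> R) -> S -> R)
    (x : S) (c : R) (f g : S -> R) :
  jump_at D L x -> L (fun y => f y - c * g y) x = L f x - c * L g x.
Proof.
move=> [J [_ LE]]; rewrite !LE mulr_sumr -sumrB; apply: eq_bigr => q _; ring.
Qed.

Lemma jump_at_max (R : realType) (S : countType) (D : set S) (L : (S -> R) -> S -> R)
    (x : S) (f : S -> R) :
  jump_at D L x -> (forall y, D y -> f y <= f x) -> L f x <= 0.
Proof.
move=> [J [J0 ->]] fx; rewrite big_seq; apply: sumr_le0 => q /J0[q0 qD].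
have [->|/qD/fx] := eqVneq q.1 0; first by rewrite mul0r.
by move=> ?; rewrite mulr_ge0_le0// subr_le0.
Qed.

Lemma jump_at_local (R : realType) (S : countType) (D : set S) (L : (S -> R) -> S -> R)
    (x : S) (f g : S -> R) :
  jump_at D L x -> D x -> (forall y, D y -> f y = g y) -> L f x = L g x.
Proof.
move=> [J [J0 LE]] Dx fg; rewrite !LE; apply: eq_big_seq => q /J0[_ qD].
have [->|/qD/fg ->] := eqVneq q.1 0; first by rewrite !mul0r.
by rewrite fg.
Qed.

Lemma jump_at_cst (R : realType) (S : countType) (D : set S) (L : (S -> R) -> S -> R)
    (x : S) (c : R) : jump_at D L x -> L (fun=> c) x = 0.
Proof. by move=> [J [_ ->]]; rewrite big1// => q _; rewrite subrr mulr0. Qed.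

Lemma jump_at_step (R : realType) (S : countType) (D : set S) (x y : S) (r : R) :
  0 <= r -> (r != 0 -> D y) -> jump_at D (fun f x => r * (f y - f x)) x.
Proof.
move=> r0 ry; exists [:: (r, y)]; split => [q|f]; last by rewrite big_seq1.
by rewrite inE => /eqP ->.
Qed.

Lemma jump_atD (R : realType) (S : countType) (D : set S) (L L' : (S -> R) -> S -> R)
    (x : S) : jump_at D L x -> jump_at D L' x ->
  jump_at D (fun f x => L f x + L' f x) x.
Proof.
move=> [J [J0 LE]] [J' [J0' LE']]; exists (J ++ J'); split => [q|f].
  by rewrite mem_cat => /orP[/J0|/J0'].
by rewrite LE LE' big_cat.
Qed.

Lemma jump_atZ (R : realType) (S : countType) (D : set S) (L : (S -> R) -> S -> R)
    (c : R) (x : S) : 0 <= c -> jump_at D L x -> jump_at D (fun f x => c * L f x) x.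
Proof.
move=> c0 [J [J0 LE]]; exists [seq (c * q.1, q.2) | q <- J]; split => [q|f].
  move=> /mapP[p /J0[p0 pD] ->] /=; split; first exact: mulr_ge0.
  by rewrite mulf_eq0 negb_or => /andP[_ /pD].
by rewrite LE big_map mulr_sumr; apply: eq_bigr => q _; rewrite mulrA.
Qed.

Lemma jump_at_bigD (R : realType) (S : countType) (D : set S) (I : Type) (s : seq I)
    (P : pred I) (L : I -> (S -> R) -> S -> R) (x : S) :
  (forall i, P i -> jump_at D (L i) x) ->
  jump_at D (fun f x => \sum_(i <- s | P i) L i f x) x.
Proof.
move=> Li; elim: s => [|i s [J [J0 LE]]].
  by exists [::]; split => // f; rewrite !big_nil.
have [Pi|nPi] := boolP (P i).
  have [J' [J0' LE']] := Li i Pi; exists (J' ++ J); split => [q|f].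
    by rewrite mem_cat => /orP[/J0'|/J0].
  by rewrite big_cons Pi LE LE' big_cat.
by exists J; split => // f; rewrite big_cons (negbTE nPi) LE.
Qed.

(** * One-sided derivatives and continuity in time, and the maximum principle *)

Lemma cvg_bigsum (R : realType) (T I : Type) (F : set_system T) (FF : Filter F)
    (s : seq I) (P : pred I) (f : I -> T -> R) (l : I -> R) :
  (forall i, P i -> f i x @[x --> F] --> l i) ->
  \sum_(i <- s | P i) f i x @[x --> F] --> \sum_(i <- s | P i) l i.
Proof.
move=> fl; elim: s => [|i s IH].
  by under eq_fun do rewrite big_nil; rewrite big_nil; exact: cvg_cst.
under eq_fun do rewrite big_cons; rewrite big_cons.
by case: ifPn => // Pi; apply: cvgD => //; exact: fl.
Qed.

Definition rderiv (R : realType) (u : R -> R) (t l : R) : Prop :=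
  (fun h => h^-1 * (u (t + h) - u t)) @ 0^'+ --> l.

Definition lcont (R : realType) (u : R -> R) (t : R) : Prop := u s @[s --> t^'-] --> u t.

Lemma rderivD (R : realType) (u v : R -> R) (t l m : R) :
  rderiv u t l -> rderiv v t m -> rderiv (fun s => u s + v s) t (l + m).
Proof.
rewrite /rderiv => ul vm.
have -> : (fun h => h^-1 * (u (t + h) + v (t + h) - (u t + v t))) =
    (fun h => h^-1 * (u (t + h) - u t) + h^-1 * (v (t + h) - v t)).
  by apply/funext => h; ring.
exact: cvgD.
Qed.

Lemma rderivZ (R : realType) (c : R) (u : R -> R) (t l : R) :
  rderiv u t l -> rderiv (fun s => c * u s) t (c * l).
Proof.
rewrite /rderiv => ul.
have -> : (fun h => h^-1 * (c * u (t + h) - c * u t)) =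
    (fun h => c * (h^-1 * (u (t + h) - u t))) by apply/funext => h; ring.
exact: cvgMl_tmp.
Qed.

Lemma rderiv_cst (R : realType) (c t : R) : rderiv (fun=> c) t 0.
Proof.
rewrite /rderiv (_ : (fun _ => _) = cst 0); first exact: cvg_cst.
by apply/funext => h; rewrite subrr mulr0.
Qed.

Lemma rderivB (R : realType) (c : R) (u v : R -> R) (t l m : R) :
  rderiv u t l -> rderiv v t m -> rderiv (fun s => u s - c * v s) t (l - c * m).
Proof.
move=> ul /(@rderivZ _ (- c)); rewrite mulNr => /(rderivD ul).
by rewrite (_ : (fun _ => _) = fun s => u s - c * v s)//; apply/funext => s; rewrite mulNr.
Qed.

Lemma rderiv_sum (R : realType) (I : Type) (s : seq I) (P : pred I) (c : I -> R)
    (u : I -> R -> R) (t : R) (l : I -> R) :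
  (forall i, P i -> rderiv (u i) t (l i)) ->
  rderiv (fun r => \sum_(i <- s | P i) c i * u i r) t (\sum_(i <- s | P i) c i * l i).
Proof.
move=> ul; elim: s => [|i s IH].
  rewrite big_nil (_ : (fun _ => _) = fun=> 0); first exact: rderiv_cst.
  by apply/funext => r; rewrite big_nil.
rewrite big_cons; case: ifPn => Pi; last first.
  rewrite (_ : (fun _ => _) = fun r => \sum_(i <- s | P i) c i * u i r)//.
  by apply/funext => r; rewrite big_cons (negbTE Pi).
rewrite (_ : (fun _ => _) = fun r => c i * u i r + \sum_(i <- s | P i) c i * u i r).
  by apply: rderivD IH; apply: rderivZ; exact: ul.
by apply/funext => r; rewrite big_cons Pi.
Qed.

Lemma lcontB (R : realType) (c : R) (u v : R -> R) (t : R) :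
  lcont u t -> lcont v t -> lcont (fun s => u s - c * v s) t.
Proof. by move=> ut vt; apply: cvgB => //; apply: cvgMl_tmp. Qed.

Lemma lcont_cst (R : realType) (c t : R) : lcont (fun=> c) t.
Proof. exact: cvg_cst. Qed.

Lemma lcont_sum (R : realType) (I : Type) (s : seq I) (P : pred I) (c : I -> R)
    (u : I -> R -> R) (t : R) :
  (forall i, P i -> lcont (u i) t) -> lcont (fun r => \sum_(i <- s | P i) c i * u i r) t.
Proof.
by move=> ut; apply: cvg_bigsum => i Pi; apply: cvgMl_tmp; exact: ut.
Qed.

Lemma rderiv_rcont (R : realType) (u : R -> R) (t l : R) :
  rderiv u t l -> u (t + h) @[h --> 0^'+] --> u t.
Proof.
move=> ul.
have h0 : (h @[h --> 0^'+] : set_system R) --> (0 : R).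
  exact: cvg_at_right_filter cvg_id.
have : h * (h^-1 * (u (t + h) - u t)) + u t @[h --> 0^'+] --> 0 * l + u t.
  by apply: cvgD; [exact: cvgM | exact: cvg_cst].
rewrite mul0r add0r => H; apply: cvg_trans H; apply: near_eq_cvg.
near=> h; rewrite /= mulrA divff ?mul1r ?subrK//.
Unshelve. all: by end_near. Qed.

Lemma rderiv_expR (R : realType) (c t : R) :
  rderiv (fun s => expR (c * s)) t (c * expR (c * t)).
Proof.
have [/= df dE] : is_derive t 1 (expR \o (c \*: @id R)) (expR (c * t) * (c *: (1 : R))).
  exact: is_derive1_comp.
have /cvg_dnbhs_at_right H : (fun h => h^-1 *: ((expR \o (c \*: @id R) \o shift t) (h *: 1) -
    (expR \o (c \*: @id R)) t)) @ 0^' --> expR (c * t) * (c *: (1 : R)).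
  by rewrite -dE; exact: df.
have -> : c * expR (c * t) = expR (c * t) * (c *: (1 : R)).
  by rewrite /GRing.scale /= mulr1 mulrC.
apply: cvg_trans H; apply: near_eq_cvg; apply: nearW => h /=.
by rewrite /GRing.scale /= mulr1 [h + t]addrC.
Qed.

(** A property that passes to the left limit and survives a small step to the right holds on all of
    [0, T]: the supremum of the times up to which it holds cannot be less than [T]. *)
Lemma real_induction (R : realType) (T : R) (A : R -> Prop) :
  A 0 ->
  (forall t : R, 0 < t -> t <= T -> (forall s : R, 0 <= s -> s < t -> A s) -> A t) ->
  (forall t : R, 0 <= t -> t < T -> A t ->
    exists2 e : R, 0 < e & forall h : R, 0 < h -> h < e -> A (t + h)) ->
  forall t : R, 0 <= t -> t <= T -> A t.
Proof.
move=> A0 Al Ar t t0 tT.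
pose E := [set s | [/\ 0 <= s, s <= T & forall r, 0 <= r -> r <= s -> A r]].
have T0 : 0 <= T by exact: le_trans tT.
have E0 : E 0 by split => // r r0 r0'; rewrite (_ : r = 0)//; lra.
have supE : has_sup E by split; [exists 0 | exists T => s []].
set m := sup E.
have m0 : 0 <= m by apply: sup_ubound => //; exact: (supE.2).
have mT : m <= T by apply: ge_sup; [exists 0 | move=> s []].
have Altm s : 0 <= s -> s < m -> A s.
  move=> s0 sm; have [|r [r0 rT rA] mr] := @sup_adherent _ E (m - s) _ supE.
    by rewrite subr_gt0.
  by apply: rA => //; rewrite /m in mr sm *; lra.
have Am : A m.
  by move: m0; rewrite le_eqVlt => /predU1P[<-//|m0]; exact: Al.
have Alem s : 0 <= s -> s <= m -> A s.
  by move=> s0; rewrite le_eqVlt => /predU1P[->//|]; exact: Altm.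
have [mlT|Tm] := ltP m T; last by apply: Alem => //; lra.
have [e e0 eA] := Ar _ m0 mlT Am.
pose d := Num.min (e / 2) (T - m).
have d0 : 0 < d by rewrite lt_min divr_gt0//= subr_gt0.
have de : d < e by rewrite gt_min; apply/orP; left; lra.
have dT : d <= T - m by rewrite ge_min lexx orbT.
have : E (m + d).
  split; [lra|lra|] => r r0 rmd.
  have [rm|mr] := leP r m; first exact: Alem.
  by rewrite (_ : r = m + (r - m)); [apply: eA; lra|ring].
move=> Emd; have : m + d <= m by apply: sup_ubound => //; exact: (supE.2).
lra.
Qed.

(* Maximum principle: [w] below stays negative up to time [T], since at a first
   zero [x] is a maximum point, where [L] is nonpositive, so that [w] decreases
   strictly. *)
Theorem comparison (R : realType) (S : countType) (D : set S)
    (L : (S -> R) -> S -> R) (W : S -> R) (C delta T : R) (v : R -> S -> R) :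
  0 < delta -> 0 <= C ->
  (forall x, D x -> jump_at D L x) ->
  (forall x, D x -> 0 < W x) -> (forall x, D x -> L W x <= C * W x) ->
  (forall x, D x -> v 0 x <= delta * W x) ->
  (forall (t : R) x, 0 <= t -> D x -> exists2 l, rderiv (v^~ x) t l & l <= L (v t) x) ->
  (forall (t : R) x, 0 < t -> D x -> lcont (v^~ x) t) ->
  finite_set [set x | D x /\ exists t : R, [/\ 0 <= t, t <= T & delta * W x < v t x]] ->
  forall (t : R) x, 0 <= t -> t <= T -> D x -> v t x <= delta * expR ((C + 1) * t) * W x.
Proof.
move=> delta0 C0 LJ W0 LW v0 vr vl; set B := [set x | _] => finB.
pose w t x := v t x - (delta * W x) * expR ((C + 1) * t).
(* Outside [B] the function [v] never exceeds [delta * W], so only states of [B] can violate the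
   bound. *)
have wB t x : 0 <= t -> t <= T -> D x -> ~ B x -> w t x <= 0.
  move=> t0 tT Dx nBx; rewrite /w subr_le0; apply: (@le_trans _ _ (delta * W x)).
    by rewrite leNgt; apply/negP => ?; apply: nBx; split => //; exists t.
  rewrite ler_peMr ?(mulr_ge0 (ltW delta0) (ltW (W0 _ Dx)))//.
  by rewrite -expR0 ler_expR mulr_ge0// addr_ge0.
suff H : forall t, 0 <= t -> t <= T -> forall x, D x -> w t x <= 0.
  by move=> t x t0 tT Dx; have := H t t0 tT x Dx; rewrite /w; lra.
have expcont (t : R) : lcont (fun s => expR ((C + 1) * s)) t.
  apply: cvg_at_left_filter; apply: continuous_comp; last exact: continuous_expR.
  exact: mulrl_continuous.
apply: real_induction => [x Dx|t t0 tT H x Dx|t t0 tT H].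
- by rewrite /w mulr0 expR0 mulr1 subr_le0 v0.
- have /(@lcontB _ (delta * W x))/(_ (expcont t)) : lcont (v^~ x) t by exact: vl.
  move=> wt; apply: (cvgr_to_le wt) => /=.
  near=> s.
  have s0 : 0 <= s by near: s; exact: nbhs_left_ge.
  have st : s < t by near: s; exact: nbhs_left_lt.
  exact: H.
- have near1 x : D x -> \forall h \near 0^'+, w (t + h) x <= 0.
    move=> Dx.
    have [l lv lL] := vr t x t0 Dx.
    have ld := @rderivB _ (delta * W x) _ _ _ _ _ lv (@rderiv_expR _ (C + 1) t).
    move: (H x Dx); rewrite le_eqVlt => /predU1P[wx0|wx0]; last first.
      have /cvgr_lt := rderiv_rcont ld.
      move=> /(_ 0 wx0); apply: filterS => h; exact: ltW.
    have Lw : L (w t) x <= 0 by apply: jump_at_max (LJ x Dx) _ => y Dy; rewrite wx0 H.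
    have {}Lw : L (v t) x <= delta * expR ((C + 1) * t) * (C * W x).
      have e0 : 0 <= delta * expR ((C + 1) * t) by rewrite mulr_ge0 ?expR_ge0// ltW.
      apply: le_trans (ler_wpM2l e0 (LW x Dx)).
      rewrite -subr_le0 -(jump_atB _ _ _ (LJ x Dx)); apply: le_trans Lw.
      by rewrite le_eqVlt; apply/orP; left; apply/eqP; congr (L _ _);
        apply/funext => y; rewrite /w; ring.
    have e0 : 0 < delta * expR ((C + 1) * t) * W x.
      by rewrite !mulr_gt0 ?expR_gt0// W0.
    (* The rate [C + 1] in the exponent, one more than the rate of [W], makes this derivative
       strictly negative. *)
    have /(cvgr_lt _ ld) : (l - delta * W x * ((C + 1) * expR ((C + 1) * t))) < 0 by nra.
    move=> near0; near=> h.
    have h0 : 0 < h by near: h; exact: nbhs_right_gt.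
    have : h^-1 * (w (t + h) x - w t x) < 0 by near: h.
    by rewrite wx0 subr0 pmulr_rlt0 ?invr_gt0// => /ltW.
  (* The right neighbourhoods found state by state have a common one because [B] is finite. *)
  have near2 : \forall h \near 0^'+, forall x, D x -> B x -> w (t + h) x <= 0.
    have /finite_seqP[s Bs] := finB; rewrite Bs {Bs finB}.
    elim: s => [|x s IH]; first by near=> h.
    have [Dx|nDx] := pselect (D x); last first.
      apply: filterS IH => h IH y Dy; rewrite /= inE => /predU1P[yx|/IH]; last exact.
      by rewrite yx in Dy.
    near=> h => y Dy; rewrite /= inE => /predU1P[->|ys].
      by near: h; exact: near1.
    by move: y Dy ys; near: h; exact: IH.
  have [e /= e0 eP] := near2.
  exists (Num.min e (T - t)); first by rewrite lt_min e0 subr_gt0.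
  move=> h h0; rewrite lt_min => /andP[he hT] x Dx.
  have [Bx|nBx] := pselect (B x); last by apply: wB => //; lra.
  by apply: eP => //=; rewrite sub0r normrN gtr0_norm.
Unshelve. all: by end_near. Qed.

(** * Semigroups acting on bounded functions *)

Lemma le_sum_esum (R : realType) (S : choiceType) (D : set S) (s : seq S) (g : S -> R) :
  uniq s -> (forall x, D x -> 0 <= g x) -> (forall x, x \in s -> D x) ->
  ((\sum_(x <- s) g x)%:E <= \esum_(x in D) (g x)%:E)%E.
Proof.
move=> us g0 sD; apply: esum_ge; exists [set` s].
  by split; [exact: finite_seq|move=> x /= /sD].
by rewrite -fsbig_seq// sumEFin.
Qed.

Lemma pmf_esum (R : realType) (S : countType) (D : set S) (mu f : S -> R) (M : R) :
  is_pmf D mu -> (forall y, D y -> 0 <= f y <= M) ->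
  exists2 r, 0 <= r <= M & (\esum_(y in D) (mu y * f y)%:E = r%:E)%E.
Proof.
move=> [mu0 mu1] fM.
have M0 : 0 <= M.
  apply: contrapT => M0; suff : (\esum_(y in D) (mu y)%:E = 0)%E.
    by rewrite mu1 => /eqP; rewrite onee_eq0.
  apply: esum1 => y /fM /andP[f0 f1]; exfalso; apply: M0; exact: le_trans f1.
have ge0 : (0 <= \esum_(y in D) (mu y * f y)%:E)%E.
  by apply: esum_ge0 => y Dy; rewrite lee_fin mulr_ge0 ?mu0//; case/andP: (fM y Dy).
have leM : (\esum_(y in D) (mu y * f y)%:E <= M%:E)%E.
  apply: (@le_trans _ _ (\esum_(y in D) (M%:E * (mu y)%:E))%E).
    apply: le_esum => y Dy; rewrite -EFinM lee_fin mulrC ler_wpM2r ?mu0//.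
    by case/andP: (fM y Dy).
  by rewrite esumZl// ?mu1 ?mule1// => y Dy; rewrite lee_fin mu0.
have fin : \esum_(y in D) (mu y * f y)%:E \is a fin_num.
  by rewrite ge0_fin_numE// (le_lt_trans leM)// ltry.
exists (fine (\esum_(y in D) (mu y * f y)%:E)); last by rewrite fineK.
by rewrite -2!lee_fin fineK// ge0 leM.
Qed.

(** [fine] sends an infinite sum to 0, so this is the semigroup only where the sum is finite, as it
    is for the bounded nonnegative functions considered below. *)
Definition Pt (R : realType) (S : countType) (D : set S) (p : R -> S -> S -> R)
    (t : R) (f : S -> R) (x : S) : R := fine (\esum_(y in D) (p t x y * f y)%:E).

Lemma PtE (R : realType) (S : countType) (D : set S) (p : R -> S -> S -> R)
    (L : (S -> R) -> S -> R) (M t : R) (f : S -> R) (x : S) :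
  markov_semigroup D p L -> (forall y, D y -> 0 <= f y <= M) -> 0 <= t -> D x ->
  (\esum_(y in D) (p t x y * f y)%:E = (Pt D p t f x)%:E)%E.
Proof.
move=> Hp fM t0 Dx.
by have [r _ e] := pmf_esum (semigroup_pmf Hp t0 Dx) fM; rewrite /Pt e.
Qed.

Lemma Pt_bound (R : realType) (S : countType) (D : set S) (p : R -> S -> S -> R)
    (L : (S -> R) -> S -> R) (M t : R) (f : S -> R) (x : S) :
  markov_semigroup D p L -> (forall y, D y -> 0 <= f y <= M) -> 0 <= t -> D x ->
  0 <= Pt D p t f x <= M.
Proof.
move=> Hp fM t0 Dx.
by have [r r0 e] := pmf_esum (semigroup_pmf Hp t0 Dx) fM; rewrite /Pt e.
Qed.

Lemma semigroup_ge0 (R : realType) (S : countType) (D : set S) (p : R -> S -> S -> R)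
    (L : (S -> R) -> S -> R) (t : R) (x y : S) :
  markov_semigroup D p L -> 0 <= t -> D x -> D y -> 0 <= p t x y.
Proof. by move=> Hp t0 Dx; apply: (semigroup_pmf Hp t0 Dx).1. Qed.

Lemma esum_semigroupD (R : realType) (S : countType) (D : set S) (p : R -> S -> S -> R)
    (L : (S -> R) -> S -> R) (s t : R) (f : S -> R) (x : S) :
  markov_semigroup D p L -> (forall y, D y -> 0 <= f y) -> 0 <= s -> 0 <= t -> D x ->
  (\esum_(y in D) (p (s + t) x y * f y)%:E =
   \esum_(z in D) ((p s x z)%:E * \esum_(y in D) (p t z y * f y)%:E))%E.
Proof.
move=> Hp f0 s0 t0 Dx.
have pos r z y : 0 <= r -> D z -> D y -> 0 <= p r z y by exact: semigroup_ge0 Hp.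
transitivity (\esum_(y in D) \esum_(z in D) (p s x z * p t z y * f y)%:E)%E.
  apply: eq_esum => y Dy; rewrite mulrC EFinM -(semigroupD Hp s0 t0 Dx Dy) -esumZl ?f0//.
    by apply: eq_esum => z _; rewrite -EFinM mulrC.
  by move=> z Dz; rewrite lee_fin mulr_ge0// pos.
rewrite esum_exchange; last first.
  by move=> y z Dy Dz; rewrite lee_fin !mulr_ge0// ?f0// pos.
apply: eq_esum => z Dz; rewrite -esumZl ?pos//.
  by apply: eq_esum => y Dy; rewrite -EFinM mulrA.
by move=> y Dy; rewrite lee_fin mulr_ge0 ?f0// pos.
Qed.

Lemma PtD (R : realType) (S : countType) (D : set S) (p : R -> S -> S -> R)
    (L : (S -> R) -> S -> R) (M s t : R) (f : S -> R) (x : S) :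
  markov_semigroup D p L -> (forall y, D y -> 0 <= f y <= M) ->
  0 <= s -> 0 <= t -> D x ->
  Pt D p (s + t) f x = Pt D p s (Pt D p t f) x.
Proof.
move=> Hp fM s0 t0 Dx; rewrite {1}/Pt (esum_semigroupD Hp)//; last first.
  by move=> y /fM /andP[].
congr fine; apply: eq_esum => z Dz.
by rewrite (PtE Hp fM)// EFinM.
Qed.

Lemma Pt1E (R : realType) (S : countType) (D : set S) (p : R -> S -> S -> R)
    (L : (S -> R) -> S -> R) (t : R) (x z : S) :
  markov_semigroup D p L -> 0 <= t -> D x -> D z ->
  Pt D p t (fun y => (y == z)%:R) x = p t x z.
Proof.
move=> Hp t0 Dx Dz; rewrite /Pt (esumID [set z]); last first.
  by move=> y Dy; rewrite lee_fin mulr_ge0// (semigroup_ge0 Hp).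
rewrite [X in (_ + X)%E]esum1 ?adde0; last first.
  by move=> y [_ /= /eqP/negbTE ->]; rewrite mulr0.
rewrite (_ : D `&` [set z] = [set z]); last by apply/seteqP; split => [y []|y ->].
by rewrite esum_set1 eqxx mulr1//= lee_fin (semigroup_ge0 Hp).
Qed.

Lemma Pt0 (R : realType) (S : countType) (D : set S) (p : R -> S -> S -> R)
    (L : (S -> R) -> S -> R) (f : S -> R) (x : S) :
  markov_semigroup D p L -> (forall y, D y -> 0 <= f y) -> D x -> Pt D p 0 f x = f x.
Proof.
move=> Hp f0 Dx; rewrite /Pt (esumID [set x]); last first.
  by move=> y Dy; rewrite lee_fin mulr_ge0 ?f0// (semigroup_ge0 Hp).
rewrite [X in (_ + X)%E]esum1 ?adde0; last first.
  move=> y [Dy /= yx]; rewrite (semigroup0 Hp)//.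
  by rewrite [x == y]eq_sym; move/eqP/negbTE: yx => ->; rewrite mul0r.
rewrite (_ : D `&` [set x] = [set x]); last by apply/seteqP; split => [y []|y ->].
by rewrite esum_set1 (semigroup0 Hp)// eqxx mul1r//= lee_fin f0.
Qed.

Lemma Pt_generator (R : realType) (S : countType) (D : set S) (p : R -> S -> S -> R)
    (L : (S -> R) -> S -> R) (M : R) (f : S -> R) (x : S) :
  markov_semigroup D p L -> (forall y, D y -> 0 <= f y <= M) -> D x ->
  (fun h => h^-1 * (Pt D p h f x - f x)) @ 0^'+ --> L f x.
Proof.
move=> Hp fM Dx; have := @semigroup_generator _ _ _ _ _ Hp f.
case/(_ _ x Dx)/Wrap; first by exists M => y /fM /andP[f0 f1]; rewrite ger0_norm.
move=> H; apply: cvg_trans H; apply: near_eq_cvg.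
near=> h; have h0 : 0 <= h by near: h; exact: nbhs_right_ge.
rewrite /= csum_ge0// => y Dy; rewrite mulr_ge0//; first exact: (semigroup_ge0 Hp).
by case/andP: (fM y Dy).
Unshelve. all: by end_near. Qed.

(** The increment after [t] is the increment after 0 for the function [Pt D p t f], which is again
    bounded; this turns the generator limit into the backward equation. *)
Lemma Pt_rderiv (R : realType) (S : countType) (D : set S) (p : R -> S -> S -> R)
    (L : (S -> R) -> S -> R) (M t : R) (f : S -> R) (x : S) :
  markov_semigroup D p L -> (forall y, D y -> 0 <= f y <= M) -> 0 <= t -> D x ->
  rderiv (fun s => Pt D p s f x) t (L (Pt D p t f) x).
Proof.
move=> Hp fM t0 Dx.
have gM y : D y -> 0 <= Pt D p t f y <= M by exact: Pt_bound Hp fM t0.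
have H := Pt_generator Hp gM Dx; apply: cvg_trans H; apply: near_eq_cvg.
near=> h; have h0 : 0 <= h by near: h; exact: nbhs_right_ge.
by rewrite /= [t + h]addrC (PtD Hp fM).
Unshelve. all: by end_near. Qed.

(** Continuity at time 0 comes from the generator limit for the indicator of [x], since a right
    derivative forces right continuity. *)
Lemma semigroup_diag (R : realType) (S : countType) (D : set S) (p : R -> S -> S -> R)
    (L : (S -> R) -> S -> R) (x : S) :
  markov_semigroup D p L -> D x -> p h x x @[h --> 0^'+] --> (1 : R).
Proof.
move=> Hp Dx.
have fM y : D y -> 0 <= ((y == x)%:R : R) <= 1 by rewrite ler0n lern1 leq_b1.
have H := rderiv_rcont (Pt_rderiv Hp fM (lexx 0) Dx).
rewrite (Pt0 Hp)// eqxx in H; apply: cvg_trans H; apply: near_eq_cvg.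
near=> h; have h0 : 0 <= h by near: h; exact: nbhs_right_ge.
by rewrite /= add0r (Pt1E Hp).
Unshelve. all: by end_near. Qed.

(** The term [y = x] alone contributes [p h x x * g x] to the sum. This lower bound, for [g] and for
    [M - g], confines the increment, and it does not depend on [t]. *)
Lemma Pt_increment (R : realType) (S : countType) (D : set S) (p : R -> S -> S -> R)
    (L : (S -> R) -> S -> R) (M t h : R) (f : S -> R) (x : S) :
  markov_semigroup D p L -> (forall y, D y -> 0 <= f y <= M) ->
  0 <= t -> 0 <= h -> D x ->
  `|Pt D p (t + h) f x - Pt D p t f x| <= M * (1 - p h x x).
Proof.
move=> Hp fM t0 h0 Dx; rewrite [t + h]addrC (PtD Hp fM)//.
set g := Pt D p t f.
have gM y : D y -> 0 <= g y <= M by exact: Pt_bound Hp fM t0.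
have pxx : p h x x <= 1.
  rewrite -(Pt1E Hp)//; suff /andP[] : 0 <= Pt D p h (fun y => (y == x)%:R) x <= 1 by [].
  by apply: (Pt_bound Hp) => // y _; rewrite ler0n lern1 leq_b1.
have pxx0 : 0 <= p h x x by exact: (semigroup_ge0 Hp).
have low k : (forall y, D y -> 0 <= k y <= M) -> p h x x * k x <= Pt D p h k x.
  move=> kM; rewrite -lee_fin -(PtE Hp kM)//.
  have := @le_sum_esum _ _ D [:: x] (fun y => p h x y * k y).
  rewrite big_seq1; apply => //; last by move=> y; rewrite inE => /eqP ->.
  by move=> y Dy; rewrite mulr_ge0 ?(semigroup_ge0 Hp)//; case/andP: (kM y Dy).
have kM y : D y -> 0 <= M - g y <= M.
  by move=> /gM /andP[? ?]; apply/andP; split; lra.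
have sumM : Pt D p h (fun y => M - g y) x + Pt D p h g x = M.
  apply: EFin_inj; rewrite EFinD -(PtE Hp kM)// -(PtE Hp gM)// -esumD; last 2 first.
  - by move=> y Dy; rewrite lee_fin mulr_ge0 ?(semigroup_ge0 Hp)//; case/andP: (kM y Dy).
  - by move=> y Dy; rewrite lee_fin mulr_ge0 ?(semigroup_ge0 Hp)//; case/andP: (gM y Dy).
  have M0 : 0 <= M by have /andP[] := gM x Dx; exact: le_trans.
  rewrite -[RHS]mule1 -(semigroup_pmf Hp h0 Dx).2 -esumZl//.
    by apply: eq_esum => y _; rewrite -EFinD -EFinM; congr EFin; ring.
  by move=> y Dy; rewrite lee_fin (semigroup_ge0 Hp).
have := low _ gM; have := low _ kM; have /andP[gx0 gxM] := gM x Dx.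
rewrite ler_norml => ? ?; apply/andP; split; nra.
Qed.

Lemma Pt_lcont (R : realType) (S : countType) (D : set S) (p : R -> S -> S -> R)
    (L : (S -> R) -> S -> R) (M t : R) (f : S -> R) (x : S) :
  markov_semigroup D p L -> (forall y, D y -> 0 <= f y <= M) -> 0 < t -> D x ->
  lcont (fun s => Pt D p s f x) t.
Proof.
move=> Hp fM t0 Dx; apply/cvgrPdist_le => e e0.
have M0 : 0 <= M by have /andP[] := fM x Dx; exact: le_trans.
have : M * (1 - p h x x) @[h --> 0^'+] --> M * (1 - 1).
  by apply: cvgMl_tmp; apply: cvgB; [exact: cvg_cst|exact: semigroup_diag Hp Dx].
rewrite subrr mulr0 => /cvgr_le/(_ _ e0) [d /= d0 dP].
near=> s.
have s0 : 0 <= s by near: s; exact: nbhs_left_ge.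
have st : s < t by near: s; exact: nbhs_left_lt.
have sd : t - d < s by near: s; apply: nbhs_left_gt; lra.
(* The increment starts at the moving time [s], which the uniformity in time of [Pt_increment]
   allows. *)
have -> : t = s + (t - s) by ring.
apply: le_trans (Pt_increment Hp fM _ _ Dx) _ => //; first by rewrite subr_ge0 ltW.
apply: dP; last by rewrite subr_gt0.
by rewrite /= sub0r normrN ger0_norm; lra.
Unshelve. all: by end_near. Qed.

(** * Finite closed classes *)

(** [L] annihilates constants, so the weight 1 with rate 0 is admissible in [comparison], and the
    exceptional set lies in [F]; then [delta] is sent to 0. *)
Lemma finite_class_comparison (R : realType) (S : countType) (F : seq S)
    (L : (S -> R) -> S -> R) (v : R -> S -> R) :
  (forall x, x \in F -> jump_at [set` F] L x) ->
  (forall x, x \in F -> v 0 x <= 0) ->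
  (forall (t : R) x, 0 <= t -> x \in F -> exists2 l, rderiv (v^~ x) t l & l <= L (v t) x) ->
  (forall (t : R) x, 0 < t -> x \in F -> lcont (v^~ x) t) ->
  forall (t : R) x, 0 <= t -> x \in F -> v t x <= 0.
Proof.
move=> LJ v0 vr vl t x t0 xF; apply/ler_addgt0Pl => e e0; rewrite addr0.
(* This value of [delta] makes the bound at time [t] equal to [e]. *)
have d0 : 0 < e / expR ((0 + 1) * t) by rewrite divr_gt0 ?expR_gt0.
apply: (@le_trans _ _ (e / expR ((0 + 1) * t) * expR ((0 + 1) * t) * 1)); last first.
  by rewrite mulr1 divfK// gt_eqF ?expR_gt0.
apply: (@comparison R S [set` F] L (fun=> 1) 0 _ t) => //.
- by move=> y Fy; rewrite (jump_at_cst _ (LJ y Fy)) mul0r.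
- by move=> y Fy; rewrite (le_trans (v0 y Fy))// mulr1 ltW.
- by apply: (@sub_finite_set _ _ [set` F]) => [y []//|]; exact: finite_seq.
Qed.

Lemma hassum_support (R : realType) (S : countType) (D : set S) (F : seq S) (g : S -> R) :
  uniq F -> (forall x, x \in F -> D x) -> (forall x, D x -> x \notin F -> g x = 0) ->
  hassum D g (\sum_(z <- F) g z).
Proof.
move=> uF FD g0.
apply: (@eq_hassum _ _ _ (fun x => \sum_(z <- F) g z * (x == z)%:R)).
  move=> x Dx; have [xF|xF] := boolP (x \in F); last first.
    rewrite g0// big_seq big1// => z zF.
    by case: eqP xF => [->|]; [rewrite zF|rewrite mulr0].
  rewrite (bigD1_seq x)//= eqxx mulr1 big1 ?addr0// => z zx.
  by rewrite eq_sym (negbTE zx) mulr0.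
rewrite [X in hassum _ _ X]big_seq.
apply: (@eq_hassum _ _ _ (fun x => \sum_(z <- F | z \in F) g z * (x == z)%:R)).
  by move=> x _; rewrite -big_seq.
apply: hassum_sum => z zF; rewrite -[X in hassum _ _ X]mulr1; apply: hassumZ.
apply: ge0_hassum => // ; rewrite (esumID [set z])//.
rewrite [X in (_ + X)%E]esum1 ?adde0; last by move=> y [_ /= /eqP/negbTE ->].
rewrite (_ : D `&` [set z] = [set z]); last first.
  by apply/seteqP; split => [y []|y -> /=]//; split => //; exact: FD.
by rewrite esum_set1 eqxx.
Qed.

(** [class_jump] is closedness in terms of rates: jumps of positive rate from [F] lead back into
    [F]. [class_mass] turns it into closedness for the transition probabilities. *)
Record finite_class (R : realType) (S : countType) (D : set S)
    (L : (S -> R) -> S -> R) (F : seq S) : Prop := FiniteClass {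
  class_uniq : uniq F;
  class_sub : forall x, x \in F -> D x;
  class_jump : forall x, x \in F -> jump_at [set` F] L x }.

Definition Qt (R : realType) (S : countType) (F : seq S) (p : R -> S -> S -> R)
    (t : R) (f : S -> R) (x : S) : R := \sum_(z <- F) p t x z * f z.

Lemma esum_support (R : realType) (S : countType) (D : set S) (F : seq S) (g : S -> R) :
  uniq F -> (forall x, x \in F -> D x) -> (forall x, D x -> 0 <= g x) ->
  (forall x, D x -> x \notin F -> g x = 0) ->
  (\esum_(x in D) (g x)%:E = (\sum_(z <- F) g z)%:E)%E.
Proof.
by move=> uF FD g0 gF; rewrite -csum_ge0//; apply: hassum_csum; exact: hassum_support.
Qed.

(** The defect, 1 minus the semigroup applied to the indicator of [F], vanishes on [F] at time 0 and
    solves the backward equation there, so comparison keeps it nonpositive: no mass leaves [F]. *)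
Lemma class_mass (R : realType) (S : countType) (D : set S) (L : (S -> R) -> S -> R)
    (F : seq S) (p : R -> S -> S -> R) (t : R) (x : S) :
  markov_semigroup D p L -> finite_class D L F -> 0 <= t -> x \in F ->
  \sum_(z <- F) p t x z = 1.
Proof.
move=> Hp [uF FD FJ] t0 xF; have Dx := FD x xF.
pose f (y : S) : R := (y \in F)%:R.
have f1 y : D y -> 0 <= f y <= 1 by rewrite /f ler0n lern1 leq_b1.
have PtF s y : 0 <= s -> y \in F -> Pt D p s f y = \sum_(z <- F) p s y z.
  move=> s0 yF; have Dy := FD y yF.
  rewrite /Pt (esum_support uF FD)/=; first 1 last.
  - by move=> z Dz; rewrite mulr_ge0 ?(semigroup_ge0 Hp)// /f ler0n.
  - by move=> z Dz zF; rewrite /f (negbTE zF) mulr0.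
  by rewrite [LHS]big_seq [RHS]big_seq; apply: eq_bigr => z zF; rewrite /f zF mulr1.
have FX z : z \in F -> [set` F] z by [].
apply/eqP; rewrite -PtF// eq_le; have /andP[_ ->] /= := Pt_bound Hp f1 t0 Dx.
rewrite -subr_le0 -[Pt _ _ _ _ _]mul1r.
apply: (@finite_class_comparison _ _ F L (fun t y => 1 - 1 * Pt D p t f y)
  FJ _ _ _ t x t0 xF).
- move=> y yF; rewrite (Pt0 Hp) => [||]; first by rewrite /f yF mul1r subrr.
    by move=> z /f1/andP[].
  exact: FD.
- move=> s y s0 yF; eexists.
    exact: rderivB (rderiv_cst 1 s) (Pt_rderiv Hp f1 s0 (FD y yF)).
  by rewrite (jump_atB _ _ _ (FJ y yF)) (jump_at_cst _ (FJ y yF)).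
- by move=> s y s0 yF; apply: lcontB; [exact: lcont_cst|exact: Pt_lcont Hp f1 s0 (FD y yF)].
Qed.

Lemma class_exit (R : realType) (S : countType) (D : set S) (L : (S -> R) -> S -> R)
    (F : seq S) (p : R -> S -> S -> R) (t : R) (x y : S) :
  markov_semigroup D p L -> finite_class D L F -> 0 <= t -> x \in F -> D y ->
  y \notin F -> p t x y = 0.
Proof.
move=> Hp HF t0 xF Dy yF; have [uF FD FJ] := HF.
have [p0 p1] := semigroup_pmf Hp t0 (FD x xF).
have := @le_sum_esum _ _ D (y :: F) (p t x).
rewrite /= yF uF p1 big_cons (class_mass Hp HF)// lee_fin => /(_ isT p0) H.
have {}H : p t x y + 1 <= 1.
  by apply: H => z; rewrite inE => /predU1P[->//|/FD].
by apply/eqP; rewrite eq_le p0// andbT; lra.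
Qed.

Lemma Qt_hassum (R : realType) (S : countType) (D : set S) (L : (S -> R) -> S -> R)
    (F : seq S) (p : R -> S -> S -> R) (t : R) (f : S -> R) (x : S) :
  markov_semigroup D p L -> finite_class D L F -> 0 <= t -> x \in F ->
  hassum D (fun y => p t x y * f y) (Qt F p t f x).
Proof.
move=> Hp HF t0 xF; have [uF FD FJ] := HF.
apply: hassum_support => // y Dy yF.
by rewrite (class_exit Hp HF) ?mul0r.
Qed.

Lemma QtD (R : realType) (S : countType) (D : set S) (L : (S -> R) -> S -> R)
    (F : seq S) (p : R -> S -> S -> R) (s t : R) (f : S -> R) (x : S) :
  markov_semigroup D p L -> finite_class D L F -> 0 <= s -> 0 <= t -> x \in F ->
  Qt F p (s + t) f x = Qt F p s (Qt F p t f) x.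
Proof.
move=> Hp HF s0 t0 xF; have [uF FD FJ] := HF.
rewrite /Qt; under [RHS]eq_bigr do rewrite mulr_sumr.
rewrite exchange_big /= [LHS]big_seq [RHS]big_seq; apply: eq_bigr => z zF.
have Dx := FD x xF; have Dz := FD z zF.
have -> : p (s + t) x z = \sum_(y <- F) p s x y * p t y z.
  apply: EFin_inj; rewrite -(semigroupD Hp)//; apply: esum_support => //.
    by move=> y Dy; rewrite mulr_ge0// (semigroup_ge0 Hp).
  by move=> y Dy yF; rewrite (class_exit Hp HF s0)// mul0r.
by rewrite mulr_suml; apply: eq_bigr => y _; rewrite mulrA.
Qed.

Lemma Qt0 (R : realType) (S : countType) (D : set S) (L : (S -> R) -> S -> R)
    (F : seq S) (p : R -> S -> S -> R) (f : S -> R) (x : S) :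
  markov_semigroup D p L -> finite_class D L F -> x \in F -> Qt F p 0 f x = f x.
Proof.
move=> Hp [uF FD FJ] xF; rewrite /Qt (bigD1_seq x)//=.
rewrite (semigroup0 Hp (FD x xF) (FD x xF)) eqxx mul1r.
rewrite big_seq_cond big1 ?addr0// => z /andP[zF zx].
by rewrite (semigroup0 Hp (FD x xF) (FD z zF)) eq_sym (negbTE zx) mul0r.
Qed.

(** Cut off outside the finite set [F], any function becomes bounded, and neither the transition
    probabilities nor [L] at a point of [F] see the difference. *)
Lemma Qt_generator (R : realType) (S : countType) (D : set S) (L : (S -> R) -> S -> R)
    (F : seq S) (p : R -> S -> S -> R) (f : S -> R) (x : S) :
  markov_semigroup D p L -> finite_class D L F -> x \in F ->
  (fun h => h^-1 * (Qt F p h f x - f x)) @ 0^'+ --> L f x.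
Proof.
move=> Hp HF xF; have [uF FD FJ] := HF; have Dx := FD x xF.
pose g y := if y \in F then f y else 0.
have -> : L f x = L g x.
  by apply: jump_at_local (FJ x xF) _ _ => // y /= yF; rewrite /g yF.
have gB : exists M : R, forall y, D y -> `|g y| <= M.
  exists (\sum_(y <- F) `|f y|) => y Dy; rewrite /g; case: ifPn => yF.
    by rewrite (bigD1_seq y)//= lerDl sumr_ge0.
  by rewrite normr0 sumr_ge0.
have H := semigroup_generator Hp gB Dx; apply: cvg_trans H; apply: near_eq_cvg.
near=> h; have h0 : 0 <= h by near: h; exact: nbhs_right_ge.
rewrite /= (hassum_csum (Qt_hassum g Hp HF h0 xF))/= /g xF; congr (_ * (_ - _)).
by rewrite /Qt [LHS]big_seq [RHS]big_seq; apply: eq_bigr => z ->.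
Unshelve. all: by end_near. Qed.

Lemma Qt_backward (R : realType) (S : countType) (D : set S) (L : (S -> R) -> S -> R)
    (F : seq S) (p : R -> S -> S -> R) (t : R) (f : S -> R) (x : S) :
  markov_semigroup D p L -> finite_class D L F -> 0 <= t -> x \in F ->
  rderiv (fun s => Qt F p s f x) t (L (Qt F p t f) x).
Proof.
move=> Hp HF t0 xF.
have H := @Qt_generator _ _ _ _ _ _ (Qt F p t f) _ Hp HF xF; apply: cvg_trans H; apply: near_eq_cvg.
near=> h; have h0 : 0 <= h by near: h; exact: nbhs_right_ge.
by rewrite /= [t + h]addrC (QtD f Hp HF).
Unshelve. all: by end_near. Qed.

(** The small-time increment is taken first and then averaged by [p t x], a finite sum through which
    the limit passes. Duality needs this form, since there the dual generator must act on the
    duality function itself. *)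
Lemma Qt_forward (R : realType) (S : countType) (D : set S) (L : (S -> R) -> S -> R)
    (F : seq S) (p : R -> S -> S -> R) (t : R) (f : S -> R) (x : S) :
  markov_semigroup D p L -> finite_class D L F -> 0 <= t -> x \in F ->
  rderiv (fun s => Qt F p s f x) t (Qt F p t (L f) x).
Proof.
move=> Hp HF t0 xF.
have H : (\sum_(y <- F | y \in F) p t x y * (h^-1 * (Qt F p h f y - f y))) @[h --> 0^'+] -->
    \sum_(y <- F | y \in F) p t x y * L f y.
  by apply: cvg_bigsum => y yF; apply: cvgMl_tmp; exact: Qt_generator Hp HF yF.
rewrite -big_seq in H; apply: cvg_trans H; apply: near_eq_cvg.
near=> h; have h0 : 0 <= h by near: h; exact: nbhs_right_ge.
rewrite /= (QtD f Hp HF)// -big_seq {1 3}/Qt -sumrB mulr_sumr.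
by apply: eq_bigr => y _; ring.
Unshelve. all: by end_near. Qed.

Lemma Qt_lcont (R : realType) (S : countType) (D : set S) (L : (S -> R) -> S -> R)
    (F : seq S) (p : R -> S -> S -> R) (t : R) (f : S -> R) (x : S) :
  markov_semigroup D p L -> finite_class D L F -> 0 < t -> x \in F ->
  lcont (fun s => Qt F p s f x) t.
Proof.
move=> Hp HF t0 xF; have [uF FD FJ] := HF; rewrite /lcont /Qt.
under eq_fun do rewrite big_seq.
rewrite big_seq; apply: cvg_bigsum => z zF; apply: cvgMr_tmp.
have f1 y : D y -> 0 <= ((y == z)%:R : R) <= 1 by rewrite ler0n lern1 leq_b1.
have H := Pt_lcont Hp f1 t0 (FD x xF).
rewrite /lcont (Pt1E Hp (ltW t0) (FD x xF) (FD z zF)) in H.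
apply: cvg_trans H; apply: near_eq_cvg.
near=> s; have s0 : 0 <= s by near: s; exact: nbhs_left_ge.
by rewrite /= (Pt1E Hp s0 (FD x xF) (FD z zF)).
Unshelve. all: by end_near. Qed.

(** Comparison is applied to both differences. The lemma recognizes a candidate as the semigroup:
    for particles already absorbed, for the binomial shift, and for two realizations of the dual
    process. *)
Lemma Qt_unique (R : realType) (S : countType) (D : set S) (L : (S -> R) -> S -> R)
    (F : seq S) (p : R -> S -> S -> R) (f : S -> R) (v : R -> S -> R) :
  markov_semigroup D p L -> finite_class D L F ->
  (forall x, x \in F -> v 0 x = f x) ->
  (forall (t : R) x, 0 <= t -> x \in F -> rderiv (v^~ x) t (L (v t) x)) ->
  (forall (t : R) x, 0 < t -> x \in F -> lcont (v^~ x) t) ->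
  forall (t : R) x, 0 <= t -> x \in F -> v t x = Qt F p t f x.
Proof.
move=> Hp HF v0 vr vl t x t0 xF; have [uF FD FJ] := HF.
have qr s y (s0 : 0 <= s) (yF : y \in F) := @Qt_backward _ _ _ _ _ _ _ f _ Hp HF s0 yF.
have ql s y (s0 : 0 < s) (yF : y \in F) := @Qt_lcont _ _ _ _ _ _ _ f _ Hp HF s0 yF.
apply/eqP; rewrite eq_le -subr_le0 -[X in _ && X]subr_le0; apply/andP; split.
- rewrite -[Qt _ _ _ _ _]mul1r.
  apply: (@finite_class_comparison _ _ F L (fun t y => v t y - 1 * Qt F p t f y)
    FJ _ _ _ t x t0 xF) => [y yF|s y s0 yF|s y s0 yF].
  + by rewrite v0// (Qt0 _ Hp HF)// mul1r subrr.
  + eexists; first exact: rderivB (vr s y s0 yF) (qr s y s0 yF).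
    by rewrite (jump_atB _ _ _ (FJ y yF)).
  + exact: lcontB (vl s y s0 yF) (ql s y s0 yF).
- rewrite -[v _ _]mul1r.
  apply: (@finite_class_comparison _ _ F L (fun t y => Qt F p t f y - 1 * v t y)
    FJ _ _ _ t x t0 xF) => [y yF|s y s0 yF|s y s0 yF].
  + by rewrite v0// (Qt0 _ Hp HF)// mul1r subrr.
  + eexists; first exact: rderivB (qr s y s0 yF) (vr s y s0 yF).
    by rewrite (jump_atB _ _ _ (FJ y yF)).
  + exact: lcontB (ql s y s0 yF) (vl s y s0 yF).
Qed.

(** * Binomial transforms on configurations *)

(** This is the operator exp(c a), where a sends [G] to the function n [G (n - 1)]. If b sends [G]
    to the function [G (n + 1)], then b a - a b = 1. Hence exp(c a) commutes with a ([binT_lower]),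
    carries b to b - c ([binT_shift]), and weights add under composition ([binT_comp]). *)
Definition binT (R : realType) (c : R) (n : nat) (G : nat -> R) : R :=
  \sum_(k < n.+1) 'C(n, k)%:R * c ^+ (n - k) * G k.

Lemma binT_widen (R : realType) (c : R) (n m : nat) (G : nat -> R) : (n <= m)%N ->
  \sum_(k < m.+1) 'C(n, k)%:R * c ^+ (n - k) * G k = binT c n G.
Proof.
move=> nm; rewrite /binT -!(big_mkord xpredT (fun k => 'C(n, k)%:R * c ^+ (n - k) * G k)).
rewrite (big_cat_nat (n := n.+1))//= [X in _ + X](_ : _ = 0) ?addr0//.
rewrite big_nat_cond big1// => k /andP[/andP[nk _] _].
by rewrite bin_small// !mul0r.
Qed.

Lemma binTS (R : realType) (c : R) (n : nat) (G : nat -> R) :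
  binT c n.+1 G = c * binT c n G + binT c n (fun k => G k.+1).
Proof.
rewrite /binT big_ord_recl /= bin0 subn0.
rewrite (eq_bigr (fun k : 'I_n.+1 => 'C(n, k.+1)%:R * c ^+ (n - k) * G k.+1 +
    'C(n, k)%:R * c ^+ (n - k) * G k.+1)); last first.
  by move=> k _; rewrite /bump /= add1n binS subSS natrD; ring.
rewrite big_split /= addrA; congr (_ + _).
rewrite big_ord_recr /= bin_small// !mul0r addr0.
rewrite [in RHS]big_ord_recl /= bin0 subn0 mulrDr; congr (_ + _).
  by rewrite exprS; ring.
rewrite mulr_sumr; apply: eq_bigr => k _; rewrite /bump /= add1n.
have -> : (n - k = (n - k.+1).+1)%N by rewrite -subSn// subSS.
by rewrite exprS; ring.
Qed.

Lemma binT_shift (R : realType) (c : R) (n : nat) (G : nat -> R) :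
  binT c n (fun k => G k.+1) = binT c n.+1 G - c * binT c n G.
Proof. by rewrite binTS; ring. Qed.

Lemma binT_lower (R : realType) (c : R) (n : nat) (G : nat -> R) :
  binT c n (fun k => k%:R * G k.-1) = n%:R * binT c n.-1 G.
Proof.
case: n => [|n]; first by rewrite /binT big_ord1 /= !mul0r mulr0.
rewrite /binT big_ord_recl /= mul0r mulr0 add0r mulr_sumr.
apply: eq_bigr => k _; rewrite /bump /= add1n subSS.
have -> : n.+1%:R * ('C(n, k)%:R * c ^+ (n - k) * G k) =
    (n.+1 * 'C(n, k))%:R * c ^+ (n - k) * G k by rewrite natrM; ring.
by rewrite (mul_bin_diag n.+1 k) natrM; ring.
Qed.

Lemma binT_lin (R : realType) (c a b : R) (n : nat) (G H : nat -> R) :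
  binT c n (fun k => a * G k + b * H k) = a * binT c n G + b * binT c n H.
Proof.
by rewrite /binT !mulr_sumr -big_split /=; apply: eq_bigr => k _; ring.
Qed.

Lemma binT_comp (R : realType) (c w : R) (n j : nat) :
  binT c n (fun k => 'C(k, j)%:R * w ^+ (k - j)) = 'C(n, j)%:R * (c + w) ^+ (n - j).
Proof.
have pascal (u : R) k i : 'C(k.+1, i.+1)%:R * u ^+ (k.+1 - i.+1) =
    u * ('C(k, i.+1)%:R * u ^+ (k - i.+1)) + 1 * ('C(k, i)%:R * u ^+ (k - i)).
  rewrite binS natrD subSS mulrDl mul1r; congr (_ + _).
  have [ik|ki] := ltnP i k; last by rewrite bin_small// !mul0r mulr0.
  have -> : (k - i = (k - i.+1).+1)%N by rewrite -subSn// subSS.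
  by rewrite exprS; ring.
elim: n j => [|n IH] j.
  by rewrite /binT big_ord1 /= bin0 expr0 !mul1r; case: j => [|j]; rewrite ?mul0r.
rewrite binTS IH; case: j => [|j].
  have := IH 0%N; rewrite !bin0 !subn0 !mul1r => IH0.
  rewrite (_ : (fun k => _) = fun k => w * ('C(k, 0)%:R * w ^+ (k - 0)) + 0 * 0); last first.
    by apply/funext => k; rewrite !bin0 !subn0 exprS; ring.
  by rewrite binT_lin IH bin0 subn0 !exprS; ring.
rewrite (_ : (fun k => 'C(k.+1, _)%:R * _) = fun k =>
  w * ('C(k, j.+1)%:R * w ^+ (k - j.+1)) + 1 * ('C(k, j)%:R * w ^+ (k - j))); last first.
  by apply/funext => k; exact: pascal.
by rewrite binT_lin !IH pascal; ring.
Qed.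

(** * Ladder operators and binomial shifts of configurations *)

Definition upd (n : nat) (xi : config n) (x : 'I_n.+1) (k : nat) : config n :=
  [ffun z => if z == x then k else xi z].

Definition siteT (R : realType) (n : nat) (c : R) (x : 'I_n.+1) (g : config n -> R)
    (xi : config n) : R := binT c (xi x) (fun k => g (upd xi x k)).

Definition lower (R : realType) (n : nat) (x : 'I_n.+1) (g : config n -> R)
    (xi : config n) : R := (xi x)%:R * g (remp xi x).

Definition raise (R : realType) (n : nat) (x : 'I_n.+1) (g : config n -> R)
    (xi : config n) : R := g (addp xi x).

Lemma siteT_lin (R : realType) (n : nat) (c a b : R) (x : 'I_n.+1) (g h : config n -> R) :
  siteT c x (fun xi => a * g xi + b * h xi) =
  fun xi => a * siteT c x g xi + b * siteT c x h xi.
Proof. by apply/funext => xi; rewrite /siteT binT_lin. Qed.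

Lemma siteT_lower (R : realType) (n : nat) (c : R) (x y : 'I_n.+1) (g : config n -> R) :
  siteT c x (lower y g) = lower y (siteT c x g).
Proof.
apply/funext => xi; rewrite /siteT /lower.
have [<-|yx] := eqVneq y x.
  rewrite ffunE eqxx subn1 -binT_lower; congr (binT _ _ _); apply/funext => k.
  rewrite ffunE eqxx; congr (_ * g _); apply/ffunP => z; rewrite !ffunE.
  by case: eqP => _; rewrite ?subn1 ?subn0.
have nyx z : (z == x) && (z == y) = false.
  by apply/negbTE/negP => /andP[/eqP -> /eqP e]; rewrite e eqxx in yx.
have -> : remp xi y x = xi x by rewrite ffunE eq_sym (negbTE yx) subn0.
rewrite /binT mulr_sumr; apply: eq_bigr => k _; rewrite ffunE (negbTE yx).
have -> : remp (upd xi x k) y = upd (remp xi y) x k.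
  apply/ffunP => z; rewrite !ffunE; have := nyx z.
  by case: (z == x); case: (z == y); rewrite //= subn0.
ring.
Qed.

Lemma siteT_raise (R : realType) (n : nat) (c : R) (x y : 'I_n.+1) (g : config n -> R) :
  siteT c x (raise y g) =
  fun xi => raise y (siteT c x g) xi - (y == x)%:R * c * siteT c x g xi.
Proof.
apply/funext => xi; rewrite /siteT /raise.
have [<-|yx] := eqVneq y x.
  rewrite ffunE eqxx addn1 mul1r.
  have := binT_shift c (xi y) (fun k => g (upd xi y k)).
  rewrite (_ : (fun k => g (addp (upd xi y k) y)) = (fun k => g (upd xi y k.+1))); last first.
    apply/funext => k; congr g; apply/ffunP => z; rewrite !ffunE.
    by case: eqP => _; rewrite ?addn1 ?addn0.
  move=> ->; congr (binT _ _ _ - _); apply/funext => k.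
  by congr g; apply/ffunP => z; rewrite !ffunE; case: eqP => // _; rewrite addn0.
have nyx z : (z == x) && (z == y) = false.
  by apply/negbTE/negP => /andP[/eqP -> /eqP e]; rewrite e eqxx in yx.
have -> : addp xi y x = xi x by rewrite ffunE eq_sym (negbTE yx) addn0.
rewrite mul0r mul0r subr0; congr (binT _ _ _); apply/funext => k; congr g.
apply/ffunP => z; rewrite !ffunE; have := nyx z.
by case: (z == x); case: (z == y); rewrite //= addn0.
Qed.

Definition sitesT (R : realType) (n : nat) (c : R) (s : seq 'I_n.+1)
    (g : config n -> R) : config n -> R := foldr (siteT c) g s.

Lemma sitesT_lin (R : realType) (n : nat) (c a b : R) (s : seq 'I_n.+1)
    (g h : config n -> R) :
  sitesT c s (fun xi => a * g xi + b * h xi) =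
  fun xi => a * sitesT c s g xi + b * sitesT c s h xi.
Proof. by elim: s => //= x s ->; rewrite siteT_lin. Qed.

Lemma sitesT_lower (R : realType) (n : nat) (c : R) (s : seq 'I_n.+1) (y : 'I_n.+1)
    (g : config n -> R) : sitesT c s (lower y g) = lower y (sitesT c s g).
Proof. by elim: s => //= x s ->; rewrite siteT_lower. Qed.

Lemma sitesT_raise (R : realType) (n : nat) (c : R) (s : seq 'I_n.+1) (y : 'I_n.+1)
    (g : config n -> R) : uniq s ->
  sitesT c s (raise y g) =
  fun xi => raise y (sitesT c s g) xi - (y \in s)%:R * c * sitesT c s g xi.
Proof.
elim: s => [|x s IH] /=; first by move=> _; apply/funext => xi; rewrite !mul0r subr0.
move=> /andP[xs us]; rewrite IH//.
rewrite (_ : (fun xi => _) = fun xi => 1 * raise y (sitesT c s g) xi +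
  (- ((y \in s)%:R * c)) * sitesT c s g xi); last by apply/funext => xi; ring.
rewrite siteT_lin siteT_raise; apply/funext => xi; rewrite inE.
have [->|yx] := eqVneq y x; last by rewrite /=; ring.
by rewrite (negbTE xs) /=; ring.
Qed.

(* [b_y - b_x], as a linear combination to which [sitesT_lin] applies. *)
Definition raiseB (R : realType) (n : nat) (x y : 'I_n.+1) (g : config n -> R)
    (xi : config n) : R := 1 * raise y g xi + (-1) * raise x g xi.

Definition shiftT (R : realType) (n : nat) (c : R) (g : config n -> R) : config n -> R :=
  sitesT c (index_enum 'I_n.+1) g.

(** Every [raise] is displaced by the same constant [c], which cancels in the difference between two
    sites. *)
Lemma shiftT_raiseB (R : realType) (n : nat) (c : R) (x y : 'I_n.+1) (g : config n -> R) :
  shiftT c (raiseB x y g) = raiseB x y (shiftT c g).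
Proof.
rewrite /shiftT sitesT_lin !sitesT_raise ?index_enum_uniq//.
by apply/funext => xi; rewrite /raiseB !mem_index_enum; ring.
Qed.

(* For [x != y], the symmetric edge generator is
   [alpha_y a_x (b_y - b_x) + alpha_x a_y (b_x - b_y) + sigma a_x a_y (b_y - b_x)^2]
   where [a = lower] and [b = raise]. *)
Lemma genE_lower (R : realType) (n : nat) (sigma : int) (G : geometry R n)
    (x y : 'I_n.+1) (g : config n -> R) : x != y ->
  genE sigma G x y g = fun xi =>
    (alpha G y)%:R * lower x (raiseB x y g) xi +
    (alpha G x)%:R * lower y (raiseB y x g) xi +
    sigma%:~R * lower x (lower y (raiseB x y (raiseB x y g))) xi.
Proof.
move=> xy; apply/funext => xi; rewrite /genE /occ_rate /lower /raiseB /raise !mul1r.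
have yx : (y == x) = false by rewrite eq_sym (negbTE xy).
have nyx z : (z == x) && (z == y) = false.
  by apply/negbTE/negP => /andP[/eqP -> /eqP e]; rewrite e eqxx in xy.
have rx : remp xi x y = xi y by rewrite ffunE yx subn0.
have ex : (xi x)%:R * g (addp (remp xi x) x) = (xi x)%:R * g xi.
  case: (posnP (xi x)) => [->|x0]; first by rewrite !mul0r.
  congr (_ * g _); apply/ffunP => z; rewrite !ffunE.
  by case: eqP => [->|_]; rewrite ?subnK ?subn0 ?addn0.
have ey : (xi y)%:R * g (addp (remp xi y) y) = (xi y)%:R * g xi.
  case: (posnP (xi y)) => [->|y0]; first by rewrite !mul0r.
  congr (_ * g _); apply/ffunP => z; rewrite !ffunE.
  by case: eqP => [->|_]; rewrite ?subnK ?subn0 ?addn0.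
rewrite !rx.
set rr := remp (remp xi x) y.
(* At an empty site [remp] is truncated, and putting the particle back does not restore [xi]. The
   corresponding factor is then 0, so empty sites are settled apart. *)
have [x0|x0] := posnP (xi x).
  rewrite x0 !mul0r !(mulr0, addr0, add0r).
  have [y0|y0] := posnP (xi y); first by rewrite y0 !mul0r !mulr0.
  by move: ey => /mulfI ->; [ring | rewrite pnatr_eq0 -lt0n].
move: ex => /mulfI ->; last by rewrite pnatr_eq0 -lt0n.
have [y0|y0] := posnP (xi y); first by rewrite y0; ring.
move: ey => /mulfI ->; last by rewrite pnatr_eq0 -lt0n.
have e1 : addp (addp rr y) y = addp (remp xi x) y.
  apply/ffunP => z; rewrite !ffunE; have := nyx z.
  by case: eqP => [->|_]; case: eqP => [->|_] //= _; rewrite ?subn0 ?addn0 ?subnK.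
have e2 : addp (addp rr x) x = addp (remp xi y) x.
  apply/ffunP => z; rewrite !ffunE; have := nyx z.
  by case: eqP => [->|_]; case: eqP => [->|_] //= _; rewrite ?subn0 ?addn0 ?subnK.
have e3 : addp (addp rr x) y = xi.
  apply/ffunP => z; rewrite !ffunE; have := nyx z.
  by case: eqP => [->|_]; case: eqP => [->|_] //= _; rewrite ?subn0 ?addn0 ?subnK.
have e4 : addp (addp rr y) x = xi.
  apply/ffunP => z; rewrite !ffunE; have := nyx z.
  by case: eqP => [->|_]; case: eqP => [->|_] //= _; rewrite ?subn0 ?addn0 ?subnK.
by rewrite e1 e2 e3 e4; ring.
Qed.

(** Configurations with values at most [m] are indexed by a finite type, over which a product of
    sums can be expanded. *)
Definition cfg (n m : nat) (z : {ffun 'I_n.+1 -> 'I_m.+1}) : config n :=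
  [ffun x => (z x : nat)].

(* For configurations bounded by [m] this is the sum over [zeta <= xi]: the
   binomial coefficients discard the other summands. *)
Definition msum (R : realType) (n m : nat) (w : 'I_n.+1 -> R) (g : config n -> R)
    (xi : config n) : R :=
  \sum_(z : {ffun 'I_n.+1 -> 'I_m.+1})
    (\prod_x ('C(xi x, z x)%:R * w x ^+ (xi x - z x))) * g (cfg z).

Lemma msum_below (R : realType) (n m : nat) (w : 'I_n.+1 -> R) (g : config n -> R)
    (xi : config n) :
  msum m w g xi =
  \sum_(z : {ffun 'I_n.+1 -> 'I_m.+1} | [forall x, (z x <= xi x)%N])
    (\prod_x ('C(xi x, z x)%:R * w x ^+ (xi x - z x))) * g (cfg z).
Proof.
rewrite /msum (bigID (fun z : {ffun 'I_n.+1 -> 'I_m.+1} => [forall x, (z x <= xi x)%N])) /=.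
rewrite [X in _ + X]big1 ?addr0// => z /forallPn[x]; rewrite -ltnNge => xz.
by rewrite (bigD1 x)//= bin_small// !mul0r.
Qed.

Lemma eq_msum (R : realType) (n m : nat) (w : 'I_n.+1 -> R) (g h : config n -> R)
    (xi : config n) :
  (forall z : config n, (forall x, (z x <= xi x)%N) -> g z = h z) ->
  msum m w g xi = msum m w h xi.
Proof.
move=> gh; rewrite !msum_below; apply: eq_bigr => z /forallP zxi; rewrite gh// => x.
by rewrite ffunE.
Qed.

(** By distributivity the double sum factorizes over the sites, where [binT_comp] adds the
    weights. *)
Lemma msum_comp (R : realType) (n m : nat) (w w' : 'I_n.+1 -> R) (g : config n -> R)
    (xi : config n) : (forall x, (xi x <= m)%N) ->
  msum m w (msum m w' g) xi = msum m (fun x => w x + w' x) g xi.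
Proof.
move=> xim; rewrite /msum; under eq_bigr do rewrite mulr_sumr.
rewrite exchange_big /=; apply: eq_bigr => u _.
under eq_bigr do rewrite mulrA; rewrite -mulr_suml; congr (_ * _).
pose H x (j : 'I_m.+1) := 'C(xi x, j)%:R * w x ^+ (xi x - j) *
  ('C(j, u x)%:R * w' x ^+ (j - u x)).
transitivity (\sum_(z : {ffun 'I_n.+1 -> 'I_m.+1}) \prod_x H x (z x)).
  by apply: eq_bigr => z _; rewrite -big_split; apply: eq_bigr => x _; rewrite /= ffunE.
rewrite -bigA_distr_bigA.
apply: eq_bigr => x _.
by rewrite (binT_widen _ (fun j => 'C(j, u x)%:R * w' x ^+ (j - u x)) (xim x)) binT_comp.
Qed.

Lemma msum0 (R : realType) (n m : nat) (g : config n -> R) (xi : config n) :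
  (forall x, (xi x <= m)%N) -> msum m (fun=> 0) g xi = g xi.
Proof.
move=> xim; pose z0 : {ffun 'I_n.+1 -> 'I_m.+1} := [ffun x => inord (xi x)].
have z0E x : z0 x = xi x :> nat by rewrite ffunE inordK// ltnS.
rewrite /msum (bigD1 z0)//= [X in _ + X]big1 ?addr0.
  rewrite (_ : cfg z0 = xi); last by apply/ffunP => x; rewrite ffunE z0E.
  by rewrite big1 ?mul1r// => x _; rewrite z0E binn subnn expr0 mulr1.
move=> z zz0.
have [x zx] : exists x, z x != xi x :> nat.
  apply/existsP; apply: contraR zz0 => /existsPn H; apply/eqP/ffunP => x.
  by apply: val_inj => /=; rewrite z0E; apply/eqP; have := H x; rewrite negbK.
rewrite (bigD1 x)//= expr0n subn_eq0.
case: (ltngtP (z x) (xi x)) zx => // [zx|xz] _; first by rewrite mulr0 !mul0r.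
by rewrite bin_small// !mul0r.
Qed.

Lemma siteT_msum (R : realType) (n m : nat) (c : R) (x : 'I_n.+1) (w : 'I_n.+1 -> R)
    (g : config n -> R) (xi : config n) : (forall x, (xi x <= m)%N) ->
  siteT c x (msum m w g) xi = msum m (fun y => (y == x)%:R * c + w y) g xi.
Proof.
move=> xim; rewrite /siteT /binT /msum.
under eq_bigr do rewrite mulr_sumr.
rewrite exchange_big /=; apply: eq_bigr => z _.
under eq_bigr do rewrite mulrA; rewrite -mulr_suml; congr (_ * _).
rewrite [RHS](bigD1 x)//= eqxx mul1r -binT_comp /binT mulr_suml.
apply: eq_bigr => k _; rewrite (bigD1 x)//= !ffunE eqxx [LHS]mulrA.
congr (_ * _); apply: eq_bigr => y yx; rewrite !ffunE (negbTE yx).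
by rewrite mul0r add0r.
Qed.

Lemma sitesT_msum (R : realType) (n m : nat) (c : R) (s : seq 'I_n.+1)
    (g : config n -> R) (xi : config n) : uniq s -> (forall x, (xi x <= m)%N) ->
  sitesT c s g xi = msum m (fun y => (y \in s)%:R * c) g xi.
Proof.
elim: s xi => [|x s IH] xi /=.
  move=> _ xim; rewrite -(msum0 g xim); congr (msum _ _ _ _).
  by apply/funext => y; rewrite mul0r.
move=> /andP[xs us] xim.
transitivity (siteT c x (msum m (fun y => (y \in s)%:R * c) g) xi).
  rewrite /siteT /binT; apply: eq_bigr => k _; rewrite IH// => y.
  by rewrite ffunE; case: eqP => // _; rewrite (leq_trans _ (xim x))// -ltnS.
rewrite siteT_msum//; congr (msum _ _ _ _); apply/funext => y.
rewrite inE; case: eqP => [->|] /=; last by rewrite mul0r add0r.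
by rewrite (negbTE xs) mul0r addr0.
Qed.

(** Two forms of one shift: the composite of site operators, which interacts well with generators,
    and the finite sum with explicit weights, which can be differentiated in time term by term. *)
Lemma shiftT_msum (R : realType) (n m : nat) (c : R) (g : config n -> R)
    (xi : config n) : (forall x, (xi x <= m)%N) ->
  shiftT c g xi = msum m (fun=> c) g xi.
Proof.
move=> xim; rewrite /shiftT (sitesT_msum _ _ (index_enum_uniq _) xim).
by congr (msum _ _ _ _); apply/funext => y; rewrite mem_index_enum mul1r.
Qed.

Definition csize (n : nat) (xi : config n) : nat := (\sum_(x < n.+1) xi x)%N.

Lemma leq_csize (n : nat) (xi : config n) (x : 'I_n.+1) : (xi x <= csize xi)%N.
Proof. by rewrite /csize (bigD1 x)//= leq_addr. Qed.

Lemma msum_scale (R : realType) (n m : nat) (d : R) (w : 'I_n.+1 -> R)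
    (g : config n -> R) (xi : config n) :
  msum m (fun x => d * w x) (fun z => d ^+ csize z * g z) xi =
  d ^+ csize xi * msum m w g xi.
Proof.
rewrite !msum_below mulr_sumr; apply: eq_bigr => z /forallP zxi.
rewrite !mulrA; congr (_ * _); rewrite /csize -!prodrXr -!big_split /=.
apply: eq_bigr => x _; rewrite !ffunE exprMn.
have -> : d ^+ xi x = d ^+ (xi x - z x) * d ^+ z x by rewrite -exprD subnK.
by ring.
Qed.

Definition cpow (R : realType) (n : nat) (b : 'I_n.+1 -> R) (xi : config n) : R :=
  \prod_x b x ^+ xi x.

Lemma shiftT_cpow (R : realType) (n : nat) (c : R) (b : 'I_n.+1 -> R) (xi : config n) :
  shiftT c (cpow b) xi = cpow (fun x => b x + c) xi.
Proof.
rewrite (shiftT_msum _ _ (leq_csize xi)) /msum /cpow.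
pose H x (j : 'I_(csize xi).+1) := 'C(xi x, j)%:R * c ^+ (xi x - j) * b x ^+ j.
transitivity (\sum_(z : {ffun 'I_n.+1 -> 'I_(csize xi).+1}) \prod_x H x (z x)).
  by apply: eq_bigr => z _; rewrite -big_split; apply: eq_bigr => x _; rewrite /= ffunE.
rewrite -bigA_distr_bigA.
apply: eq_bigr => x _; rewrite (binT_widen _ (fun j => b x ^+ j) (leq_csize xi x)).
rewrite addrC exprDn /binT; apply: eq_bigr => k _.
by rewrite -mulrA mulr_natl.
Qed.

Lemma sitesT_sum (R : realType) (n : nat) (c : R) (s : seq 'I_n.+1) (I : Type)
    (r : seq I) (P : pred I) (a : I -> R) (g : I -> config n -> R) :
  sitesT c s (fun xi => \sum_(i <- r | P i) a i * g i xi) =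
  fun xi => \sum_(i <- r | P i) a i * sitesT c s (g i) xi.
Proof.
elim: r => [|i r IH].
  rewrite (_ : (fun xi => _) = fun xi => 0 * 0 + 0 * 0); last first.
    by apply/funext => xi; rewrite big_nil; ring.
  by rewrite (sitesT_lin c 0 0 s (fun=> 0) (fun=> 0)); apply/funext => xi;
    rewrite big_nil; ring.
have [Pi|nPi] := boolP (P i); last first.
  rewrite (_ : (fun xi => _) = fun xi => \sum_(i <- r | P i) a i * g i xi).
    by rewrite IH; apply/funext => xi; rewrite big_cons (negbTE nPi).
  by apply/funext => xi; rewrite big_cons (negbTE nPi).
rewrite (_ : (fun xi => _) = fun xi => a i * g i xi +
  1 * \sum_(i <- r | P i) a i * g i xi); last first.
  by apply/funext => xi; rewrite big_cons Pi mul1r.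
by rewrite sitesT_lin IH; apply/funext => xi; rewrite big_cons Pi mul1r.
Qed.

(** The dual generator seen from the bulk, when each particle absorbed at L or R counts for a factor
    [bL] or [bR]; see [dgen_rpow]. *)
Definition bgen (R : realType) (n : nat) (sigma : int) (G : geometry R n) (bL bR : R)
    (g : config n -> R) (xi : config n) : R :=
  gen_bulk sigma G g xi +
  omegaL G * alphaL G * (xi ord0)%:R * (bL * g (remp xi ord0) - g xi) +
  omegaR G * alphaR G * (xi ord_max)%:R * (bR * g (remp xi ord_max) - g xi).

Lemma shiftT_genE (R : realType) (n : nat) (sigma : int) (G : geometry R n) (c : R)
    (x y : 'I_n.+1) (g : config n -> R) : x != y ->
  shiftT c (genE sigma G x y g) = genE sigma G x y (shiftT c g).
Proof.
move=> xy; rewrite !genE_lower//.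
rewrite -!shiftT_raiseB {1}/shiftT.
rewrite (_ : (fun xi => _ + _ + _) = fun xi =>
  1 * ((alpha G y)%:R * lower x (raiseB x y g) xi +
       (alpha G x)%:R * lower y (raiseB y x g) xi) +
  sigma%:~R * lower x (lower y (raiseB x y (raiseB x y g))) xi); last first.
  by apply/funext => xi; rewrite mul1r.
rewrite !sitesT_lin !sitesT_lower; apply/funext => xi.
by rewrite mul1r.
Qed.

(** In this form the exit term is a (b - [raise]), so displacing [raise] by [- c] amounts to
    replacing [b] by [b + c]: the shift acts on the reservoirs through their parameters only. *)
Lemma lower_exit (R : realType) (n : nat) (x : 'I_n.+1) (b : R) (g : config n -> R)
    (xi : config n) :
  (xi x)%:R * (b * g (remp xi x) - g xi) =
  lower x (fun z => b * g z + (-1) * raise x g z) xi.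
Proof.
rewrite /lower /raise; have [->|x0] := posnP (xi x); first by rewrite !mul0r.
congr (_ * _); rewrite mulN1r; congr (_ - g _); apply/ffunP => z; rewrite !ffunE.
by case: eqP => [->|_]; rewrite ?subnK ?subn0 ?addn0.
Qed.

Lemma shiftT_bgen (R : realType) (n : nat) (sigma : int) (G : geometry R n)
    (c bL bR : R) (g : config n -> R) :
  shiftT c (bgen sigma G bL bR g) = bgen sigma G (bL + c) (bR + c) (shiftT c g).
Proof.
have exit x b : shiftT c (fun xi => (xi x)%:R * (b * g (remp xi x) - g xi)) =
    fun xi => (xi x)%:R * ((b + c) * shiftT c g (remp xi x) - shiftT c g xi).
  rewrite (_ : (fun xi => _) = lower x (fun z => b * g z + (-1) * raise x g z)).
    rewrite /shiftT sitesT_lower sitesT_lin sitesT_raise ?index_enum_uniq//.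
    apply/funext => xi; rewrite lower_exit; congr (lower _ _ _); apply/funext => z.
    by rewrite mem_index_enum mul1r; ring.
  by apply/funext => xi; rewrite lower_exit.
have bulkE : shiftT c (gen_bulk sigma G g) = gen_bulk sigma G (shiftT c g).
  rewrite (_ : gen_bulk sigma G g = fun xi => \sum_(x < n.+1) 1 *
      \sum_(y < n.+1 | (x < y)%N && (omega G x y != 0)) omega G x y * genE sigma G x y g xi).
    rewrite /shiftT sitesT_sum; apply/funext => xi; apply: eq_bigr => x _.
    rewrite sitesT_sum mul1r; apply: eq_bigr => y /andP[xy _].
    rewrite -[sitesT _ _ _]/(shiftT c (genE sigma G x y g)) shiftT_genE//.
    by apply: contraTneq xy => ->; rewrite ltnn.
  by apply/funext => xi; apply: eq_bigr => x _; rewrite mul1r.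
rewrite (_ : bgen sigma G bL bR g = fun xi =>
  1 * (1 * gen_bulk sigma G g xi + (omegaL G * alphaL G) *
    ((xi ord0)%:R * (bL * g (remp xi ord0) - g xi))) +
  (omegaR G * alphaR G) * ((xi ord_max)%:R * (bR * g (remp xi ord_max) - g xi))); last first.
  by apply/funext => xi; rewrite /bgen; ring.
rewrite /shiftT !sitesT_lin -!/(shiftT c _) !exit bulkE.
by apply/funext => xi; rewrite /bgen; ring.
Qed.

(** * Consistency of the dual process *)

Lemma csize_addp (n : nat) (xi : config n) (x : 'I_n.+1) :
  csize (addp xi x) = (csize xi).+1.
Proof.
rewrite /csize; under eq_bigr do rewrite ffunE.
rewrite big_split /= -[RHS]addn1; congr addn.
by rewrite (bigD1 x)//= eqxx big1// => y /negbTE ->.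
Qed.

Lemma csize_remp (n : nat) (xi : config n) (x : 'I_n.+1) : (0 < xi x)%N ->
  csize xi = (csize (remp xi x)).+1.
Proof.
move=> x0; rewrite -(csize_addp _ x); congr csize; apply/ffunP => z; rewrite !ffunE.
by case: eqP => [->|_]; rewrite ?subnK ?subn0 ?addn0.
Qed.

(** * Jump structure of the generators, and finite classes of the dual process *)

Lemma confs_le (R : realType) (n : nat) (sigma : int) (G : geometry R n)
    (xi zeta : config n) :
  confs sigma G xi -> (forall x, (zeta x <= xi x)%N) -> confs sigma G zeta.
Proof. by move=> Dxi le s x; exact: leq_trans (le x) (Dxi s x). Qed.

Lemma confs_remp (R : realType) (n : nat) (sigma : int) (G : geometry R n)
    (xi : config n) (x : 'I_n.+1) : confs sigma G xi -> confs sigma G (remp xi x).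
Proof. by move=> Dxi; apply: (confs_le Dxi) => y; rewrite ffunE leq_subr. Qed.

Lemma occ_rate_ge0 (R : realType) (n : nat) (sigma : int) (G : geometry R n)
    (xi : config n) (x : 'I_n.+1) : sigma \in [:: -1; 0; 1] ->
  confs sigma G xi -> 0 <= occ_rate sigma G xi x.
Proof.
rewrite !inE /occ_rate => /or3P[] /eqP -> Dxi.
- by rewrite mulrN1z mulN1r subr_ge0 ler_nat Dxi.
- by rewrite mul0r addr0 ler0n.
- by rewrite mul1r addr_ge0.
Qed.

(** For sigma = -1 a nonzero [occ_rate] says exactly that there is room left at [x]. *)
Lemma confs_addp (R : realType) (n : nat) (sigma : int) (G : geometry R n)
    (xi zeta : config n) (x : 'I_n.+1) :
  confs sigma G xi -> occ_rate sigma G xi x != 0 ->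
  (forall y, (zeta y <= xi y)%N) -> confs sigma G (addp zeta x).
Proof.
move=> Dxi rx le s y; rewrite ffunE; have [->|_] := eqVneq y x; last first.
  by rewrite addn0; exact: leq_trans (le y) (Dxi s y).
rewrite addn1; apply: (leq_ltn_trans (le x)); rewrite ltn_neqAle Dxi// andbT.
by apply: contra rx => /eqP e; rewrite /occ_rate s e mulrN1z mulN1r subrr.
Qed.

(** The embedding [e] lets one argument serve both processes: the identity for the driven one, and
    [c] with frozen reservoir contents for the dual. As exchanges preserve [csize], [D] may be a
    class of fixed size. *)
Lemma jump_at_genE (R : realType) (n : nat) (sigma : int) (G : geometry R n)
    (S : countType) (D : set S) (e : config n -> S) (eta : config n) (x y : 'I_n.+1) :
  sigma \in [:: -1; 0; 1] -> confs sigma G eta -> x != y ->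
  (forall c, confs sigma G c -> csize c = csize eta -> D (e c)) ->
  jump_at D (fun f _ => genE sigma G x y (fun c => f (e c)) eta) (e eta).
Proof.
move=> hs De xy eD.
have step u v : u != v -> jump_at D (fun f _ =>
    (eta u)%:R * occ_rate sigma G eta v * (f (e (addp (remp eta u) v)) - f (e eta))) (e eta).
  move=> uv; have := @jump_at_step R S D (e eta) (e (addp (remp eta u) v))
    ((eta u)%:R * occ_rate sigma G eta v).
  apply; first by rewrite mulr_ge0// occ_rate_ge0.
  rewrite mulf_eq0 negb_or pnatr_eq0 -lt0n => /andP[u0 rv]; apply: eD.
    by apply: (confs_addp De rv) => z; rewrite ffunE leq_subr.
  by rewrite csize_addp -csize_remp.
by apply: (jump_atD (step x y xy)); apply: step; rewrite eq_sym.
Qed.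

Lemma jump_at_gen_bulk (R : realType) (n : nat) (sigma : int) (G : geometry R n)
    (S : countType) (D : set S) (e : config n -> S) (eta : config n) :
  sigma \in [:: -1; 0; 1] -> confs sigma G eta ->
  (forall c, confs sigma G c -> csize c = csize eta -> D (e c)) ->
  jump_at D (fun f _ => gen_bulk sigma G (fun c => f (e c)) eta) (e eta).
Proof.
move=> hs De eD; apply: jump_at_bigD => x _; apply: jump_at_bigD => y /andP[xy _].
apply: jump_atZ; first exact: omega_ge0.
by apply: jump_at_genE => //; apply: contraTneq xy => ->; rewrite ltnn.
Qed.

Lemma Theta_ge0 (R : realType) (sigma : int) (theta : R) :
  Theta sigma theta -> 0 <= theta.
Proof. by rewrite /Theta; case: ifP => _; rewrite /= in_itv/= => /andP[]. Qed.

Lemma exit_rate_ge0 (R : realType) (sigma : int) (theta : R) :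
  sigma \in [:: -1; 0; 1] -> Theta sigma theta -> 0 <= 1 + sigma%:~R * theta.
Proof.
rewrite !inE => /or3P[] /eqP ->; rewrite /Theta /= in_itv/= => /andP[t0 t1].
- by rewrite mulrN1z mulN1r subr_ge0.
- by rewrite mul0r addr0.
- by rewrite mul1r addr_ge0.
Qed.

Lemma jump_at_reservoir (R : realType) (n : nat) (sigma : int) (G : geometry R n)
    (a theta : R) (x : 'I_n.+1) (eta : config n) :
  sigma \in [:: -1; 0; 1] -> confs sigma G eta -> 0 <= a -> Theta sigma theta ->
  jump_at (confs sigma G) (fun f => gen_reservoir sigma G a theta x f) eta.
Proof.
move=> hs De a0 ht; have t0 := Theta_ge0 ht; rewrite /gen_reservoir.
apply: (@jump_atD R _ (confs sigma G)
  (fun f eta => (eta x)%:R * a * (1 + sigma%:~R * theta) * (f (remp eta x) - f eta))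
  (fun f eta => a * theta * occ_rate sigma G eta x * (f (addp eta x) - f eta))).
- have := @jump_at_step R _ (confs sigma G) eta (remp eta x)
    ((eta x)%:R * a * (1 + sigma%:~R * theta)).
  apply; first by rewrite !mulr_ge0// exit_rate_ge0.
  by move=> _; exact: confs_remp.
- have := @jump_at_step R _ (confs sigma G) eta (addp eta x)
    (a * theta * occ_rate sigma G eta x).
  apply; first by rewrite !mulr_ge0// occ_rate_ge0.
  by rewrite mulf_eq0 negb_or => /andP[_ rx]; exact: (confs_addp De rx).
Qed.

Lemma jump_at_gen (R : realType) (n : nat) (sigma : int) (G : geometry R n)
    (thetaL thetaR : R) (eta : config n) :
  sigma \in [:: -1; 0; 1] -> Theta sigma thetaL -> Theta sigma thetaR ->
  confs sigma G eta -> jump_at (confs sigma G) (gen sigma G thetaL thetaR) eta.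
Proof.
move=> hs hL hR De.
rewrite /gen; apply: (@jump_atD R _ (confs sigma G) (fun f eta => gen_bulk sigma G f eta +
  omegaL G * gen_reservoir sigma G (alphaL G) thetaL ord0 f eta)); last first.
  apply: jump_atZ; first exact: omegaR_ge0.
  by apply: jump_at_reservoir => //; exact/ltW/alphaR_gt0.
apply: jump_atD; last first.
  apply: jump_atZ; first exact: omegaL_ge0.
  by apply: jump_at_reservoir => //; exact/ltW/alphaL_gt0.
by have := @jump_at_gen_bulk R n sigma G _ (confs sigma G) id eta hs De; apply.
Qed.

Lemma dsizeE (n : nat) (z : dconfig n) : dsize z = (atL z + atR z + csize (bulk z))%N.
Proof. by []. Qed.

Lemma finite_dclass (R : realType) (n : nat) (sigma : int) (G : geometry R n) (k : nat) :
  finite_set [set z | dconfs sigma G z /\ dsize z = k].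
Proof.
pose h (u : {ffun 'I_n.+1 -> 'I_k.+1} * 'I_k.+1 * 'I_k.+1) : dconfig n :=
  (cfg u.1.1, (u.1.2 : nat), (u.2 : nat)).
apply: (@sub_finite_set _ _ (h @` setT)); last by apply: finite_image; exact: finite_finset.
move=> [[c l] r] [_]; rewrite dsizeE /= => e.
have cx x : (c x < k.+1)%N by rewrite ltnS -e (leq_trans (leq_csize c x))// leq_addl.
have lk : (l < k.+1)%N by rewrite ltnS -e -addnA leq_addr.
have rk : (r < k.+1)%N by rewrite ltnS -e addnAC leq_addl.
exists ([ffun x => Ordinal (cx x)], Ordinal lk, Ordinal rk) => //.
by congr (_, _, _); apply/ffunP => x; rewrite !ffunE.
Qed.

Definition dclass (R : realType) (n : nat) (sigma : int) (G : geometry R n) (k : nat) :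
    seq (dconfig n) :=
  finmap.enum_fset (fset_set [set z | dconfs sigma G z /\ dsize z = k]).

Lemma mem_dclass (R : realType) (n : nat) (sigma : int) (G : geometry R n) (k : nat)
    (z : dconfig n) :
  z \in dclass sigma G k <-> dconfs sigma G z /\ dsize z = k.
Proof.
have := in_fset_set (finite_dclass sigma G k) z.
rewrite -[X in X = _]/(z \in dclass sigma G k) => ->.
by split; [move/set_mem|move/mem_set].
Qed.

Lemma dclass_finite_class (R : realType) (n : nat) (sigma : int) (G : geometry R n)
    (k : nat) : sigma \in [:: -1; 0; 1] ->
  finite_class (dconfs sigma G) (dgen sigma G) (dclass sigma G k).
Proof.
move=> hs; split; first exact: finmap.fset_uniq.
  by move=> z /mem_dclass[].
move=> [[c l] r] /mem_dclass[Dc]; rewrite dsizeE /= => e.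
have exit (x : 'I_n.+1) (a : R) (s : dconfig n) : 0 <= a ->
    ((0 < c x)%N -> s \in dclass sigma G k) ->
    jump_at [set` dclass sigma G k]
      (fun f (_ : dconfig n) => a * (c x)%:R * (f s - f (c, l, r))) (c, l, r).
  move=> a0 sk; have := @jump_at_step R _ [set` dclass sigma G k] (c, l, r) s (a * (c x)%:R).
  apply; first by rewrite mulr_ge0.
  by rewrite mulf_eq0 negb_or pnatr_eq0 -lt0n => /andP[_ /sk].
rewrite /dgen; apply: (@jump_atD R _ _ (fun f xi =>
  gen_bulk sigma G (fun c => f (c, atL xi, atR xi)) (bulk xi) +
  omegaL G * alphaL G * (bulk xi ord0)%:R *
    (f (remp (bulk xi) ord0, (atL xi).+1, atR xi) - f xi))); last first.
  apply: exit; first by rewrite mulr_ge0 ?omegaR_ge0// ltW// alphaR_gt0.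
  move=> x0; apply/mem_dclass; split; first exact: confs_remp.
  by rewrite dsizeE /= -e (csize_remp x0) addnS addSn addnS.
apply: jump_atD; last first.
  apply: exit; first by rewrite mulr_ge0 ?omegaL_ge0// ltW// alphaL_gt0.
  move=> x0; apply/mem_dclass; split; first exact: confs_remp.
  by rewrite dsizeE /= -e (csize_remp x0) addnS !addSn.
apply: (@jump_at_gen_bulk R n sigma G _ _ (fun c => (c, l, r)) c hs) => // c' Dc' cc'.
by apply/mem_dclass; split => //; rewrite dsizeE /= -e cc'.
Qed.

Lemma gen_bulkZ (R : realType) (n : nat) (sigma : int) (G : geometry R n) (k : R)
    (g : config n -> R) (xi : config n) :
  gen_bulk sigma G (fun c => k * g c) xi = k * gen_bulk sigma G g xi.
Proof.
rewrite /gen_bulk mulr_sumr; apply: eq_bigr => x _; rewrite mulr_sumr.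
by apply: eq_bigr => y _; rewrite /genE; ring.
Qed.

Definition rpow (R : realType) (n : nat) (bL bR : R) (g : config n -> R)
    (z : dconfig n) : R := bL ^+ atL z * bR ^+ atR z * g (bulk z).

Lemma dgen_rpow (R : realType) (n : nat) (sigma : int) (G : geometry R n) (bL bR : R)
    (g : config n -> R) (z : dconfig n) :
  dgen sigma G (rpow bL bR g) z = rpow bL bR (bgen sigma G bL bR g) z.
Proof.
case: z => [[c l] r]; rewrite /dgen /rpow /bgen /bulk /atL /atR /= gen_bulkZ !exprS.
by ring.
Qed.

(* As [dsize] is conserved, the law at time [t] is carried by the class of [z]. *)
Definition Et (R : realType) (n : nat) (sigma : int) (G : geometry R n)
    (p : R -> dconfig n -> dconfig n -> R) (t : R) (f : dconfig n -> R)
    (z : dconfig n) : R := Qt (dclass sigma G (dsize z)) p t f z.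

(** Absorbed particles are inert: adding [l] and [r] of them carries one closed class into another
    and respects the dynamics, so both sides solve the same backward equation with the same initial
    value. *)
Lemma Et_shift (R : realType) (n : nat) (sigma : int) (G : geometry R n)
    (p : R -> dconfig n -> dconfig n -> R) (t bL bR : R) (g : config n -> R)
    (z : dconfig n) :
  sigma \in [:: -1; 0; 1] -> markov_semigroup (dconfs sigma G) p (dgen sigma G) ->
  0 <= t -> dconfs sigma G z ->
  Et sigma G p t (rpow bL bR g) z =
  rpow bL bR (fun c => Et sigma G p t (rpow bL bR g) (c, 0%N, 0%N)) z.
Proof.
move=> hs Hp t0; case: z => [[c l] r] Dc; rewrite {2}/rpow /=.
pose k := dsize ((c, 0%N, 0%N) : dconfig n).
have HF j := dclass_finite_class G j hs.
pose sh (z : dconfig n) : dconfig n := (bulk z, (atL z + l)%N, (atR z + r)%N).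
have shk z : z \in dclass sigma G k -> sh z \in dclass sigma G (dsize ((c, l, r) : dconfig n)).
  move=> /mem_dclass[Dz zk]; apply/mem_dclass; split => //.
  by move: zk; rewrite /k !dsizeE /sh /= => zk; rewrite addnACA addnAC zk [RHS]addnC.
have ck : (c, 0%N, 0%N) \in dclass sigma G k by apply/mem_dclass.
pose v s z := Qt (dclass sigma G (dsize ((c, l, r) : dconfig n))) p s (rpow bL bR g) (sh z).
transitivity (v t (c, 0%N, 0%N)); first by [].
rewrite (@Qt_unique R _ _ _ _ p (fun z => bL ^+ l * bR ^+ r * rpow bL bR g z) v Hp (HF k))//.
- rewrite /Et -/k /Qt mulr_sumr; apply: eq_bigr => z _; ring.
- move=> z zk; rewrite /v (Qt0 _ Hp (HF _))//; last exact: shk.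
  by rewrite /rpow /= !exprD; ring.
(* The equation for [v] holds by conversion, as [(atL z).+1 + l] reduces to [(atL z + l).+1]. *)
- move=> s z s0 zk; have := @Qt_backward _ _ _ _ _ _ _ (rpow bL bR g) _ Hp (HF _) s0 (shk z zk).
  by [].
- by move=> s z s0 zk; have := @Qt_lcont _ _ _ _ _ _ _ (rpow bL bR g) _ Hp (HF _) s0 (shk z zk).
Qed.

Lemma Et_rderiv (R : realType) (n : nat) (sigma : int) (G : geometry R n)
    (p : R -> dconfig n -> dconfig n -> R) (t bL bR : R) (g : config n -> R)
    (c : config n) :
  sigma \in [:: -1; 0; 1] -> markov_semigroup (dconfs sigma G) p (dgen sigma G) ->
  0 <= t -> confs sigma G c ->
  rderiv (fun s => Et sigma G p s (rpow bL bR g) (c, 0%N, 0%N)) t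
    (bgen sigma G bL bR (fun c => Et sigma G p t (rpow bL bR g) (c, 0%N, 0%N)) c).
Proof.
move=> hs Hp t0 Dc; set z : dconfig n := (c, 0%N, 0%N).
have HF := dclass_finite_class G (dsize z) hs.
have zk : z \in dclass sigma G (dsize z) by apply/mem_dclass.
have := @Qt_backward _ _ _ _ _ _ _ (rpow bL bR g) _ Hp HF t0 zk.
(* On the class, [Et_shift] writes the evolved function as a function of the bulk times reservoir
   factors, the form to which [dgen_rpow] applies. *)
rewrite (jump_at_local (g := rpow bL bR (fun c => Et sigma G p t (rpow bL bR g) (c, 0%N, 0%N)))
  (class_jump HF zk) zk).
  by rewrite dgen_rpow /rpow /= !expr0 !mul1r.
move=> y /= /mem_dclass[Dy ys]; rewrite -Et_shift//.
by rewrite /Et ys.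
Qed.

(* Consistency of the dual process: removing particles commutes with its
   dynamics, so that shifting all parameters by [c] amounts to a binomial sum. *)
Lemma Et_consistency (R : realType) (n : nat) (sigma : int) (G : geometry R n)
    (p : R -> dconfig n -> dconfig n -> R) (t c bL bR : R) (b : 'I_n.+1 -> R)
    (xi : config n) :
  sigma \in [:: -1; 0; 1] -> markov_semigroup (dconfs sigma G) p (dgen sigma G) ->
  0 <= t -> confs sigma G xi ->
  Et sigma G p t (rpow (bL + c) (bR + c) (cpow (fun x => b x + c))) (xi, 0%N, 0%N) =
  shiftT c (fun zeta => Et sigma G p t (rpow bL bR (cpow b)) (zeta, 0%N, 0%N)) xi.
Proof.
move=> hs Hp t0 Dxi.
pose k := dsize ((xi, 0%N, 0%N) : dconfig n).
have HF := dclass_finite_class G k hs.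
pose m s zeta := Et sigma G p s (rpow bL bR (cpow b)) (zeta, 0%N, 0%N).
(* The candidate solution: the shifted function of the bulk with reservoir factors restored. By
   [shiftT_bgen] it solves the backward equation, and at time 0 it is the right datum by
   [shiftT_cpow]. *)
pose v s := rpow (bL + c) (bR + c) (shiftT c (m s)).
have xik : (xi, 0%N, 0%N) \in dclass sigma G k by apply/mem_dclass.
transitivity (v t (xi, 0%N, 0%N)); last by rewrite /v /rpow /= !expr0 !mul1r.
have ck (z : dconfig n) : z \in dclass sigma G k -> forall x, (bulk z x <= k)%N.
  move=> /mem_dclass[_ <-] x; rewrite dsizeE (leq_trans (leq_csize _ x))//.
  exact: leq_addl.
have below (z : dconfig n) (u : {ffun 'I_n.+1 -> 'I_k.+1}) : dconfs sigma G z ->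
    [forall x, (u x <= bulk z x)%N] -> confs sigma G (cfg u).
  by move=> Dz /forallP uz; apply: (confs_le Dz) => x; rewrite ffunE.
symmetry; apply: (@Qt_unique R _ _ _ _ p _ v Hp HF).
- move=> z zk; have [Dz _] := (mem_dclass _ _ _ _).1 zk.
  rewrite /v /rpow; congr (_ * _); rewrite -shiftT_cpow !(shiftT_msum _ _ (ck z zk)).
  apply: eq_msum => u uz; have Du := confs_le Dz uz.
  rewrite /m /Et (Qt0 _ Hp (dclass_finite_class G _ hs)); last by apply/mem_dclass.
  by rewrite /rpow /= !expr0 !mul1r.
- move=> s z s0 zk; have [Dz _] := (mem_dclass _ _ _ _).1 zk.
  rewrite /v dgen_rpow -shiftT_bgen /rpow; apply: rderivZ.
  rewrite (shiftT_msum _ _ (ck z zk)) msum_below.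
  under eq_fun do rewrite (shiftT_msum _ _ (ck z zk)) msum_below.
  by apply: (@rderiv_sum _ _ _ _ _ (fun u s => m s (cfg u)) s
    (fun u => bgen sigma G bL bR (m s) (cfg u))) => u uz; apply: Et_rderiv => //; exact: below uz.
- move=> s z s0 zk; have [Dz _] := (mem_dclass _ _ _ _).1 zk.
  rewrite /lcont /v /rpow; apply: cvgMl_tmp.
  under eq_fun do rewrite (shiftT_msum _ _ (ck z zk)) msum_below.
  rewrite (shiftT_msum _ _ (ck z zk)) msum_below.
  apply: (@lcont_sum _ _ _ _ _ (fun u s => m s (cfg u))) => u uz; apply: (@Qt_lcont _ _ _ _ _ p s
    (rpow bL bR (cpow b)) (cfg u, 0%N, 0%N) Hp (dclass_finite_class G _ hs) s0).
  by apply/mem_dclass; split => //; exact: below uz.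
- exact: t0.
- exact: xik.
Qed.

(** All states in the class of [z] have [dsize z] particles, each contributing one factor [d]. *)
Lemma Et_scale (R : realType) (n : nat) (sigma : int) (G : geometry R n)
    (p : R -> dconfig n -> dconfig n -> R) (t d bL bR : R) (b : 'I_n.+1 -> R)
    (z : dconfig n) :
  Et sigma G p t (rpow (d * bL) (d * bR) (cpow (fun x => d * b x))) z =
  d ^+ dsize z * Et sigma G p t (rpow bL bR (cpow b)) z.
Proof.
rewrite /Et /Qt mulr_sumr [LHS]big_seq [RHS]big_seq; apply: eq_bigr => y /mem_dclass[_ <-].
rewrite /rpow.
have -> : cpow (fun x => d * b x) (bulk y) = d ^+ csize (bulk y) * cpow b (bulk y).
  by rewrite /cpow /csize -prodrXr -big_split /=; apply: eq_bigr => x _; rewrite exprMn.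
by rewrite dsizeE !exprMn !exprD; ring.
Qed.

(** Relative to [thetaR], the parameters at L, at R and at [x] are [d] times 1, 0 and [beta x].
    Hence the factors [rpow 1 0], in which the power of 0 is the indicator that no particle sits at
    R. *)
Lemma Et_interp (R : realType) (n : nat) (sigma : int) (G : geometry R n)
    (p : R -> dconfig n -> dconfig n -> R) (t thetaL thetaR : R)
    (beta beta' : 'I_n.+1 -> R) (m : nat) (xi : config n) :
  sigma \in [:: -1; 0; 1] -> markov_semigroup (dconfs sigma G) p (dgen sigma G) ->
  0 <= t -> confs sigma G xi -> (forall x, (xi x <= m)%N) ->
  msum m (fun x => - interp thetaL thetaR beta' x) (fun zeta =>
    Et sigma G p t (rpow thetaL thetaR (cpow (interp thetaL thetaR beta)))
      (zeta, 0%N, 0%N)) xi =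
  (thetaL - thetaR) ^+ csize xi *
  msum m (fun x => - beta' x) (fun zeta =>
    Et sigma G p t (rpow 1 0 (cpow beta)) (zeta, 0%N, 0%N)) xi.
Proof.
move=> hs Hp t0 Dxi xim; set d := thetaL - thetaR.
rewrite -msum_scale.
transitivity (msum m (fun x => - interp thetaL thetaR beta' x)
  (msum m (fun=> thetaR) (fun zeta =>
    d ^+ csize zeta * Et sigma G p t (rpow 1 0 (cpow beta)) (zeta, 0%N, 0%N))) xi).
  apply: eq_msum => zeta zxi; have Dz := confs_le Dxi zxi.
  have zm x : (zeta x <= m)%N by exact: leq_trans (zxi x) (xim x).
  rewrite -(shiftT_msum _ _ zm).
  have -> : (fun z => d ^+ csize z * Et sigma G p t (rpow 1 0 (cpow beta)) (z, 0%N, 0%N)) =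
      (fun z => Et sigma G p t (rpow d 0 (cpow (fun x => d * beta x))) (z, 0%N, 0%N)).
    apply/funext => z; have := @Et_scale R n sigma G p t d 1 0 beta (z, 0%N, 0%N).
    by rewrite mulr1 mulr0 => ->.
  rewrite -Et_consistency// add0r /d subrK; congr (Et _ _ _ _ (rpow _ _ (cpow _)) _).
  by apply/funext => x; rewrite /interp addrC mulrC.
rewrite msum_comp//; congr (msum _ _ _ _); apply/funext => x.
by rewrite /interp /d; ring.
Qed.

(** * Duality *)

(** For sigma = -1 and [l = a], truncated subtraction would leave a nonzero left-hand side against a
    factor 0 on the right; hence the condition [l < a]. *)
Lemma w_S (R : realType) (sigma : int) (a l : nat) : sigma \in [:: -1; 0; 1] ->
  (0 < a)%N -> (sigma = -1 -> (l < a)%N) ->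
  w_ R sigma a l.+1 = w_ R sigma a l * (a%:R + sigma%:~R * l%:R).
Proof.
rewrite !inE /w_ => /or3P[] /eqP -> a0 /= la.
- have {}la := la erefl; rewrite mulrN1z mulN1r -natrB; last exact: ltnW.
  have -> : (a - l = (a - l.+1).+1)%N by rewrite -subSn// subSS.
  rewrite factS natrM; field.
  by rewrite pnatr_eq0 -lt0n fact_gt0 /= nat1r pnatr_eq0.
- by rewrite exprSr mul0r addr0.
- rewrite mul1r -natrD addnS /=.
  have := ltn_addr l a0; case: (a + l)%N => // k _.
  by rewrite factS natrM /=; ring.
Qed.

Lemma w_gt0 (R : realType) (sigma : int) (a l : nat) : (0 < a)%N -> 0 < w_ R sigma a l.
Proof.
move=> a0; rewrite /w_; case: ifP => _; first by rewrite divr_gt0// ltr0n fact_gt0.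
case: ifP => _; first by rewrite exprn_gt0// ltr0n.
by rewrite divr_gt0// ltr0n fact_gt0.
Qed.

Lemma d_clE (R : realType) (sigma : int) (a l k : nat) :
  d_cl R sigma a l k = (k ^_ l)%:R / w_ R sigma a l.
Proof.
rewrite /d_cl; case: leqP => [lk|kl]; last by rewrite ffact_small// mul0r.
by rewrite -(ffact_fact lk) natrM mulfK// pnatr_eq0 -lt0n fact_gt0.
Qed.

Lemma d_cl_ge0 (R : realType) (sigma : int) (a l k : nat) : (0 < a)%N ->
  0 <= d_cl R sigma a l k.
Proof. by move=> a0; rewrite d_clE divr_ge0// ltW// w_gt0. Qed.

(** With [d_cl_down] and [d_cl_up], this trades multiplication by [m], and the moves of [m] weighted
    by their rates, for operations on [k]. Duality on an edge and at a reservoir follows from these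
    one-site relations by polynomial algebra. *)
Lemma d_cl_diag (R : realType) (sigma : int) (a k m : nat) :
  sigma \in [:: -1; 0; 1] -> (0 < a)%N -> (sigma = -1 -> (m <= a)%N) ->
  (sigma = -1 -> (k <= a)%N) ->
  m%:R * d_cl R sigma a k m =
  k%:R * d_cl R sigma a k m + (a%:R + sigma%:~R * k%:R) * d_cl R sigma a k.+1 m.
Proof.
move=> hs a0 ma ka; rewrite !d_clE.
have w0 : w_ R sigma a k != 0 by rewrite gt_eqF// w_gt0.
have ff : (m ^_ k.+1)%:R = (m ^_ k)%:R * (m%:R - k%:R) :> R.
  rewrite ffactnSr natrM; have [km|mk] := leqP k m; first by rewrite natrB.
  by rewrite ffact_small// !mul0r.
(* At [k = a] with sigma = -1 the last coefficient is 0 and [w_S] does not apply; the relation then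
   says that [m] equals [a] or the function vanishes. *)
have [/andP[/eqP s1 /eqP kE]|nka] := boolP ((sigma == -1) && (k == a)).
  rewrite s1 kE mulrN1z mulN1r subrr mul0r addr0.
  have [ma1|am] := ltnP m a; first by rewrite ffact_small// !mul0r !mulr0.
  by have -> : m = a by apply/eqP; rewrite eqn_leq am ma.
have ka' : sigma = -1 -> (k < a)%N.
  by move=> s1; rewrite ltn_neqAle ka// andbT; move: nka; rewrite s1.
have := w_gt0 R sigma k.+1 a0; rewrite (w_S R hs a0 ka') ff => w1.
have r0 : a%:R + sigma%:~R * k%:R != 0 :> R.
  by apply: contraTneq w1 => ->; rewrite mulr0 ltxx.
by field; rewrite w0 r0.
Qed.

Lemma d_cl_down (R : realType) (sigma : int) (a k m : nat) :
  sigma \in [:: -1; 0; 1] -> (0 < a)%N -> (sigma = -1 -> (m <= a)%N) ->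
  (sigma = -1 -> (k <= a)%N) ->
  m%:R * d_cl R sigma a k m.-1 =
  (a%:R + sigma%:~R * k%:R) * d_cl R sigma a k.+1 m.
Proof.
move=> hs a0 ma ka; have := d_cl_diag R hs a0 ma ka.
have -> : m%:R * d_cl R sigma a k m.-1 = (m%:R - k%:R) * d_cl R sigma a k m.
  rewrite !d_clE !mulrA; congr (_ / _); case: m {ma} => [|m] /=.
    by rewrite mul0r; case: k {ka} => [|k]; rewrite ?subrr ?mul0r// ffact0n mulr0.
  rewrite -natrM -ffactSS ffactnSr natrM mulrC.
  have [km|mk] := leqP k m.+1; first by rewrite natrB.
  by rewrite ffact_small// !mulr0.
by move=> e; rewrite mulrBl e; ring.
Qed.

Lemma d_cl_up (R : realType) (sigma : int) (a k m : nat) :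
  sigma \in [:: -1; 0; 1] -> (0 < a)%N -> (sigma = -1 -> (k <= a)%N) ->
  (a%:R + sigma%:~R * m%:R) * d_cl R sigma a k m.+1 =
  (a%:R + sigma%:~R * (m%:R + k%:R)) * d_cl R sigma a k m +
  k%:R * d_cl R sigma a k.-1 m.
Proof.
move=> hs a0; rewrite !d_clE; case: k => [_|k ka].
  by rewrite !ffactn0 mul0r !addr0.
have w0 : w_ R sigma a k != 0 by rewrite gt_eqF// w_gt0.
have := w_gt0 R sigma k.+1 a0; rewrite (w_S R hs a0 ka) /= => w1.
have r0 : a%:R + sigma%:~R * k%:R != 0 :> R.
  by apply: contraTneq w1 => ->; rewrite mulr0 ltxx.
have -> : (m ^_ k.+1)%:R = (m ^_ k)%:R * (m%:R - k%:R) :> R.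
  rewrite ffactnSr natrM; have [km|mk] := leqP k m; first by rewrite natrB.
  by rewrite ffact_small// !mul0r.
rewrite ffactSS natrM -!natr1.
by field; rewrite w0 r0.
Qed.

(* The factors of the classical duality function at the two reservoirs are
   supplied by [rpow]. *)
Definition Dcl (R : realType) (n : nat) (sigma : int) (G : geometry R n)
    (xi eta : config n) : R := \prod_x d_cl R sigma (alpha G x) (xi x) (eta x).

Lemma Dcl_ge0 (R : realType) (n : nat) (sigma : int) (G : geometry R n)
    (xi eta : config n) : 0 <= Dcl sigma G xi eta.
Proof. by apply: prodr_ge0 => x _; rewrite d_cl_ge0// alpha_gt0. Qed.

Lemma Dcl_split2 (R : realType) (n : nat) (sigma : int) (G : geometry R n)
    (x y : 'I_n.+1) (xi eta xi' eta' : config n) : x != y ->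
  (forall z, z != x -> z != y -> xi' z = xi z /\ eta' z = eta z) ->
  Dcl sigma G xi' eta' = d_cl R sigma (alpha G x) (xi' x) (eta' x) *
    d_cl R sigma (alpha G y) (xi' y) (eta' y) *
    \prod_(z | (z != x) && (z != y)) d_cl R sigma (alpha G z) (xi z) (eta z).
Proof.
move=> xy H; rewrite /Dcl (bigD1 x)//= (bigD1 y)/=; last by rewrite eq_sym.
by rewrite mulrA; congr (_ * _); apply: eq_bigr => z /andP[zx zy]; have [-> ->] := H z zx zy.
Qed.

Lemma Dcl_split1 (R : realType) (n : nat) (sigma : int) (G : geometry R n)
    (x : 'I_n.+1) (xi eta xi' eta' : config n) :
  (forall z, z != x -> xi' z = xi z /\ eta' z = eta z) ->
  Dcl sigma G xi' eta' = d_cl R sigma (alpha G x) (xi' x) (eta' x) *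
    \prod_(z | z != x) d_cl R sigma (alpha G z) (xi z) (eta z).
Proof.
move=> H; rewrite /Dcl (bigD1 x)//=.
by congr (_ * _); apply: eq_bigr => z zx; have [-> ->] := H z zx.
Qed.

Lemma genE_Dcl (R : realType) (n : nat) (sigma : int) (G : geometry R n)
    (x y : 'I_n.+1) (xi eta : config n) : sigma \in [:: -1; 0; 1] -> x != y ->
  confs sigma G xi -> confs sigma G eta ->
  genE sigma G x y (Dcl sigma G xi) eta = genE sigma G x y (Dcl sigma G ^~ eta) xi.
Proof.
move=> hs xy Dxi De.
have yx : (y == x) = false by rewrite eq_sym (negbTE xy).
have jump (c : config n) u v z : z != u -> z != v -> addp (remp c u) v z = c z.
  by move=> /negbTE zu /negbTE zv; rewrite !ffunE zu zv subn0 addn0.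
have jx (c : config n) : addp (remp c x) y x = (c x).-1 /\ addp (remp c x) y y = (c y).+1.
  by rewrite !ffunE !eqxx yx (negbTE xy) subn1 addn0 subn0 addn1.
have jy (c : config n) : addp (remp c y) x x = (c x).+1 /\ addp (remp c y) x y = (c y).-1.
  by rewrite !ffunE !eqxx yx (negbTE xy) subn1 addn0 subn0 addn1.
rewrite /genE /occ_rate.
rewrite (@Dcl_split2 R n sigma G x y xi eta xi eta xy)//.
rewrite (@Dcl_split2 R n sigma G x y xi eta xi (addp (remp eta x) y) xy); last first.
  by move=> z zx zy; rewrite jump.
rewrite (@Dcl_split2 R n sigma G x y xi eta xi (addp (remp eta y) x) xy); last first.
  by move=> z zx zy; rewrite jump.
rewrite (@Dcl_split2 R n sigma G x y xi eta (addp (remp xi x) y) eta xy); last first.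
  by move=> z zx zy; rewrite jump.
rewrite (@Dcl_split2 R n sigma G x y xi eta (addp (remp xi y) x) eta xy); last first.
  by move=> z zx zy; rewrite jump.
have [-> ->] := jx eta; have [-> ->] := jy eta.
have [-> ->] := jx xi; have [-> ->] := jy xi.
have rel z := (d_cl_diag R hs (alpha_gt0 G z) (De^~ z) (Dxi^~ z),
  d_cl_down R hs (alpha_gt0 G z) (De^~ z) (Dxi^~ z),
  d_cl_up R (eta z) hs (alpha_gt0 G z) (Dxi^~ z)).
have [[gx dx] ux] := rel x; have [[gy dy] uy] := rel y.
set P := \prod_(z | _) _.
set kx : R := (xi x)%:R in gx dx ux *; set ky : R := (xi y)%:R in gy dy uy *.
set nx : R := (eta x)%:R in gx dx ux *; set ny : R := (eta y)%:R in gy dy uy *.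
set ax : R := (alpha G x)%:R in gx dx ux *; set ay : R := (alpha G y)%:R in gy dy uy *.
set s : R := sigma%:~R in gx dx ux gy dy uy *.
set ex := d_cl _ _ _ (xi x) (eta x) in gx dx ux *.
set ey := d_cl _ _ _ (xi y) (eta y) in gy dy uy *.
set a1 := d_cl _ _ _ (xi x) (eta x).-1 in gx dx ux *.
set b1 := d_cl _ _ _ (xi y) (eta y).-1 in gy dy uy *.
set a2 := d_cl _ _ _ (xi x) (eta x).+1 in gx dx ux *.
set b2 := d_cl _ _ _ (xi y) (eta y).+1 in gy dy uy *.
set a3 := d_cl _ _ _ (xi x).-1 (eta x) in gx dx ux *.
set b3 := d_cl _ _ _ (xi y).-1 (eta y) in gy dy uy *.
set a4 := d_cl _ _ _ (xi x).+1 (eta x) in gx dx ux *.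
set b4 := d_cl _ _ _ (xi y).+1 (eta y) in gy dy uy *.
(* Products are grouped so that their factors are left-hand sides of the one-site relations; after
   substitution only [ex], [ey] and the values at moved dual particles remain. *)
transitivity (((nx * a1) * ((ay + s * ny) * b2) - (nx * ex) * (ay * ey + s * (ny * ey)) +
  ((ny * b1) * ((ax + s * nx) * a2) - (ny * ey) * (ax * ex + s * (nx * ex)))) * P).
  by ring.
have ux' : (ax + s * nx) * a2 = ax * ex + s * (nx * ex) + s * (kx * ex) + kx * a3.
  by rewrite ux; ring.
have uy' : (ay + s * ny) * b2 = ay * ey + s * (ny * ey) + s * (ky * ey) + ky * b3.
  by rewrite uy; ring.
rewrite dx dy ux' uy' gx gy.
by ring.
Qed.

(** Up to the factor [a], with k = [xi x] and D the duality function, removal contributes - (1 +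
    sigma theta) k D, and creation theta k times the lowered D plus sigma theta k D. The terms in
    sigma theta cancel, leaving pure absorption. *)
Lemma gen_reservoir_Dcl (R : realType) (n : nat) (sigma : int) (G : geometry R n)
    (a theta : R) (x : 'I_n.+1) (xi eta : config n) : sigma \in [:: -1; 0; 1] ->
  confs sigma G xi -> confs sigma G eta ->
  gen_reservoir sigma G a theta x (Dcl sigma G xi) eta =
  a * (xi x)%:R * (theta * Dcl sigma G (remp xi x) eta - Dcl sigma G xi eta).
Proof.
move=> hs Dxi De; rewrite /gen_reservoir /occ_rate.
have rem (c : config n) z : z != x -> remp c x z = c z.
  by move=> /negbTE zx; rewrite !ffunE zx subn0.
have add (c : config n) z : z != x -> addp c x z = c z.
  by move=> /negbTE zx; rewrite !ffunE zx addn0.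
rewrite (@Dcl_split1 R n sigma G x xi eta xi eta)//.
rewrite (@Dcl_split1 R n sigma G x xi eta xi (remp eta x)); last first.
  by move=> z zx; rewrite rem.
rewrite (@Dcl_split1 R n sigma G x xi eta xi (addp eta x)); last first.
  by move=> z zx; rewrite add.
rewrite (@Dcl_split1 R n sigma G x xi eta (remp xi x) eta); last first.
  by move=> z zx; rewrite rem.
have remx (c : config n) : remp c x x = (c x).-1 by rewrite ffunE eqxx subn1.
have addx (c : config n) : addp c x x = (c x).+1 by rewrite ffunE eqxx addn1.
rewrite !remx addx.
have gx := d_cl_diag R hs (alpha_gt0 G x) (De^~ x) (Dxi^~ x).
have dx := d_cl_down R hs (alpha_gt0 G x) (De^~ x) (Dxi^~ x).
have ux := d_cl_up R (eta x) hs (alpha_gt0 G x) (Dxi^~ x).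
set P := \prod_(z | _) _.
set kx : R := (xi x)%:R in gx dx ux *; set nx : R := (eta x)%:R in gx dx ux *.
set ax : R := (alpha G x)%:R in gx dx ux *; set s : R := sigma%:~R in gx dx ux *.
set ex := d_cl _ _ _ (xi x) (eta x) in gx dx ux *.
set a1 := d_cl _ _ _ (xi x) (eta x).-1 in gx dx ux *.
set a2 := d_cl _ _ _ (xi x) (eta x).+1 in gx dx ux *.
set a3 := d_cl _ _ _ (xi x).-1 (eta x) in gx dx ux *.
set a4 := d_cl _ _ _ (xi x).+1 (eta x) in gx dx ux *.
transitivity (a * ((1 + s * theta) * (nx * a1 - nx * ex) +
  theta * ((ax + s * nx) * a2 - (ax * ex + s * (nx * ex)))) * P); first by ring.
have ux' : (ax + s * nx) * a2 = ax * ex + s * (nx * ex) + s * (kx * ex) + kx * a3.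
  by rewrite ux; ring.
rewrite dx ux' gx.
by ring.
Qed.

Lemma gen_Dcl (R : realType) (n : nat) (sigma : int) (G : geometry R n)
    (thetaL thetaR : R) (xi eta : config n) : sigma \in [:: -1; 0; 1] ->
  confs sigma G xi -> confs sigma G eta ->
  gen sigma G thetaL thetaR (Dcl sigma G xi) eta =
  bgen sigma G thetaL thetaR (Dcl sigma G ^~ eta) xi.
Proof.
move=> hs Dxi De; rewrite /gen /bgen !gen_reservoir_Dcl// !mulrA; congr (_ + _ + _).
rewrite /gen_bulk; apply: eq_bigr => x _; apply: eq_bigr => y /andP[xy _].
by rewrite genE_Dcl//; apply: contraTneq xy => ->; rewrite ltnn.
Qed.

(** * Growth bounds, and the duality relation for the semigroups *)

Lemma ffact_le_exp (m k : nat) : (m ^_ k <= m ^ k)%N.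
Proof.
elim: k => [|k IH]; first by rewrite ffactn0.
by rewrite ffactnSr expnSr leq_mul// leq_subr.
Qed.

(** A Lyapunov function: exchanges leave it unchanged and the reservoirs raise it by at most a
    multiple of itself, while degree [K] suffices to dominate [Dcl] with [K] dual particles. *)
Definition growth (R : realType) (n : nat) (K : nat) (eta : config n) : R :=
  (1 + (csize eta)%:R) ^+ K.

Lemma growth_ge1 (R : realType) (n K : nat) (eta : config n) : 1 <= growth R K eta.
Proof. by rewrite exprn_ege1// lerDl. Qed.

Lemma Dcl_growth (R : realType) (n : nat) (sigma : int) (G : geometry R n)
    (xi eta : config n) (k : nat) : (csize xi <= k)%N ->
  Dcl sigma G xi eta <=
  (\prod_x (w_ R sigma (alpha G x) (xi x))^-1) * growth R k eta.
Proof.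
move=> xk; have w0 x : 0 < w_ R sigma (alpha G x) (xi x) by rewrite w_gt0// alpha_gt0.
apply: (@le_trans _ _ ((\prod_x (w_ R sigma (alpha G x) (xi x))^-1) *
    \prod_x (1 + (csize eta)%:R) ^+ xi x)).
  rewrite -big_split /=; apply: ler_prod => x _; rewrite d_cl_ge0 ?alpha_gt0//=.
  rewrite d_clE mulrC ler_wpM2l ?invr_ge0 ?(ltW (w0 x))//.
  apply: (@le_trans _ _ ((eta x)%:R ^+ xi x)).
    by rewrite -natrX ler_nat ffact_le_exp.
  apply: lerXn2r; rewrite ?nnegrE ?addr_ge0//.
  by rewrite nat1r ler_nat ltnW// ltnS leq_csize.
apply: ler_wpM2l; first by apply: prodr_ge0 => x _; rewrite invr_ge0 ltW.
by rewrite prodrXr /growth -/(csize xi) ler_weXn2l// lerDl.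
Qed.

(** The factor [1 + s] stands for a creation rate that is linear in the number of particles. The
    constant 3 per degree is 2 + 1: [2 + s] is at most twice [1 + s], and each induction step adds
    one more term in [1 + s]. *)
Lemma pow_increment (R : realType) (s : R) (K : nat) : 0 <= s ->
  (1 + s) * ((2 + s) ^+ K - (1 + s) ^+ K) <= 3 ^+ K * (1 + s) ^+ K.
Proof.
move=> s0; elim: K => [|K IH]; first by rewrite !expr0; lra.
have p0 : 0 <= (1 + s) ^+ K by rewrite exprn_ge0// addr_ge0.
have t1 : 1 <= 3 ^+ K :> R by rewrite exprn_ege1// ler1n.
rewrite !exprS; set u := (2 + s) ^+ K in IH *; set v := (1 + s) ^+ K in IH p0 *.
set c := 3 ^+ K in IH t1 *.
have -> : (1 + s) * ((2 + s) * u - (1 + s) * v) =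
    (2 + s) * ((1 + s) * (u - v)) + (1 + s) * v by ring.
have H : (2 + s) * ((1 + s) * (u - v)) <= (2 + s) * (c * v).
  by apply: ler_wpM2l => //; lra.
have H1 : 0 <= (1 + s) * v by rewrite mulr_ge0//; lra.
have H2 : (1 + s) * v <= c * ((1 + s) * v) by rewrite ler_peMl.
have H3 : 0 <= c * (s * v) by rewrite !mulr_ge0//; lra.
lra.
Qed.

Lemma gen_bulk_growth (R : realType) (n : nat) (sigma : int) (G : geometry R n)
    (K : nat) (eta : config n) : gen_bulk sigma G (@growth R n K) eta = 0.
Proof.
have step (x y : 'I_n.+1) :
    (eta x)%:R * (growth R K (addp (remp eta x) y) - growth R K eta) = 0.
  have [->|x0] := posnP (eta x); first by rewrite mul0r.
  by rewrite /growth csize_addp -csize_remp// subrr mulr0.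
rewrite /gen_bulk big1// => x _; rewrite big1// => y _.
by rewrite /genE -mulrA mulrCA step mulr0 -mulrA mulrCA step !mulr0 addr0 mulr0.
Qed.

Lemma gen_reservoir_growth (R : realType) (n : nat) (sigma : int) (G : geometry R n)
    (a theta : R) (x : 'I_n.+1) (K : nat) (eta : config n) :
  sigma \in [:: -1; 0; 1] -> 0 <= a -> Theta sigma theta ->
  gen_reservoir sigma G a theta x (@growth R n K) eta <=
  a * theta * (alpha G x)%:R * 3 ^+ K * growth R K eta.
Proof.
move=> hs a0 ht; have t0 := Theta_ge0 ht; rewrite /gen_reservoir.
have le0 : (eta x)%:R * a * (1 + sigma%:~R * theta) *
    (growth R K (remp eta x) - growth R K eta) <= 0.
  have [->|x0] := posnP (eta x); first by rewrite !mul0r.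
  apply: mulr_ge0_le0; first by rewrite !mulr_ge0// exit_rate_ge0.
  rewrite subr_le0 /growth (csize_remp x0); apply: lerXn2r; rewrite ?nnegrE//.
  by rewrite lerD2l ler_nat.
rewrite -[leRHS]add0r; apply: lerD => //.
rewrite -!mulrA; apply: ler_wpM2l => //; apply: ler_wpM2l => //.
rewrite /growth csize_addp; set s : R := (csize eta)%:R.
have s0 : 0 <= s by rewrite ler0n.
have -> : 1 + (csize eta).+1%:R = 2 + s :> R by rewrite -natr1 -/s; ring.
have inc := pow_increment K s0.
have occ : occ_rate sigma G eta x <= (alpha G x)%:R * (1 + s).
  have a1 : 1 <= (alpha G x)%:R :> R by rewrite ler1n alpha_gt0.
  have es : (eta x)%:R <= s by rewrite ler_nat leq_csize.
  have e0 : 0 <= (eta x)%:R :> R by rewrite ler0n.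
  have as1 : s <= (alpha G x)%:R * s by rewrite ler_peMl.
  move: hs; rewrite /occ_rate !inE => /or3P[] /eqP ->.
  - by rewrite mulrN1z; lra.
  - by rewrite mulr0z mul0r; lra.
  - by rewrite mulr1z; lra.
apply: (@le_trans _ _ ((alpha G x)%:R * (1 + s) * ((2 + s) ^+ K - (1 + s) ^+ K))).
  apply: ler_wpM2r => //; rewrite subr_ge0; apply: lerXn2r; rewrite ?nnegrE; lra.
by rewrite -mulrA; apply: ler_wpM2l.
Qed.

Lemma gen_growth (R : realType) (n : nat) (sigma : int) (G : geometry R n)
    (thetaL thetaR : R) (K : nat) :
  sigma \in [:: -1; 0; 1] -> Theta sigma thetaL -> Theta sigma thetaR ->
  exists2 C, 0 <= C & forall eta : config n,
    gen sigma G thetaL thetaR (@growth R n K) eta <= C * growth R K eta.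
Proof.
move=> hs hL hR.
have [tL tR] := (Theta_ge0 hL, Theta_ge0 hR).
have [oL oR] := (omegaL_ge0 G, omegaR_ge0 G).
have [aL aR] := (ltW (alphaL_gt0 G), ltW (alphaR_gt0 G)).
exists (omegaL G * (alphaL G * thetaL * (alpha G ord0)%:R * 3 ^+ K) +
  omegaR G * (alphaR G * thetaR * (alpha G ord_max)%:R * 3 ^+ K)).
  by rewrite addr_ge0// !mulr_ge0// exprn_ge0.
move=> eta; rewrite /gen gen_bulk_growth add0r mulrDl -!(mulrA (omegaL G)) -!(mulrA (omegaR G)).
by apply: lerD; apply: ler_wpM2l => //; exact: gen_reservoir_growth.
Qed.

Lemma finite_csize (n M : nat) : finite_set [set c : config n | (csize c <= M)%N].
Proof.
apply: (@sub_finite_set _ _ ((@cfg n M) @` setT)); last first.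
  by apply: finite_image; exact: finite_finset.
move=> c /= cM.
have cx x : (c x < M.+1)%N by rewrite ltnS (leq_trans (leq_csize c x)).
by exists [ffun x => Ordinal (cx x)] => //; apply/ffunP => x; rewrite !ffunE.
Qed.

Lemma le_of_eps (R : realType) (a b K : R) : 0 < K ->
  (forall d, 0 < d -> a <= b + d * K) -> a <= b.
Proof.
move=> K0 H; apply/ler_addgt0Pr => e e0.
by have := H (e / K) (divr_gt0 e0 K0); rewrite divfK// gt_eqF.
Qed.

(** The extra degree in the weight is decisive: [delta * (1 + csize x) < B] bounds [csize x]
    uniformly in time. *)
Lemma finite_growth (R : realType) (n : nat) (D : set (config n)) (delta B T : R)
    (k : nat) (v : R -> config n -> R) : 0 < delta ->
  (forall (t : R) x, 0 <= t -> D x -> v t x <= B * growth R k x) ->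
  finite_set [set x | D x /\
    exists t : R, [/\ 0 <= t, t <= T & delta * growth R k.+1 x < v t x]].
Proof.
move=> d0 vB.
pose M' := Num.bound `|B / delta|.
apply: (sub_finite_set _ (@finite_csize n M')) => x [Dx [t [t0 _ H]]] /=.
have {H} := lt_le_trans H (vB t x t0 Dx).
rewrite /growth exprS mulrA ltr_pM2r ?exprn_gt0 ?ltr_pwDl//.
rewrite mulrC -ltr_pdivlMr// => H.
have M0 : B / delta < M'%:R.
  apply: le_lt_trans (ler_norm _) _; exact/archi_boundP/normr_ge0.
have : (csize x)%:R < M'%:R :> R by lra.
by rewrite ltr_nat => /ltnW.
Qed.

(* Both inequalities follow from the comparison principle applied to the
   truncations [f * 1_(|eta| <= M)]; the polynomial growth of [f] and of the dual
   side is absorbed by [growth k.+1]. *)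
Theorem duality (R : realType) (n : nat) (sigma : int) (G : geometry R n)
    (thetaL thetaR : R) (p : R -> config n -> config n -> R)
    (ph : R -> dconfig n -> dconfig n -> R) (t : R) (xi eta : config n) :
  sigma \in [:: -1; 0; 1] -> Theta sigma thetaL -> Theta sigma thetaR ->
  markov_semigroup (confs sigma G) p (gen sigma G thetaL thetaR) ->
  markov_semigroup (dconfs sigma G) ph (dgen sigma G) ->
  0 <= t -> confs sigma G xi -> confs sigma G eta ->
  (\esum_(y in confs sigma G) (p t eta y * Dcl sigma G xi y)%:E =
   (Et sigma G ph t (rpow thetaL thetaR (Dcl sigma G ^~ eta)) (xi, 0%N, 0%N))%:E)%E.
Proof.
move=> hs hL hR Hp Hph t0 Dxi Deta.
have [tL tR] := (Theta_ge0 hL, Theta_ge0 hR).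
set D := confs sigma G in Hp Dxi Deta *.
pose z0 : dconfig n := (xi, 0%N, 0%N); pose k := dsize z0.
pose F := dclass sigma G k.
have HF : finite_class (dconfs sigma G) (dgen sigma G) F by exact: dclass_finite_class.
have z0F : z0 \in F by apply/mem_dclass.
pose f := Dcl sigma G xi.
pose co (z : dconfig n) := thetaL ^+ atL z * thetaR ^+ atR z.
have co0 z : 0 <= co z by rewrite mulr_ge0// exprn_ge0.
pose g s y := Et sigma G ph s (rpow thetaL thetaR (Dcl sigma G ^~ y)) z0.
(* As a function of the configuration, [g s] is a finite combination of duality functions, so the
   generator can be applied term by term. *)
have gE s : g s = fun y => \sum_(z <- F) (ph s z0 z * co z) * Dcl sigma G (bulk z) y.
  apply/funext => y; rewrite /g /Et /Qt; apply: eq_bigr => z _.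
  by rewrite /rpow /co !mulrA.
have ph0 s z : 0 <= s -> z \in F -> 0 <= ph s z0 z <= 1.
  move=> s0 zF; have [uF FD _] := HF.
  rewrite (semigroup_ge0 Hph s0 (FD _ z0F) (FD _ zF))/=.
  rewrite -(class_mass Hph HF s0 z0F) (bigD1_seq z)//= lerDl big_seq_cond.
  by apply: sumr_ge0 => y /andP[yF _]; exact: semigroup_ge0 Hph s0 (FD _ z0F) (FD _ yF).
have g0 s y : 0 <= s -> 0 <= g s y.
  move=> s0; rewrite gE big_seq; apply: sumr_ge0 => z zF.
  have /andP[pz _] := ph0 s z s0 zF.
  by apply: mulr_ge0; [exact: mulr_ge0|exact: Dcl_ge0].
(* The forward equation of the dual, read through [gen_Dcl], is the backward equation of the driven
   process for [g]. *)
have gD s y : 0 <= s -> D y -> rderiv (g ^~ y) s (gen sigma G thetaL thetaR (g s) y).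
  move=> s0 Dy.
  have := @Qt_forward _ _ _ _ _ _ _ (rpow thetaL thetaR (Dcl sigma G ^~ y)) _
    Hph HF s0 z0F.
  rewrite gE (jump_at_sum _ _ _ (jump_at_gen hs hL hR Dy)).
  suff -> : Qt F ph s (dgen sigma G (rpow thetaL thetaR (Dcl sigma G ^~ y))) z0 =
      \sum_(z <- F) ph s z0 z * co z * gen sigma G thetaL thetaR (Dcl sigma G (bulk z)) y by [].
  rewrite /Qt [LHS]big_seq [RHS]big_seq; apply: eq_bigr => z /mem_dclass[Dz _].
  by rewrite dgen_rpow /rpow gen_Dcl// /co !mulrA.
have gl s y : 0 < s -> lcont (g ^~ y) s.
  move=> s0; exact: Qt_lcont Hph HF s0 z0F.
pose A z : R := \prod_x (w_ R sigma (alpha G x) (bulk z x))^-1.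
have gB s y : 0 <= s -> g s y <= (\sum_(z <- F) co z * A z) * growth R k y.
  move=> s0; rewrite gE mulr_suml [leLHS]big_seq [leRHS]big_seq; apply: ler_sum => z zF.
  have /mem_dclass[_ zk] := zF; have /andP[p0 p1] := ph0 s z s0 zF.
  have DA : Dcl sigma G (bulk z) y <= A z * growth R k y.
    by apply: Dcl_growth; rewrite -zk dsizeE leq_addl.
  rewrite -mulrA -[leRHS]mul1r -[X in _ <= _ * X]mulrA; apply: ler_pM => //.
    by rewrite mulr_ge0// Dcl_ge0.
  exact: ler_wpM2l.
set B := \sum_(z <- F) _ in gB.
have fB y : f y <= A z0 * growth R k y by apply: Dcl_growth; rewrite /k dsizeE.
have A0 : 0 <= A z0 by apply: prodr_ge0 => x _; rewrite invr_ge0 ltW// w_gt0// alpha_gt0.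
(* Truncated to at most [M] particles, [f] is bounded and [Pt] makes sense of it. *)
pose fM (M : nat) y : R := if (csize y <= M)%N then f y else 0.
have fMb M y : D y -> 0 <= fM M y <= A z0 * (1 + M%:R) ^+ k.
  move=> Dy; rewrite /fM; case: ifPn => yM; last first.
    by rewrite lexx mulr_ge0// exprn_ge0// addr_ge0.
  rewrite Dcl_ge0/=; apply: le_trans (fB y) _; apply: ler_wpM2l => //.
  by apply: lerXn2r; rewrite ?nnegrE// lerD2l ler_nat.
have [C C0 CW] := gen_growth G k.+1 hs hL hR.
have W0 (x : config n) : 0 < growth R k.+1 x by exact: lt_le_trans ltr01 (growth_ge1 _ _ _).
have g00 y : g 0 y = f y.
  by rewrite /g /Et (Qt0 _ Hph HF)// /rpow /= !expr0 !mul1r.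
have LJ y : D y -> jump_at D (gen sigma G thetaL thetaR) y by exact: jump_at_gen.
have E0 : 0 < expR ((C + 1) * t) * growth R k.+1 eta by rewrite mulr_gt0 ?expR_gt0.
have up M : Pt D p t (fM M) eta <= g t eta.
  apply: (le_of_eps E0) => d d0; rewrite -lerBlDl -[X in _ - X]mul1r mulrA.
  apply: (@comparison R _ D (gen sigma G thetaL thetaR) (@growth R n k.+1) C d t
    (fun s y => Pt D p s (fM M) y - 1 * g s y)) => //.
  - move=> y Dy; rewrite (Pt0 Hp)//; last by move=> u /(fMb M) /andP[].
    rewrite g00 mul1r (@le_trans _ _ 0)//; last by rewrite mulr_ge0// ltW.
    by rewrite subr_le0 /fM; case: ifP => // _; exact: Dcl_ge0.
  - move=> s y s0 Dy; eexists.
      exact: rderivB (Pt_rderiv Hp (fMb M) s0 Dy) (gD s y s0 Dy).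
    by rewrite (jump_atB _ _ _ (LJ y Dy)).
  - move=> s y s0 Dy; apply: lcontB; last exact: gl.
    exact: Pt_lcont Hp (fMb M) s0 Dy.
  - apply: (@finite_growth R n D d (A z0 * (1 + M%:R) ^+ k)) => // s y s0 Dy.
    have /andP[_ PM] := Pt_bound Hp (fMb M) s0 Dy.
    have gy := g0 s y s0; have G1 := growth_ge1 R k y.
    have AM : 0 <= A z0 * (1 + M%:R) ^+ k by rewrite mulr_ge0// exprn_ge0// addr_ge0.
    have : A z0 * (1 + M%:R) ^+ k <= A z0 * (1 + M%:R) ^+ k * growth R k y.
      by rewrite ler_peMr.
    lra.
have pf0 y : D y -> 0 <= p t eta y * f y.
  by move=> Dy; rewrite mulr_ge0 ?Dcl_ge0// (semigroup_ge0 Hp).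
apply/eqP; rewrite eq_le; apply/andP; split.
  (* A finite partial sum involves configurations of bounded size only, so some truncation dominates
     it. *)
  apply: ge_ereal_sup => /= _ [X [finX XD] <-].
  have [M XM] : exists M, forall y, X y -> (csize y <= M)%N.
    have /finite_seqP[s Xs] := finX; exists (\max_(y <- s) csize y) => y.
    rewrite Xs /= => ys; rewrite (big_rem y)//=; exact: leq_maxl.
  rewrite (@eq_fsbigr _ _ _ _ _ (fun y => (p t eta y * fM M y)%:E)); last first.
    by move=> y /set_mem/XM yM; rewrite /fM yM.
  apply: (@le_trans _ _ (Pt D p t (fM M) eta)%:E); last by rewrite lee_fin up.
  rewrite -(PtE Hp (fMb M))//; apply: ereal_sup_ubound; exists X => //.
apply/lee_addgt0Pr => e e0.
pose d := e / (expR ((C + 1) * t) * growth R k.+1 eta).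
have d0 : 0 < d by rewrite divr_gt0.
(* With [d] making the final error [e], this [M] ensures that beyond [M] particles the part cut off
   is at most [d] times the weight of degree [k.+1]. *)
pose M := Num.bound `|A z0 / d|.
have MA : A z0 / d < M%:R.
  by apply: le_lt_trans (ler_norm _) _; exact/archi_boundP/normr_ge0.
apply: (@le_trans _ _ ((Pt D p t (fM M) eta) + e)%:E); last first.
  rewrite EFinD leeD2r// -(PtE Hp (fMb M))//; apply: le_esum => y Dy; rewrite lee_fin.
  apply: ler_wpM2l; first exact: (semigroup_ge0 Hp).
  by rewrite /fM; case: ifP => // _; exact: Dcl_ge0.
rewrite lee_fin -lerBlDl -[X in _ - X]mul1r.
have -> : e = d * expR ((C + 1) * t) * growth R k.+1 eta.
  by rewrite -mulrA divfK// gt_eqF.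
apply: (@comparison R _ D (gen sigma G thetaL thetaR) (@growth R n k.+1) C d t
    (fun s y => g s y - 1 * Pt D p s (fM M) y)) => //.
- move=> y Dy; rewrite (Pt0 Hp)//; last by move=> u /(fMb M) /andP[].
  rewrite g00 mul1r /fM; case: leqP => yM; first by rewrite subrr mulr_ge0// ltW.
  rewrite subr0; apply: le_trans (fB y) _.
  rewrite /growth exprS mulrA; apply: ler_wpM2r; first by rewrite exprn_ge0// addr_ge0.
  rewrite mulrC -ler_pdivrMr//.
  have : M%:R < (csize y)%:R :> R by rewrite ltr_nat.
  lra.
- move=> s y s0 Dy; eexists.
    exact: rderivB (gD s y s0 Dy) (Pt_rderiv Hp (fMb M) s0 Dy).
  by rewrite (jump_atB _ _ _ (LJ y Dy)).
- move=> s y s0 Dy; apply: lcontB; first exact: gl.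
  exact: Pt_lcont Hp (fMb M) s0 Dy.
- apply: (@finite_growth R n D d B) => // s y s0 Dy.
  have /andP[P0 _] := Pt_bound Hp (fMb M) s0 Dy.
  have := gB s y s0; lra.
Qed.

(** * Product measures and expectations *)

(** Monotonicity gives [u m <= v m <= l], so [u] converges, and its limit x solves (1 + c) x = l + c
    x, that is x = l. No estimate of the last term of a partial sum is needed, and [c] may go down
    to -1. *)
Lemma recurrence_cvg (R : realType) (u v : nat -> R) (c l : R) : 0 <= 1 + c ->
  {homo u : i j / (i <= j)%N >-> i <= j} ->
  (forall m, v m <= l) -> (forall m, (1 + c) * u m.+1 = v m + c * u m) ->
  v m @[m --> \oo] --> l -> u m @[m --> \oo] --> l.
Proof.
move=> c0 u_nd vl uv vcvg.
have cu : cvgn u.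
  apply: nondecreasing_is_cvgn; first by move=> i j; exact: u_nd.
  exists l => _ [m _ <-]; apply: le_trans (vl m).
  have -> : v m = (1 + c) * u m.+1 - c * u m by rewrite uv; ring.
  have := ler_wpM2l c0 (u_nd _ _ (leqnSn m)); lra.
suff -> : l = limn u by exact: cu.
have H1 : (1 + c) * u m.+1 @[m --> \oo] --> (1 + c) * limn u.
  by apply: cvgMl_tmp; rewrite (cvg_shiftS u); exact: cu.
have H2 : (1 + c) * u m.+1 @[m --> \oo] --> l + c * limn u.
  under eq_fun do rewrite uv.
  by apply: cvgD => //; apply: cvgMl_tmp; exact: cu.
have E : (1 + c) * limn u = l + c * limn u by exact: cvg_unique H1 H2.
by rewrite mulrDl mul1r in E; apply: (addIr (c * limn u)); rewrite E.
Qed.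

Lemma sum_homo (R : realType) (f : nat -> R) : (forall j, 0 <= f j) ->
  {homo (fun m => \sum_(j < m) f j) : i j / (i <= j)%N >-> i <= j}.
Proof.
move=> f0 i j ij; rewrite -!(big_mkord xpredT f) [leRHS](big_cat_nat (n := i))//= lerDl.
by apply: sumr_ge0.
Qed.

(** Induction on [b] by Pascal's rule for partial sums, [rec]; divided by [1 - q], it is the
    recurrence above with [c = q / (1 - q)]. *)
Lemma negative_binomial_cvg (R : realType) (b : nat) (q : R) : 0 <= q < 1 ->
  \sum_(j < m) 'C(b + j, j)%:R * q ^+ j @[m --> \oo] --> (1 - q) ^- b.+1.
Proof.
move=> /andP[q0 q1]; have q1' : 1 - q != 0 by rewrite subr_eq0 gt_eqF.
elim: b => [|b IH].
  have := @cvg_geometric_series R 1 q; rewrite ger0_norm// => /(_ q1).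
  rewrite mul1r expr1; apply: cvg_trans; apply: near_eq_cvg; apply: nearW => m.
  rewrite /series /= big_mkord; apply: eq_bigr => j _.
  by rewrite add0n binn /geometric.
have c0 : 0 <= 1 + q / (1 - q) by rewrite addr_ge0// divr_ge0// subr_ge0 ltW.
have rec m : \sum_(j < m.+1) 'C(b.+1 + j, j)%:R * q ^+ j =
    \sum_(j < m.+1) 'C(b + j, j)%:R * q ^+ j +
    q * \sum_(j < m) 'C(b.+1 + j, j)%:R * q ^+ j.
  elim: m => [|m IHm]; first by rewrite !big_ord1 !big_ord0 !bin0 mulr0 addr0.
  rewrite [X in q * X]big_ord_recr [LHS]big_ord_recr /= IHm.
  rewrite [X in _ = X + _]big_ord_recr /=.
  by rewrite !addSn binS natrD !addnS exprS; ring.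
have pos a j : 0 <= 'C(a + j, j)%:R * q ^+ j :> R by rewrite mulr_ge0// exprn_ge0.
pose v m := (1 - q)^-1 * \sum_(j < m.+1) 'C(b + j, j)%:R * q ^+ j.
have vcvg : v m @[m --> \oo] --> (1 - q) ^- b.+2.
  rewrite exprS invfM; apply: cvgMl_tmp.
  by rewrite (cvg_shiftS (fun m => \sum_(j < m) 'C(b + j, j)%:R * q ^+ j)).
apply: (@recurrence_cvg R _ v (q / (1 - q)) _ c0) => //.
- by move=> i j; exact: (sum_homo (pos b.+1)).
- move=> m; rewrite -(cvg_lim _ vcvg)//; apply: nondecreasing_cvgn_le.
    move=> i j ij; rewrite /v; apply: ler_wpM2l; first by rewrite invr_ge0 subr_ge0 ltW.
    exact: (sum_homo (pos b)).
  by apply/cvg_ex; exists ((1 - q) ^- b.+2).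
- by move=> m; rewrite /v rec; field.
Qed.

(** Detailed balance at one site in contact with a reservoir: departures from j particles at rate (1
    + sigma theta) j, arrivals at rate theta (a + sigma j). *)
Lemma nu_balance (R : realType) (sigma : int) (a j : nat) (theta : R) :
  sigma \in [:: -1; 0; 1] -> (0 < a)%N -> Theta sigma theta ->
  (1 + sigma%:~R * theta) * (j.+1%:R * nu sigma a theta j.+1) =
  theta * ((a%:R + sigma%:~R * j%:R) * nu sigma a theta j).
Proof.
rewrite !inE => hs a0 ht; have t0 := Theta_ge0 ht.
have jf : j`!%:R != 0 :> R by rewrite pnatr_eq0 -lt0n fact_gt0.
case/or3P : hs => /eqP s1; rewrite s1 /nu /=.
- rewrite !mulrN1z /binomial_pmf /unstable.onem !mulN1r.
  have [ja|aj] := ltnP j a; last first.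
    rewrite bin_small// mulr0n !mulr0.
    have [->|ja] := eqVneq j a; first by rewrite subrr mul0r mulr0.
    by rewrite bin_small ?mulr0n ?mulr0// ltn_neqAle eq_sym ja.
  have := mul_bin_left a j => /(congr1 (fun k => k%:R : R)).
  rewrite !natrM natrB ?(ltnW ja)// => e.
  rewrite -[_ *+ 'C(a, j.+1)]mulr_natr -[_ *+ 'C(a, j)]mulr_natr.
  have -> : (a - j = (a - j.+1).+1)%N by rewrite -subSn// subSS.
  transitivity (theta ^+ j.+1 * (1 - theta) ^+ (a - j.+1).+1 * (j.+1%:R * 'C(a, j.+1)%:R)).
    by rewrite [(1 - theta) ^+ _.+1]exprS; ring.
  by rewrite e exprS; ring.
- rewrite mul0r addr0 mul1r mul0r addr0 factS natrM exprS; field.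
  by rewrite jf nat1r pnatr_eq0.
- have t1 : 1 + theta != 0 by rewrite gt_eqF// ltr_pwDl.
  rewrite !mul1r -natrD addnS /=.
  have := ltn_addr j a0; case: (a + j)%N => // k _.
  rewrite !factS !natrM /= exprS; field.
  rewrite expf_neq0//= jf t1 nat1r !pnatr_eq0 andbT /=.
  by rewrite -lt0n fact_gt0.
Qed.

Lemma nu_ge0 (R : realType) (sigma : int) (a j : nat) (theta : R) :
  Theta sigma theta -> 0 <= nu sigma a theta j.
Proof.
move=> ht; have t0 := Theta_ge0 ht; rewrite /nu; case: ifP => s1.
  by rewrite binomial_pmf_ge0//; move: ht; rewrite /Theta s1 /= in_itv.
case: ifP => _; first by rewrite mulr_ge0 ?expR_ge0// divr_ge0// exprn_ge0// mulr_ge0.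
by apply: mulr_ge0; [apply: mulr_ge0; [apply: divr_ge0 => //; exact: mulr_ge0
  |rewrite exprn_ge0// divr_ge0// addr_ge0]|rewrite invr_ge0 exprn_ge0// addr_ge0].
Qed.

Lemma nu_out (R : realType) (a j : nat) (theta : R) : (a < j)%N ->
  nu (-1) a theta j = 0.
Proof. by move=> aj; rewrite /nu /= /binomial_pmf bin_small// mulr0n. Qed.

Lemma nu_mass (R : realType) (sigma : int) (a : nat) (theta : R) :
  sigma \in [:: -1; 0; 1] -> (0 < a)%N -> Theta sigma theta ->
  \sum_(j < m) nu sigma a theta j @[m --> \oo] --> (1 : R).
Proof.
rewrite !inE => hs a0 ht; have t0 := Theta_ge0 ht.
case/or3P : hs => /eqP s1; rewrite s1 in ht *.
- have H : \sum_(j < a.+1) nu (-1) a theta j = 1.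
    rewrite -[RHS](expr1n _ a) -[1 in RHS](subrK theta) exprDn.
    by apply: eq_bigr => j _; rewrite /nu /= /binomial_pmf /unstable.onem mulrC.
  apply: (@cvg_trans _ ((fun=> 1 : R) @ \oo)); last exact: cvg_cst.
  apply: near_eq_cvg; exists a.+1 => // m /= am.
  rewrite -(big_mkord xpredT (nu (-1) a theta)) (big_cat_nat (n := a.+1))//= big_mkord H.
  by rewrite big_nat_cond big1 ?addr0// => j /andP[/andP[aj _] _]; rewrite nu_out.
- rewrite -[X in _ --> X](_ : expR (a%:R * theta) * expR (- (a%:R * theta)) = 1); last first.
    by rewrite expRN divff// gt_eqF// expR_gt0.
  under eq_fun do rewrite /nu /= -mulr_suml.
  apply: cvgMr_tmp; have H : series (exp_coeff (a%:R * theta)) @ \oo --> expR (a%:R * theta).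
    exact: is_cvg_series_exp_coeff.
  apply: cvg_trans H; apply: near_eq_cvg; apply: nearW => m.
  by rewrite /series /= big_mkord.
- have q1 : 0 <= theta / (1 + theta) < 1.
    rewrite divr_ge0 ?addr_ge0//= ltr_pdivrMr ?mul1r ?ltrDr ?ltr_pwDl//.
  have := @negative_binomial_cvg R a.-1 _ q1.
  have -> : 1 - theta / (1 + theta) = (1 + theta)^-1.
    by field; rewrite gt_eqF// ltr_pwDl.
  rewrite (prednK a0) exprVn invrK => H.
  rewrite -[X in _ --> X](_ : (1 + theta) ^+ a * (1 + theta) ^- a = 1); last first.
    by rewrite divff// expf_neq0// gt_eqF// ltr_pwDl.
  under eq_fun do rewrite /nu /= -mulr_suml.
  apply: cvgMr_tmp; apply: cvg_trans H; apply: near_eq_cvg; apply: nearW => m.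
  apply: eq_bigr => j _; congr (_ * _).
  have := bin_fact (leq_addl a.-1 j); rewrite addnK => /(congr1 (fun k => k%:R : R)).
  have -> : (a.-1 + j = (a + j).-1)%N by case: (a) a0.
  rewrite !natrM => <-; field.
  by rewrite !pnatr_eq0 -!lt0n !fact_gt0.
Qed.

(** Detailed balance, [d_cl_down] and [d_cl_diag] tie the partial sums of orders [k] and [k.+1] by
    the recurrence of [recurrence_cvg], with c = sigma theta. One induction thus covers the three
    families of laws. *)
Lemma nu_moment (R : realType) (sigma : int) (a k : nat) (theta : R) :
  sigma \in [:: -1; 0; 1] -> (0 < a)%N -> Theta sigma theta ->
  (sigma = -1 -> (k <= a)%N) ->
  \sum_(j < m) nu sigma a theta j * d_cl R sigma a k j @[m --> \oo] --> theta ^+ k.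
Proof.
move=> hs a0 ht; have t0 := Theta_ge0 ht; elim: k => [_|k IH ka].
  have d1 j : d_cl R sigma a 0 j = 1.
    by rewrite /d_cl leq0n subn0 /w_ subn0 addn0 expr0; do 2?case: ifP => _;
      rewrite !divff ?divr1// pnatr_eq0 -lt0n fact_gt0.
  rewrite expr0; under eq_fun do under eq_bigr do rewrite d1 mulr1.
  exact: nu_mass.
have ka' : sigma = -1 -> (k <= a)%N by move=> /ka/ltnW.
have r0 : a%:R + sigma%:~R * k%:R != 0 :> R.
  have := w_gt0 R sigma k.+1 a0; rewrite (w_S R hs a0 ka) => w1.
  by apply: contraTneq w1 => ->; rewrite mulr0 ltxx.
pose S i m : R := \sum_(j < m) nu sigma a theta j * d_cl R sigma a i j.
have nd i : {homo S i : x y / (x <= y)%N >-> x <= y}.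
  have H j : 0 <= nu sigma a theta j * d_cl R sigma a i j.
    by rewrite mulr_ge0 ?nu_ge0// d_cl_ge0.
  by move=> x y; exact: (sum_homo H).
have vcvg : theta * S k m @[m --> \oo] --> theta ^+ k.+1.
  by rewrite exprS; apply: cvgMl_tmp; exact: IH.
(* The one-site relations require [m <= a] when sigma = -1; beyond [a] the weight vanishes and both
   sides are 0. *)
have out j : nu sigma a theta j != 0 -> sigma = -1 -> (j <= a)%N.
  by move=> + s1; rewrite s1 leqNgt; apply: contra => /nu_out ->.
apply: (@recurrence_cvg R (S k.+1) (fun m => theta * S k m) (sigma%:~R * theta)) => //.
- exact: exit_rate_ge0.
- move=> m; rewrite -(cvg_lim _ vcvg)//; apply: nondecreasing_cvgn_le.
    by move=> i j ij; apply: ler_wpM2l => //; exact: nd.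
  by apply/cvg_ex; exists (theta ^+ k.+1).
elim=> [|m IHm].
  by rewrite /S big_ord1 !big_ord0 d_clE ffact0n /= mul0r !mulr0 addr0.
rewrite {1}/S big_ord_recr /= mulrDr -/(S k.+1 m.+1) IHm.
rewrite {3 4}/S !big_ord_recr /= -/(S k m) -/(S k.+1 m).
suff : (1 + sigma%:~R * theta) * (nu sigma a theta m.+1 * d_cl R sigma a k.+1 m.+1) =
    theta * (nu sigma a theta m * d_cl R sigma a k m) +
    sigma%:~R * theta * (nu sigma a theta m * d_cl R sigma a k.+1 m).
  by move=> ->; ring.
apply: (mulfI r0).
have down : m.+1%:R * (nu sigma a theta m.+1 * d_cl R sigma a k m) =
    (a%:R + sigma%:~R * k%:R) * (nu sigma a theta m.+1 * d_cl R sigma a k.+1 m.+1).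
  have [->|/out nu0] := eqVneq (nu sigma a theta m.+1) 0; first by rewrite !mul0r !mulr0.
  have := d_cl_down R hs a0 nu0 ka' => /= e.
  by rewrite mulrCA e; ring.
have diag : m%:R * (nu sigma a theta m * d_cl R sigma a k m) =
    k%:R * (nu sigma a theta m * d_cl R sigma a k m) +
    (a%:R + sigma%:~R * k%:R) * (nu sigma a theta m * d_cl R sigma a k.+1 m).
  have [->|/out nu0] := eqVneq (nu sigma a theta m) 0.
    by rewrite !mul0r !mulr0 addr0.
  by have e := d_cl_diag R hs a0 nu0 ka'; rewrite mulrCA e; ring.
have bal := nu_balance m hs a0 ht.
rewrite mulrCA -down.
transitivity ((1 + sigma%:~R * theta) * (m.+1%:R * nu sigma a theta m.+1) *
  d_cl R sigma a k m); first by ring.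
rewrite bal.
transitivity (theta * (a%:R * (nu sigma a theta m * d_cl R sigma a k m) +
  sigma%:~R * (m%:R * (nu sigma a theta m * d_cl R sigma a k m)))); first by ring.
by rewrite diag; ring.
Qed.

(** The boxes of configurations bounded by [m] exhaust the space, and on a box the sum of products
    is the product of sums. *)
Lemma esum_prod (R : realType) (n : nat) (F : 'I_n.+1 -> nat -> R) (r : 'I_n.+1 -> R) :
  (forall x j, 0 <= F x j) ->
  (forall x, \sum_(j < m) F x j @[m --> \oo] --> r x) ->
  (\esum_(c in [set: config n]) (\prod_x F x (c x))%:E = (\prod_x r x)%:E)%E.
Proof.
move=> F0 Fr.
have nd x : {homo (fun m => \sum_(j < m) F x j) : i j / (i <= j)%N >-> i <= j}.
  by move=> i j; exact: (sum_homo (F0 x)).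
have Fle x m : \sum_(j < m) F x j <= r x.
  rewrite -(cvg_lim _ (Fr x))//; apply: nondecreasing_cvgn_le; first exact: nd.
  by apply/cvg_ex; exists (r x).
have box m : (\sum_(z : {ffun 'I_n.+1 -> 'I_m.+1}) \prod_x F x (cfg z x)) =
    \prod_x \sum_(j < m.+1) F x j.
  rewrite bigA_distr_bigA; apply: eq_bigr => z _; apply: eq_bigr => x _.
  by rewrite ffunE.
have cfg_inj m : injective (@cfg n m).
  move=> z z' /ffunP e; apply/ffunP => x; apply: val_inj.
  by have := e x; rewrite !ffunE.
pose s m := [seq cfg z | z : {ffun 'I_n.+1 -> 'I_m.+1}].
have us m : uniq (s m) by rewrite map_inj_uniq ?enum_uniq//; exact: cfg_inj.
have sE m : \sum_(c <- s m) \prod_x F x (c x) = \prod_x \sum_(j < m.+1) F x j.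
  by rewrite -box big_map big_enum.
have pos (c : config n) : 0 <= \prod_x F x (c x) by apply: prodr_ge0.
apply/eqP; rewrite eq_le; apply/andP; split.
  apply: ge_ereal_sup => /= _ [X [finX _] <-].
  have /finite_seqP[X' XX'] := finX.
  pose M := (\max_(c <- X') csize c)%N.
  have XM c : X c -> c \in s M.
    rewrite XX' /= => cX.
    have cM : (csize c <= M)%N by rewrite /M (big_rem c)//=; exact: leq_maxl.
    have cx x : (c x < M.+1)%N by rewrite ltnS (leq_trans (leq_csize c x)).
    apply/mapP; exists [ffun x => Ordinal (cx x)]; first by rewrite mem_enum.
    by apply/ffunP => x; rewrite !ffunE.
  apply: (@le_trans _ _ (\sum_(c \in [set` s M]) (\prod_x F x (c x))%:E)%E).
    apply: lee_fsum_nneg_subset => //; first exact: finite_seq.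
      by move=> c /set_mem/XM cs; exact/mem_set.
    by move=> c _; rewrite lee_fin.
  rewrite -fsbig_seq// sumEFin lee_fin sE.
  by apply: ler_prod => x _; rewrite Fle andbT; apply: sumr_ge0 => j _.
have H : \prod_x \sum_(j < m.+1) F x j @[m --> \oo] --> \prod_x r x.
  elim: (index_enum _) => [|x l IH].
    by under eq_fun do rewrite big_nil; rewrite big_nil; exact: cvg_cst.
  under eq_fun do rewrite big_cons; rewrite big_cons; apply: cvgM => //.
  by rewrite (cvg_shiftS (fun m => \sum_(j < m) F x j)); exact: Fr.
have /(cvg_comp _ _ H) : EFin @ \prod_x r x --> (\prod_x r x)%:E by [].
move=> HE; rewrite -(cvg_lim _ HE)//; apply: lime_le.
  by apply/cvg_ex; exists (\prod_x r x)%:E.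
apply: nearW => m /=; rewrite -sE.
by apply: (@le_sum_esum R _ setT (s m) (fun c => \prod_x F x (c x))).
Qed.

Lemma esum_mu_interp (R : realType) (n : nat) (sigma : int) (G : geometry R n)
    (thetaL thetaR : R) (beta : 'I_n.+1 -> R) (xi : config n) :
  sigma \in [:: -1; 0; 1] -> (forall x, Theta sigma (interp thetaL thetaR beta x)) ->
  confs sigma G xi ->
  (\esum_(eta in confs sigma G)
     (mu_interp sigma G thetaL thetaR beta eta * Dcl sigma G xi eta)%:E =
   (cpow (interp thetaL thetaR beta) xi)%:E)%E.
Proof.
move=> hs ht Dxi.
pose F x j := nu sigma (alpha G x) (interp thetaL thetaR beta x) j *
  d_cl R sigma (alpha G x) (xi x) j.
have F0 x j : 0 <= F x j by rewrite mulr_ge0 ?nu_ge0// d_cl_ge0// alpha_gt0.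
have FE eta : mu_interp sigma G thetaL thetaR beta eta * Dcl sigma G xi eta =
    \prod_x F x (eta x) by rewrite /mu_interp /Dcl -big_split.
rewrite -(esum_prod F0 (r := fun x => interp thetaL thetaR beta x ^+ xi x)); last first.
  move=> x; apply: nu_moment => //; first exact: alpha_gt0.
  by move=> s1; exact: Dxi.
(* The sum extends to all configurations: outside [confs], which happens for sigma = -1 only, some
   factor [nu] vanishes. *)
rewrite esum_mkcond; apply: eq_esum => eta _; rewrite FE.
case: ifPn => // /negP nD; suff -> : \prod_x F x (eta x) = 0 by [].
have [s1 [x xa]] : sigma = -1 /\ exists x, (alpha G x < eta x)%N.
  have [s1|ns] := pselect (sigma = -1); last by exfalso; apply: nD; apply/mem_set => /ns.
  split=> //; apply: contrapT => nx; apply: nD; apply/mem_set => _ x.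
  by rewrite leqNgt; apply/negP => xa; apply: nx; exists x.
by rewrite (bigD1 x)//= /F s1 nu_out// !mul0r.
Qed.

(** * Expectations of discrete random variables and of the processes *)

Lemma discrete_preimage (d : measure_display) (Omega : measurableType d) (T : countType)
    (X : Omega -> T) (A : set T) :
  (forall x, measurable [set w | X w = x]) -> measurable [set w | A (X w)].
Proof.
move=> mX; rewrite (_ : [set w | _] =
    \bigcup_(k in [set k | exists2 x, A x & pickle x = k])
      (if unpickle k is Some x then [set w | X w = x] else set0)).
  by apply: bigcup_measurable => k _; case: unpickle.
apply/seteqP; split => [w /= Aw|w [k [x Ax <-]]].
  by exists (pickle (X w)); [exists (X w)|rewrite pickleK].
by rewrite pickleK /= => ->.
Qed.

Lemma discrete_integral (R : realType) (d : measure_display) (Omega : measurableType d)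
    (P : probability Omega R) (T : countType) (X : Omega -> T) (f : T -> R) :
  (forall x, measurable [set w | X w = x]) -> (forall x, 0 <= f x) ->
  (\int[P]_w (f (X w))%:E = \esum_(x in setT) ((f x)%:E * P [set w | X w = x]))%E.
Proof.
move=> mX f0; pose F k := [set w | pickle (X w) = k].
have mF k : measurable (F k).
  by apply: (@discrete_preimage _ _ _ X [set x | pickle x = k]).
have FT : \bigcup_k F k = setT by apply/seteqP; split => // w _; exists (pickle (X w)).
pose g : Omega -> \bar R := fun w => (f (X w))%:E.
have mf : measurable_fun [set: Omega] g.
  move=> _ Y mY; rewrite setTI.
  exact: (@discrete_preimage _ _ _ X [set x | Y (f x)%:E]).
have intF x : (\int[P]_(w in F (pickle x)) (f (X w))%:E = (f x)%:E * P [set w | X w = x])%E.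
  have FE : F (pickle x) = [set w | X w = x].
    by apply/seteqP; split => w /=; [exact: (pcan_inj pickleK)|rewrite /F /= => ->].
  rewrite FE (@eq_integral _ _ _ _ _ (cst (f x)%:E)); last by move=> w /set_mem /= <-.
  by rewrite integral_cst.
have := @ge0_integral_bigcup _ _ _ P F g mF.
rewrite FT => -> //; last 2 first.
- by move=> w _; rewrite lee_fin.
- by move=> i j _ _ [w [<- <-]].
have int0 k : (0 <= \int[P]_(w in F k) g w)%E.
  by apply: integral_ge0 => w _; rewrite /g lee_fin.
rewrite nneseries_esumT//.
transitivity (\esum_(k in range (@pickle T)) \int[P]_(w in F k) g w)%E.
  rewrite [RHS]esum_mkcond; apply: eq_esum => k _; case: ifPn => // /negP nk.
  rewrite (_ : F k = set0) ?integral_set0//; apply/seteqP; split => // w /= wk.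
  by apply: nk; apply/mem_set; exists (X w).
rewrite esum_image; last by move=> x y _ _; exact: (pcan_inj pickleK).
by apply: eq_esum => x _; exact: intF.
Qed.

Lemma expectation_discrete (R : realType) (d : measure_display) (Omega : measurableType d)
    (P : probability Omega R) (T : countType) (D : set T) (X : Omega -> T) (f lam : T -> R) :
  (forall x, measurable [set w | X w = x]) -> (forall w, D (X w)) ->
  (forall x, D x -> P [set w | X w = x] = (lam x)%:E) ->
  ('E_P[fun w => f (X w)])%E = csum D (fun x => lam x * f x).
Proof.
move=> mX DX PX; rewrite unlock integralE /csum.
have lam0 x : D x -> 0 <= lam x by move=> Dx; rewrite -lee_fin -PX.
have part (g : T -> R) : (forall x, 0 <= g x) ->
    (\int[P]_w (g (X w))%:E = \esum_(x in D) (lam x * g x)%:E)%E.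
  move=> g0; rewrite discrete_integral// [RHS]esum_mkcond; apply: eq_esum => x _.
  case: ifPn => [/set_mem Dx|/negP nD]; first by rewrite PX// -EFinM mulrC.
  rewrite (_ : [set w | X w = x] = set0) ?measure0 ?mule0//.
  by apply/seteqP; split => // w /= Xw; apply: nD; rewrite -Xw; exact/mem_set.
congr (_ - _)%E.
- transitivity (\int[P]_w (Num.max (f (X w)) 0)%:E)%E.
    by apply: eq_integral => w _; rewrite funeposE EFin_max.
  rewrite (part (fun x => Num.max (f x) 0)); last by move=> x; rewrite le_max lexx orbT.
  apply: eq_esum => x Dx; rewrite funeposE /= -EFin_max maxr_pMr ?lam0//.
  by rewrite mulr0.
- transitivity (\int[P]_w (Num.max (- f (X w)) 0)%:E)%E.
    by apply: eq_integral => w _; rewrite funenegE EFin_max EFinN.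
  rewrite (part (fun x => Num.max (- f x) 0)); last by move=> x; rewrite le_max lexx orbT.
  apply: eq_esum => x Dx; rewrite funenegE /= -EFin_max maxr_pMr ?lam0//.
  by rewrite mulr0 mulrN.
Qed.

Lemma process_joint (R : realType) (S : countType) (D : set S) (p : R -> S -> S -> R)
    (mu : S -> R) (d : measure_display) (Omega : measurableType d)
    (P : probability Omega R) (X : R -> Omega -> S) (t : R) (x y : S) :
  markov_process D p mu P X -> 0 <= t -> D x -> D y ->
  P [set w | X 0 w = x /\ X t w = y] = (mu x * p t x y)%:E.
Proof.
move=> HX t0 Dx Dy.
have := @process_fdd _ _ _ _ _ _ _ _ _ HX 1 (fun i => if i is 0%N then 0 else t)
  (fun i => if i is 0%N then x else y) erefl.
rewrite big_ord1 /= subr0 => <-.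
- congr (P _); apply/seteqP; split => w /=; first by move=> [? ?] [|[|]].
  by move=> H; split; [exact: (H 0%N)|exact: (H 1%N)].
- by case.
- by case=> [|[|]].
Qed.

Lemma process_expectation (R : realType) (S : countType) (D : set S)
    (p : R -> S -> S -> R) (mu : S -> R) (d : measure_display) (Omega : measurableType d)
    (P : probability Omega R) (X : R -> Omega -> S) (t : R) (f : S -> R) :
  markov_process D p mu P X -> 0 <= t ->
  ('E_P[fun w => f (X t w)])%E =
  csum (D `*` D) (fun q => mu q.1 * p t q.1 q.2 * f q.2).
Proof.
move=> HX t0.
have := @expectation_discrete R d Omega P (S * S)%type (D `*` D)
  (fun w => (X 0 w, X t w)) (fun q => f q.2) (fun q => mu q.1 * p t q.1 q.2).
apply.
- move=> [x y]; rewrite (_ : [set w | _] = [set w | X 0 w = x] `&` [set w | X t w = y]).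
    by apply: measurableI; apply: (process_measurable HX).
  by apply/seteqP; split => w /=; [case=> -> ->|case=> -> ->].
- by move=> w; split; apply: (process_state HX).
- move=> [x y] [/= Dx Dy]; rewrite -(process_joint HX t0 Dx Dy).
  by congr (P _); apply/seteqP; split => w /=; [case=> -> ->|case=> -> ->].
Qed.

Lemma dual_expectation (R : realType) (n : nat) (sigma : int) (G : geometry R n)
    (p : R -> dconfig n -> dconfig n -> R) (d : measure_display)
    (Omega : measurableType d) (P : probability Omega R) (Z : R -> Omega -> dconfig n)
    (t : R) (zeta : dconfig n) (f : dconfig n -> R) :
  sigma \in [:: -1; 0; 1] -> markov_semigroup (dconfs sigma G) p (dgen sigma G) ->
  markov_process (dconfs sigma G) p (fun z => (z == zeta)%:R) P Z ->
  0 <= t -> dconfs sigma G zeta ->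
  ('E_P[fun w => f (Z t w)])%E = (Et sigma G p t f zeta)%:E.
Proof.
move=> hs Hp HZ t0 Dz; rewrite (process_expectation _ HZ t0); apply: hassum_csum.
pose F := dclass sigma G (dsize zeta).
have HF : finite_class (dconfs sigma G) (dgen sigma G) F by exact: dclass_finite_class.
have [uF FD _] := HF.
have zF : zeta \in F by apply/mem_dclass.
have -> : Et sigma G p t f zeta =
    \sum_(q <- [seq (zeta, z) | z <- F]) (q.1 == zeta)%:R * p t q.1 q.2 * f q.2.
  by rewrite big_map /Et /Qt; apply: eq_bigr => z _; rewrite /= eqxx mul1r.
apply: hassum_support.
- by rewrite map_inj_uniq// => x y [].
- by move=> q /mapP[z zF' ->]; split => //=; exact: FD.
- move=> [x y] [/= Dx Dy] nq; have [xz|xz] := eqVneq x zeta; last by rewrite !mul0r.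
  rewrite (class_exit Hp HF t0)// ?mulr0 ?mul0r// ?xz//.
  by apply: contra nq => yF; apply/mapP; exists y => //; rewrite xz.
Qed.

(** * The sums that define psi *)

Lemma big_dle (R : realType) (n : nat) (xi : dconfig n) (m : nat) (h : dconfig n -> R) :
  atL xi = 0%N -> atR xi = 0%N -> (forall x, (bulk xi x <= m)%N) ->
  \sum_(zeta \in [set zeta | dle zeta xi]) h zeta =
  \sum_(z : {ffun 'I_n.+1 -> 'I_m.+1} | [forall x, (z x <= bulk xi x)%N])
    h (cfg z, 0%N, 0%N).
Proof.
move=> l0 r0 xim.
pose s := [seq (cfg z, 0%N, 0%N) : dconfig n |
  z : {ffun 'I_n.+1 -> 'I_m.+1} <-
    enum [pred z : {ffun 'I_n.+1 -> 'I_m.+1} | [forall x, (z x <= bulk xi x)%N]]].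
rewrite (_ : [set zeta | dle zeta xi] = [set` s]).
  rewrite -fsbig_seq; last first.
    rewrite map_inj_uniq ?enum_uniq// => z z' [] /ffunP e; apply/ffunP => x.
    by apply: val_inj; have := e x; rewrite !ffunE.
  by rewrite big_map big_enum.
apply/seteqP; split => [[[c l] r]|zeta /= /mapP[z]].
  rewrite /dle /= l0 r0 !leqn0 => -[cx /eqP /= + /eqP /= +]; rewrite /atL /atR /= => -> ->.
  have cm x : (c x < m.+1)%N by rewrite ltnS (leq_trans (cx x)).
  apply/mapP; exists [ffun x => Ordinal (cm x)].
    by rewrite mem_enum inE; apply/forallP => x; rewrite ffunE; exact: cx.
  by congr (_, _, _); apply/ffunP => x; rewrite !ffunE.
rewrite mem_enum inE => /forallP zx ->; rewrite /dle /= l0 r0; split => // x.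
by rewrite ffunE.
Qed.

(** With empty reservoirs the exponent of -1 is the sum over the sites of [bulk xi x - bulk zeta x],
    so the sign is absorbed into the weights [- beta' x]. *)
Lemma psi_weightE (R : realType) (n : nat) (beta' : 'I_n.+1 -> R) (xi zeta : dconfig n) :
  atL xi = 0%N -> atR xi = 0%N -> dle zeta xi ->
  psi_weight beta' xi zeta =
  \prod_x ('C(bulk xi x, bulk zeta x)%:R * (- beta' x) ^+ (bulk xi x - bulk zeta x)).
Proof.
move=> l0 r0 [zx]; rewrite l0 r0 !leqn0 => /eqP zl /eqP zr.
rewrite /psi_weight !dsizeE l0 r0 zl zr !add0n.
have -> : (csize (bulk xi) - csize (bulk zeta) =
    \sum_(x < n.+1) (bulk xi x - bulk zeta x))%N by rewrite -sumnB.
rewrite -prodrXr -big_split /=; apply: eq_bigr => x _.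
by rewrite [in RHS]exprNn; ring.
Qed.

Lemma psi_sum (R : realType) (n : nat) (beta' : 'I_n.+1 -> R) (xi : dconfig n) (m : nat)
    (h : dconfig n -> R) :
  atL xi = 0%N -> atR xi = 0%N -> (forall x, (bulk xi x <= m)%N) ->
  \sum_(zeta \in [set zeta | dle zeta xi]) psi_weight beta' xi zeta * h zeta =
  msum m (fun x => - beta' x) (fun c => h (c, 0%N, 0%N)) (bulk xi).
Proof.
move=> l0 r0 xim; rewrite (big_dle _ l0 r0 xim) msum_below; apply: eq_bigr => z /forallP zx.
rewrite psi_weightE//; last by split => // x; rewrite ffunE.
by congr (_ * _); apply: eq_bigr => x _; rewrite ffunE.
Qed.

Lemma psiE (R : realType) (n : nat) (sigma : int) (G : geometry R n)
    (p : R -> dconfig n -> dconfig n -> R) (d : measure_display)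
    (Omega : measurableType d) (Ph : dconfig n -> probability Omega R)
    (Z : R -> Omega -> dconfig n) (t : R) (beta beta' : 'I_n.+1 -> R) (xi : dconfig n)
    (m : nat) :
  sigma \in [:: -1; 0; 1] -> markov_semigroup (dconfs sigma G) p (dgen sigma G) ->
  (forall zeta, dconfs sigma G zeta ->
    markov_process (dconfs sigma G) p (fun z => (z == zeta)%:R) (Ph zeta) Z) ->
  0 <= t -> dconfs0 sigma G xi -> (forall x, (bulk xi x <= m)%N) ->
  psi Ph Z t beta beta' xi =
  msum m (fun x => - beta' x)
    (fun c => Et sigma G p t (rpow 1 0 (cpow beta)) (c, 0%N, 0%N)) (bulk xi).
Proof.
move=> hs Hp HZ t0 [Dxi l0 r0] xim; rewrite /psi (psi_sum _ _ l0 r0 xim).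
apply: eq_msum => c cx; have Dc : dconfs sigma G (c, 0%N, 0%N) by exact: confs_le Dxi cx.
rewrite (_ : (fun w => _) = fun w => rpow 1 0 (cpow beta) (Z t w)).
  by rewrite (dual_expectation _ hs Hp (HZ _ Dc) t0 Dc).
by apply/funext => w; rewrite /rpow expr1n mul1r expr0n.
Qed.

Lemma Et_unique (R : realType) (n : nat) (sigma : int) (G : geometry R n)
    (p p' : R -> dconfig n -> dconfig n -> R) (t : R) (f : dconfig n -> R)
    (z : dconfig n) :
  sigma \in [:: -1; 0; 1] -> markov_semigroup (dconfs sigma G) p (dgen sigma G) ->
  markov_semigroup (dconfs sigma G) p' (dgen sigma G) ->
  0 <= t -> dconfs sigma G z -> Et sigma G p t f z = Et sigma G p' t f z.
Proof.
move=> hs Hp Hp' t0 Dz; have HF := dclass_finite_class G (dsize z) hs.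
apply: (@Qt_unique _ _ _ _ _ p' f (fun t => Qt (dclass sigma G (dsize z)) p t f) Hp' HF) => //.
- by move=> y yF; rewrite (Qt0 _ Hp HF).
- by move=> s y s0 yF; exact: Qt_backward Hp HF s0 yF.
- by move=> s y s0 yF; exact: Qt_lcont Hp HF s0 yF.
- by apply/mem_dclass.
Qed.

Lemma D_or_msum (R : realType) (n : nat) (sigma : int) (G : geometry R n)
    (thetaL thetaR : R) (beta : 'I_n.+1 -> R) (xi : dconfig n) (eta : config n) (m : nat) :
  atL xi = 0%N -> atR xi = 0%N -> (forall x, (bulk xi x <= m)%N) ->
  D_or sigma G thetaL thetaR beta xi eta =
  msum m (fun x => - interp thetaL thetaR beta x) (Dcl sigma G ^~ eta) (bulk xi).
Proof.
move=> l0 r0 xim; rewrite /D_or l0 r0 !expr0 mul1r mulr1.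
pose H x (j : 'I_m.+1) := 'C(bulk xi x, j)%:R * (- interp thetaL thetaR beta x) ^+ (bulk xi x - j)
  * d_cl R sigma (alpha G x) j (eta x).
transitivity (\prod_x \sum_j H x j).
  apply: eq_bigr => x _.
  rewrite /H (binT_widen _ (fun j => d_cl R sigma (alpha G x) j (eta x)) (xim x)).
  by rewrite /d_or /binT; apply: eq_bigr => j _; rewrite mulrAC.
rewrite bigA_distr_bigA; apply: eq_bigr => z _; rewrite /Dcl -big_split.
by apply: eq_bigr => x _; rewrite /= ffunE.
Qed.

(** * Absorption and stationary measures *)

Lemma probability_cvg (R : realType) (d : measure_display) (Omega : measurableType d)
    (P : probability Omega R) (A_ : nat -> set Omega) (A : set Omega) :
  (forall k, measurable (A_ k)) -> measurable A ->
  {ae P, forall w, exists K, forall k, (K <= k)%N -> (A_ k w <-> A w)} ->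
  fine (P (A_ k)) @[k --> \oo] --> fine (P A).
Proof.
move=> mA_ mA cv.
pose f_ k w : \bar R := (\1_(A_ k) w)%:E; pose f w : \bar R := (\1_A w)%:E.
have mi B : measurable B -> measurable_fun [set: Omega] (fun w => (\1_B w)%:E : \bar R).
  by move=> mB; apply/measurable_EFinP; exact: measurable_indic.
have [] := @dominated_convergence _ _ _ P setT measurableT f_ f (EFin \o cst 1).
- by move=> k; exact: mi.
- exact: mi.
- apply: filterS cv => w [K HK] _; apply: (@cvg_trans _ ((fun=> f w) @ \oo)).
    apply: near_eq_cvg; exists K => // k /= /HK AA; rewrite /f_ /f !indicE; congr (_%:R%:E).
    by congr nat_of_bool; apply/idP/idP; rewrite !inE => /AA.
  exact: cvg_cst.
- exact: finite_measure_integrable_cst.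
- by apply: aeW => w k _; rewrite /f_ indicE; case: (_ \in _); rewrite /= ?normr1 ?normr0 ?lee_fin.
move=> _ _ H.
have fin B : measurable B -> P B \is a fin_num by move=> mB; exact: fin_num_measure.
have H' : P (A_ k) @[k --> \oo] --> P A.
  rewrite -[P A]/((P : set _ -> _) A) -(setIT A) -integral_indic//.
  apply: cvg_trans H; apply: near_eq_cvg; apply: nearW => k /=.
  by rewrite integral_indic// setIT.
by apply: fine_cvg; rewrite fineK// fin.
Qed.

Lemma process_start (R : realType) (S : countType) (D : set S) (p : R -> S -> S -> R)
    (x : S) (d : measure_display) (Omega : measurableType d)
    (P : probability Omega R) (X : R -> Omega -> S) :
  markov_process D p (fun z => (z == x)%:R) P X -> D x -> {ae P, forall w, X 0 w = x}.
Proof.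
move=> HX Dx; have m0 := process_measurable HX x (lexx 0).
exists (~` [set w | X 0 w = x]); split => //; first exact: measurableC.
rewrite probability_setC// (_ : P [set w | X 0 w = x] = 1%E) ?subee//.
have := @process_fdd _ _ _ _ _ _ _ _ _ HX 0 (fun=> 0) (fun=> x) erefl.
rewrite big_ord0 eqxx mulr1 => <- //; congr (P _); apply/seteqP; split => w /= H.
  by case.
exact: (H 0%N).
Qed.

Section absorption.
Variables (R : realType) (n : nat) (sigma : int) (G : geometry R n).
Variables (p : R -> dconfig n -> dconfig n -> R).
Variables (d : measure_display) (Omega : measurableType d) (P : probability Omega R).
Variables (Z : R -> Omega -> dconfig n) (Zinf : Omega -> dconfig n) (zeta : dconfig n).
Hypothesis hs : sigma \in [:: -1; 0; 1].
Hypothesis Hp : markov_semigroup (dconfs sigma G) p (dgen sigma G).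
Hypothesis HZ : markov_process (dconfs sigma G) p (fun z => (z == zeta)%:R) P Z.
Hypothesis Dzeta : dconfs sigma G zeta.
Hypothesis mZ : forall z, measurable [set w | Zinf w = z].
Hypothesis Zcvg : {ae P, forall w, exists T : R, forall t : R, T <= t -> Z t w = Zinf w}.

Let law z := fine (P [set w | Zinf w = z]).
Let F := dclass sigma G (dsize zeta).

(** Continuous time is replaced by the grid of step [h], on which sequences of events suffice. *)
Lemma eventually_limit (h : R) (w : Omega) (T : R) : 0 < h ->
  (forall t : R, T <= t -> Z t w = Zinf w) ->
  exists K, forall k, (K <= k)%N -> Z (k%:R * h) w = Zinf w.
Proof.
move=> h0 HT; exists (Num.bound `|T / h|) => k Kk; apply: HT.
rewrite -ler_pdivrMr//; apply: le_trans (ler_norm _) _.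
apply: (@le_trans _ _ (Num.bound `|T / h|)%:R); last by rewrite ler_nat.
exact/ltW/archi_boundP/normr_ge0.
Qed.

Lemma transition_cvg (h : R) (z : dconfig n) : 0 < h -> dconfs sigma G z ->
  p (k%:R * h) zeta z @[k --> \oo] --> law z.
Proof.
move=> h0 Dz; have kh0 k : 0 <= k%:R * h by rewrite mulr_ge0// ltW.
pose A_ k := [set w | Z 0 w = zeta /\ Z (k%:R * h) w = z].
have -> : (fun k : nat => p (k%:R * h) zeta z) = (fun k => fine (P (A_ k))).
  by apply/funext => k; rewrite /A_ (process_joint HZ (kh0 k) Dzeta Dz) eqxx mul1r.
apply: probability_cvg => //.
  by move=> k; apply: measurableI; apply: (process_measurable HZ).
apply: filterS2 (process_start HZ Dzeta) Zcvg => w w0 [T /(eventually_limit h0)[K HK]].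
by exists K => k /HK e; rewrite /A_ /= e; split; [case|].
Qed.

(** Since the path is eventually equal to its limit, being at [z] at two successive grid times has
    asymptotic probability [law z]. By the Markov property this probability also tends to
    [law z * p h z z]. *)
Lemma limit_stays (h : R) (z : dconfig n) : 0 < h -> dconfs sigma G z ->
  law z != 0 -> p h z z = 1.
Proof.
move=> h0 Dz lz; have kh0 k : 0 <= k%:R * h by rewrite mulr_ge0// ltW.
pose A_ k := [set w | Z 0 w = zeta] `&`
  ([set w | Z (k%:R * h) w = z] `&` [set w | Z (k.+1%:R * h) w = z]).
have AE k : fine (P (A_ k)) = p (k%:R * h) zeta z * p h z z.
  (* The three times are 0, [k h] and [(k + 1) h]: index [j.+1] is sent to [(k + j) h]. *)
  have := @process_fdd _ _ _ _ _ _ _ _ _ HZ 2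
    (fun i => if i is j.+1 then (k + j)%:R * h else 0)
    (fun i => if i is 0%N then zeta else z) erefl.
  rewrite !big_ord_recl big_ord0 /= eqxx mul1r mulr1 subr0 addn0.
  have -> : (k + 1)%:R * h - k%:R * h = h by rewrite natrD; ring.
  move=> E; rewrite -[RHS]/(fine (p (k%:R * h) zeta z * p h z z)%:E) -E.
  - congr (fine (P _)); apply/seteqP; split => w /=.
      by move=> [w0 [w1 w2]] [|[|[|]]]//= _; rewrite ?addn0 ?addn1.
    move=> H; split; first exact: (H 0%N).
    by split; [have := H 1%N isT; rewrite /= addn0|have := H 2%N isT; rewrite /= addn1].
  - move=> [|i] _; first by rewrite addn0.
    by rewrite ler_wpM2r ?(ltW h0)// ler_nat leq_add2l.
  - by case.
have H1 : fine (P (A_ k)) @[k --> \oo] --> law z.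
  apply: probability_cvg => //.
    move=> k; apply: measurableI; first exact: (process_measurable HZ).
    by apply: measurableI; apply: (process_measurable HZ).
  apply: filterS2 (process_start HZ Dzeta) Zcvg => w w0 [T /(eventually_limit h0)[K HK]].
  exists K => k Kk; rewrite /A_ /= (HK _ Kk) (HK _ (leqW Kk)); split; first by case=> _ [].
  by move=> e.
have H2 : fine (P (A_ k)) @[k --> \oo] --> law z * p h z z.
  by under eq_fun do rewrite AE; apply: cvgMr_tmp; exact: transition_cvg.
have E : law z = law z * p h z z by exact: cvg_unique H1 H2.
by apply: (mulfI lz); rewrite mulr1 -E.
Qed.

(** [p h z z = 1] for all [h > 0] leaves no increment at [z], so the generator applied to the
    indicator, minus the total exit rate, is 0. *)
Lemma limit_no_exit (z : dconfig n) : dconfs sigma G z -> law z != 0 ->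
  dgen sigma G (fun y => (y == z)%:R) z = 0.
Proof.
move=> Dz lz; have HF := dclass_finite_class G (dsize z) hs.
have zF : z \in dclass sigma G (dsize z) by apply/mem_dclass.
have H1 := @Qt_generator _ _ _ _ _ _ (fun y => (y == z)%:R) _ Hp HF zF.
have H2 : (fun h => h^-1 * (Qt (dclass sigma G (dsize z)) p h (fun y => (y == z)%:R) z -
    (z == z)%:R)) @ 0^'+ --> (0 : R).
  apply: (@cvg_trans _ ((fun=> 0 : R) @ 0^'+)); last exact: cvg_cst.
  apply: near_eq_cvg; near=> h.
  have h0 : 0 < h by near: h; exact: nbhs_right_gt.
  have [uF _ _] := HF.
  rewrite /Qt (bigD1_seq z)//= eqxx mulr1 limit_stays// big1 ?addr0 ?subrr ?mulr0//.
  by move=> y /negbTE ->; rewrite mulr0.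
exact: cvg_unique H1 H2.
Unshelve. all: by end_near. Qed.

Lemma Et_cvg (f : dconfig n -> R) :
  Et sigma G p k%:R f zeta @[k --> \oo] --> \sum_(z <- F) law z * f z.
Proof.
rewrite /Et /Qt big_seq; under eq_fun do rewrite big_seq.
apply: cvg_bigsum => z /mem_dclass[Dz _]; apply: cvgMr_tmp.
have := @transition_cvg 1 z ltr01 Dz.
by under eq_fun do rewrite mulr1.
Qed.

Lemma law_ge0 z : 0 <= law z.
Proof. by rewrite /law fine_ge0. Qed.

Lemma law_mass : \sum_(z <- F) law z = 1.
Proof.
have := @Et_cvg (fun=> 1); under eq_bigr do rewrite mulr1.
move=> H; symmetry; apply: cvg_unique H => //.
apply: (@cvg_trans _ ((fun=> 1 : R) @ \oo)); last exact: cvg_cst.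
apply: near_eq_cvg; apply: nearW => k.
rewrite /Et /Qt; under eq_bigr do rewrite mulr1.
rewrite (class_mass Hp (dclass_finite_class G _ hs))//.
by apply/mem_dclass.
Qed.

Lemma limit_expectation (f : dconfig n -> R) :
  ('E_P[fun w => f (Zinf w)])%E = (\sum_(z <- F) law z * f z)%:E.
Proof.
have PE z : P [set w | Zinf w = z] = (law z)%:E.
  by rewrite /law fineK//; exact: fin_num_measure.
have H g : ('E_P[fun w => g (Zinf w)])%E = csum setT (fun z => law z * g z).
  exact: expectation_discrete.
have [uF _ _] := dclass_finite_class G (dsize zeta) hs.
rewrite H; apply: hassum_csum; apply: hassum_support => // y _ yF.
(* The class already carries mass 1, which is also the total mass, so nothing is left outside it. *)
suff -> : law y = 0 by rewrite mul0r.
have := H (fun=> 1); rewrite expectation_cst csum_ge0; last first.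
  by move=> z _; rewrite mulr1 law_ge0.
under eq_esum do rewrite mulr1.
move=> E; have := @le_sum_esum R _ setT (y :: F) law.
rewrite -E /= yF uF big_cons law_mass lee_fin => /(_ isT (fun z _ => law_ge0 z) (fun _ _ => I)) le1.
by apply/eqP; rewrite eq_le law_ge0 andbT; lra.
Qed.

End absorption.

(** A site with an active reservoir must be empty. Emptiness then spreads along the connected graph:
    next to an empty site [x], a particle would jump to [x] at a rate proportional to
    [alpha G x > 0]. Starting from an empty site matters for sigma = -1, where full sites block each
    other. *)
Lemma no_exit_empty (R : realType) (n : nat) (sigma : int) (G : geometry R n)
    (z : dconfig n) : sigma \in [:: -1; 0; 1] ->
  0 < Num.max (omegaL G) (omegaR G) -> dconfs sigma G z ->
  dgen sigma G (fun y => (y == z)%:R) z = 0 -> forall x, bulk z x = 0%N.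
Proof.
move=> hs hm; case: z => [[c l] r] Dc; rewrite /dgen /bulk /atL /atR /=.
pose e (c' : config n) : R := (c' == c)%:R.
(* A jump adds a particle at [y], so it changes the configuration even when the removal at [x] is
   truncated. *)
have neq (x y : 'I_n.+1) : x != y -> (addp (remp c x) y == c) = false.
  move=> xy; apply/negbTE/eqP => /ffunP/(_ y); rewrite !ffunE eqxx eq_sym (negbTE xy).
  by rewrite subn0 addn1 => /eqP; rewrite gtn_eqF.
have bE : gen_bulk sigma G (fun c' => ((c', l, r) == (c, l, r))%:R) c = gen_bulk sigma G e c.
  congr (gen_bulk _ _ _ _); apply/funext => c'; rewrite /e; congr (nat_of_bool _)%:R.
  by rewrite !xpair_eqE !eqxx !andbT.
have termE x y : x != y -> genE sigma G x y e c =
    - ((c x)%:R * occ_rate sigma G c y + (c y)%:R * occ_rate sigma G c x).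
  move=> xy; have yx : y != x by rewrite eq_sym.
  by rewrite /genE /e (neq x y xy) (neq y x yx) eqxx /=; ring.
have term0 x y : 0 <= (c x)%:R * occ_rate sigma G c y + (c y)%:R * occ_rate sigma G c x.
  by rewrite addr_ge0// mulr_ge0// occ_rate_ge0.
have b0 (x y : 'I_n.+1) : (x < y)%N && (omega G x y != 0) ->
    0 <= - (omega G x y * genE sigma G x y e c).
  move=> /andP[xy _]; rewrite termE; last by apply: contraTneq xy => ->; rewrite ltnn.
  by rewrite mulrN opprK mulr_ge0// omega_ge0.
have bsum : 0 <= - gen_bulk sigma G e c.
  rewrite /gen_bulk -sumrN; apply: sumr_ge0 => x _; rewrite -sumrN.
  by apply: sumr_ge0 => y; exact: b0.
have [oL oR] := (omegaL_ge0 G, omegaR_ge0 G).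
have [aL aR] := (alphaL_gt0 G, alphaR_gt0 G).
rewrite bE !xpair_eqE /= !eqxx /= [l.+1 == l]gtn_eqF// [r.+1 == r]gtn_eqF//.
rewrite andbF andbF /= sub0r !mulrN1 => E.
have L0 : 0 <= omegaL G * alphaL G * (c ord0)%:R by rewrite !mulr_ge0// ltW.
have R0 : 0 <= omegaR G * alphaR G * (c ord_max)%:R by rewrite !mulr_ge0// ltW.
(* The exit rates through the bulk, L and R are nonnegative with sum 0, so each of them vanishes. *)
have {}bE : - gen_bulk sigma G e c = 0 by lra.
have {}L0 : omegaL G * alphaL G * (c ord0)%:R = 0 by lra.
have {}R0 : omegaR G * alphaR G * (c ord_max)%:R = 0 by lra.
have adj' (x y : 'I_n.+1) : (x < y)%N -> omega G x y != 0 ->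
    (c x)%:R * occ_rate sigma G c y + (c y)%:R * occ_rate sigma G c x = 0.
  move=> xy oxy; move: bE; rewrite /gen_bulk -sumrN => /eqP.
  rewrite psumr_eq0; last first.
    by move=> u _; rewrite -sumrN; apply: sumr_ge0 => v; exact: b0.
  move=> /allP/(_ x (mem_index_enum _)) /=; rewrite -sumrN.
  rewrite psumr_eq0 => [/allP/(_ y (mem_index_enum _))|v]; last exact: b0.
  rewrite xy oxy /= oppr_eq0 mulf_eq0 (negbTE oxy) /= termE ?oppr_eq0; first by move/eqP.
  by apply: contraTneq xy => ->; rewrite ltnn.
have adj (x y : 'I_n.+1) : omega G x y != 0 -> c x = 0%N -> c y = 0%N.
  move=> oxy cx; have ax : occ_rate sigma G c x != 0.
    by rewrite /occ_rate cx mulr0 addr0 pnatr_eq0 -lt0n alpha_gt0.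
  have : (c x)%:R * occ_rate sigma G c y + (c y)%:R * occ_rate sigma G c x = 0.
    case: (ltngtP x y) => [xy|yx|/val_inj xy]; first exact: adj'.
      by rewrite addrC; apply: adj' => //; rewrite omega_sym.
    by move: oxy; rewrite xy omega_diag eqxx.
  rewrite cx mul0r add0r => /eqP; rewrite mulf_eq0 (negbTE ax) orbF pnatr_eq0.
  by move/eqP.
have [b cb] : exists b, c b = 0%N.
  move: hm; rewrite lt_max => /orP[w0|w0].
  - exists ord0; move/eqP: L0; rewrite !mulf_eq0 (gt_eqF w0) (gt_eqF aL) /= pnatr_eq0.
    by move/eqP.
  - exists ord_max; move/eqP: R0; rewrite !mulf_eq0 (gt_eqF w0) (gt_eqF aR) /= pnatr_eq0.
    by move/eqP.
move=> x; have /connectP[s sp ->] := omega_connected G b x.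
elim: s b cb sp => [|y s IH] b cb //= /andP[oby sp].
by apply: IH sp; exact: adj oby cb.
Qed.

Lemma limit_empty (R : realType) (n : nat) (sigma : int) (G : geometry R n)
    (p : R -> dconfig n -> dconfig n -> R) (d : measure_display)
    (Omega : measurableType d) (P : probability Omega R) (Z : R -> Omega -> dconfig n)
    (Zinf : Omega -> dconfig n) (zeta z : dconfig n) :
  sigma \in [:: -1; 0; 1] -> 0 < Num.max (omegaL G) (omegaR G) ->
  markov_semigroup (dconfs sigma G) p (dgen sigma G) ->
  markov_process (dconfs sigma G) p (fun z => (z == zeta)%:R) P Z ->
  dconfs sigma G zeta -> (forall z, measurable [set w | Zinf w = z]) ->
  {ae P, forall w, exists T : R, forall t : R, T <= t -> Z t w = Zinf w} ->
  dconfs sigma G z -> fine (P [set w | Zinf w = z]) != 0 -> forall x, bulk z x = 0%N.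
Proof.
move=> hs hm Hp HZ Dzeta mZ Zcvg Dz lz; apply: (no_exit_empty hs hm Dz).
exact: (limit_no_exit hs Hp HZ Dzeta mZ Zcvg Dz lz).
Qed.

Lemma cpow0 (R : realType) (n : nat) (b : 'I_n.+1 -> R) (c : config n) :
  (forall x, c x = 0%N) -> cpow b c = 1.
Proof. by move=> c0; rewrite /cpow big1// => x _; rewrite c0 expr0. Qed.

Lemma csize0 (n : nat) (c : config n) : (forall x, c x = 0%N) -> csize c = 0%N.
Proof. by move=> c0; rewrite /csize big1. Qed.

(** Limit states of positive probability have an empty bulk, so [beta] disappears, and the power of
    0 retains those with every particle at L. *)
Lemma limit_left_probability (R : realType) (n : nat) (sigma : int) (G : geometry R n)
    (p : R -> dconfig n -> dconfig n -> R) (d : measure_display)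
    (Omega : measurableType d) (P : probability Omega R) (Z : R -> Omega -> dconfig n)
    (Zinf : Omega -> dconfig n) (zeta : dconfig n) (beta : 'I_n.+1 -> R) :
  sigma \in [:: -1; 0; 1] -> 0 < Num.max (omegaL G) (omegaR G) ->
  markov_semigroup (dconfs sigma G) p (dgen sigma G) ->
  markov_process (dconfs sigma G) p (fun z => (z == zeta)%:R) P Z ->
  dconfs sigma G zeta -> (forall z, measurable [set w | Zinf w = z]) ->
  {ae P, forall w, exists T : R, forall t : R, T <= t -> Z t w = Zinf w} ->
  Et sigma G p k%:R (rpow 1 0 (cpow beta)) zeta @[k --> \oo] -->
  fine (P [set w | atL (Zinf w) = dsize zeta]).
Proof.
move=> hs hm Hp HZ Dzeta mZ Zcvg.
have mA : measurable [set w | atL (Zinf w) = dsize zeta].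
  by apply: (@discrete_preimage _ _ _ Zinf [set z | atL z = dsize zeta]).
have := Et_cvg HZ Dzeta mZ Zcvg (f := rpow 1 0 (cpow beta)).
suff -> : fine (P [set w | atL (Zinf w) = dsize zeta]) =
  \sum_(z <- dclass sigma G (dsize zeta))
    fine (P [set w | Zinf w = z]) * rpow 1 0 (cpow beta) z by [].
apply: EFin_inj; rewrite fineK; last exact: fin_num_measure.
have := limit_expectation hs Hp HZ Dzeta mZ Zcvg (fun z => (atL z == dsize zeta)%:R).
rewrite -(expectation_indic P mA) (_ : (fun w => _) = \1_[set w | atL (Zinf w) = dsize zeta]).
  move=> ->; congr EFin; rewrite [LHS]big_seq [RHS]big_seq.
  apply: eq_bigr => z /mem_dclass[Dz zs].
  have [->|lz] := eqVneq (fine (P [set w | Zinf w = z])) 0; first by rewrite !mul0r.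
  have z0 := limit_empty hs hm Hp HZ Dzeta mZ Zcvg Dz lz.
  rewrite /rpow cpow0// mulr1 expr1n mul1r expr0n -zs dsizeE csize0// addn0.
  by rewrite -[X in X == _]addn0 eqn_add2l eq_sym.
apply/funext => w; rewrite indicE; congr (nat_of_bool _)%:R.
by apply/eqP/idP; rewrite inE.
Qed.

Lemma msum_cvg (R : realType) (n m : nat) (w : 'I_n.+1 -> R) (g : nat -> config n -> R)
    (h : config n -> R) (xi : config n) :
  (forall c : config n, (forall x, (c x <= xi x)%N) -> g k c @[k --> \oo] --> h c) ->
  msum m w (g k) xi @[k --> \oo] --> msum m w h xi.
Proof.
move=> gh; under eq_fun do rewrite msum_below; rewrite msum_below.
apply: cvg_bigsum => z /forallP zx; apply: cvgMl_tmp; apply: gh => x.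
by rewrite ffunE.
Qed.

Lemma psi_cvg (R : realType) (n : nat) (sigma : int) (G : geometry R n)
    (d : measure_display) (Omega : measurableType d)
    (Ph : dconfig n -> probability Omega R) (Z : R -> Omega -> dconfig n)
    (Zinf : Omega -> dconfig n) (beta beta' : 'I_n.+1 -> R) (xi : dconfig n) :
  sigma \in [:: -1; 0; 1] -> 0 < Num.max (omegaL G) (omegaR G) ->
  dual_process sigma G Ph Z -> dual_limit sigma G Ph Z Zinf -> dconfs0 sigma G xi ->
  psi Ph Z k%:R beta beta' xi @[k --> \oo] --> psi_inf Ph Zinf beta' xi.
Proof.
move=> hs hm [p Hp HZ] [mZ Zcvg] Dxi; have [Dxib l0 r0] := Dxi.
have xim := leq_csize (bulk xi).
under eq_fun do rewrite (psiE _ _ hs Hp HZ (ler0n _ _) Dxi xim).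
rewrite /psi_inf (psi_sum _ _ l0 r0 xim); apply: msum_cvg => c cx.
have Dc : dconfs sigma G (c, 0%N, 0%N) by exact: confs_le Dxib cx.
exact: (limit_left_probability _ hs hm Hp (HZ _ Dc) Dc mZ (Zcvg _ Dc)).
Qed.

Lemma psi_unique (R : realType) (n : nat) (sigma : int) (G : geometry R n)
    (d d' : measure_display) (Omega : measurableType d) (Omega' : measurableType d')
    (Ph : dconfig n -> probability Omega R) (Z : R -> Omega -> dconfig n)
    (Ph' : dconfig n -> probability Omega' R) (Z' : R -> Omega' -> dconfig n)
    (t : R) (beta beta' : 'I_n.+1 -> R) (xi : dconfig n) :
  sigma \in [:: -1; 0; 1] -> dual_process sigma G Ph Z -> dual_process sigma G Ph' Z' ->
  0 <= t -> dconfs0 sigma G xi ->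
  psi Ph Z t beta beta' xi = psi Ph' Z' t beta beta' xi.
Proof.
move=> hs [p Hp HZ] [p' Hp' HZ'] t0 Dxi; have [Dxib l0 r0] := Dxi.
have xim := leq_csize (bulk xi).
rewrite (psiE _ _ hs Hp HZ t0 Dxi xim) (psiE _ _ hs Hp' HZ' t0 Dxi xim).
apply: eq_msum => c cx; apply: (Et_unique _ hs Hp Hp' t0).
exact: confs_le Dxib cx.
Qed.

(** * Moments of the stationary measure, and the conclusion *)

Lemma esum_stationary (R : realType) (S : countType) (D : set S) (p : R -> S -> S -> R)
    (L : (S -> R) -> S -> R) (mu f : S -> R) (t : R) :
  markov_semigroup D p L -> stationary D p mu -> 0 <= t -> (forall y, D y -> 0 <= f y) ->
  (\esum_(y in D) (mu y * f y)%:E =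
   \esum_(x in D) ((mu x)%:E * \esum_(y in D) (p t x y * f y)%:E))%E.
Proof.
move=> Hp [[mu0 _] st] t0 f0.
have pos x y : D x -> D y -> 0 <= p t x y by exact: semigroup_ge0 Hp t0.
transitivity (\esum_(y in D) \esum_(x in D) (mu x * p t x y * f y)%:E)%E.
  apply: eq_esum => y Dy; rewrite mulrC EFinM -(st t y t0 Dy) -esumZl ?f0//.
    by apply: eq_esum => x _; rewrite -EFinM mulrC.
  by move=> x Dx; rewrite lee_fin mulr_ge0 ?mu0// pos.
rewrite esum_exchange; last first.
  by move=> y x Dy Dx; rewrite lee_fin !mulr_ge0 ?f0 ?mu0// pos.
apply: eq_esum => x Dx; rewrite -esumZl ?mu0//.
  by apply: eq_esum => y Dy; rewrite -EFinM mulrA.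
by move=> y Dy; rewrite lee_fin mulr_ge0 ?f0// pos.
Qed.

(* Fatou-type bound: [f] is bounded, and [mu f = mu (P_k f)] where [P_k f] is
   asymptotically at most [m]. *)
Lemma stationary_bound (R : realType) (S : countType) (D : set S)
    (p : R -> S -> S -> R) (L : (S -> R) -> S -> R) (mu f : S -> R) (M m : R)
    (u : nat -> S -> R) :
  markov_semigroup D p L -> stationary D p mu -> 0 <= m ->
  (forall y, D y -> 0 <= f y <= M) ->
  (forall k x, D x -> Pt D p k%:R f x <= u k x) ->
  (forall x, D x -> u k x @[k --> \oo] --> m) ->
  (\esum_(y in D) (mu y * f y)%:E <= m%:E)%E.
Proof.
move=> Hp Hst m0 fM fu um; have [[mu0 mu1] _] := Hst.
have [r /andP[r0 rM] rE] := pmf_esum Hst.1 fM; rewrite rE lee_fin.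
have M0 : 0 <= M by exact: le_trans r0 rM.
have M1 : 0 < 1 + M by rewrite ltr_pwDl.
apply: (le_of_eps M1) => e e0.
(* On a finite set of mass above [1 - e] the convergence of [u] is uniform; off it [f] is at most
   [M]. The total error is [e + M e], whence the factor [1 + M]. *)
have [A [uA AD] sA] : exists2 A : seq S, uniq A /\ (forall x, x \in A -> D x) &
    1 - e < \sum_(x <- A) mu x.
  have : ((1 - e)%:E < \esum_(x in D) (mu x)%:E)%E by rewrite mu1 lte_fin; lra.
  move=> /ereal_sup_gt[_ [X [finX XD] <-]] H.
  exists (finmap.enum_fset (fset_set X)).
    split; first exact: finmap.fset_uniq.
    move=> x; have := in_fset_set finX x.
    by rewrite -[X in X = _]/(x \in finmap.enum_fset (fset_set X)) => -> /set_mem/XD.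
  by move: H; rewrite fsbig_finite// sumEFin lte_fin.
have [k kA] : exists k, forall x, x \in A -> u k x <= m + e.
  have : \forall k \near \oo, forall x, x \in A -> u k x <= m + e.
    elim: A uA AD {sA} => [|x A IH] /= uA AD; first by apply: nearW.
    have {}IH : \forall k \near \oo, forall x, x \in A -> u k x <= m + e.
      by apply: IH; [case/andP: uA|move=> y yA; apply: AD; rewrite inE yA orbT].
    have Dx : D x by apply: AD; rewrite inE eqxx.
    have /cvgr_le/(_ (m + e)) := um x Dx; rewrite ltrDl => /(_ e0).
    apply: filterS2 IH => k IH ux y; rewrite inE => /predU1P[->//|]; exact: IH.
  by move=> [k _ Hk]; exists k; apply: Hk => /=.
pose b (x : S) : R := (x \notin A)%:R.
have b01 x : D x -> 0 <= b x <= 1 by rewrite /b ler0n lern1 leq_b1.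
have [s /andP[s0 _] sE] := pmf_esum Hst.1 b01.
have AE : (\esum_(x in D) (mu x * (x \in A)%:R)%:E = (\sum_(x <- A) mu x)%:E)%E.
  rewrite (esum_support uA AD).
  - by congr EFin; rewrite [LHS]big_seq [RHS]big_seq; apply: eq_bigr => x ->; rewrite mulr1.
  - by move=> x Dx; rewrite mulr_ge0// mu0.
  - by move=> x _ /negbTE ->; rewrite mulr0.
have s1 : s + \sum_(x <- A) mu x = 1.
  apply: EFin_inj; rewrite EFinD -sE -AE -mu1 -esumD.
  - apply: eq_esum => x _; rewrite -EFinD -mulrDr /b; congr EFin.
    by case: (x \in A); rewrite ?add0r ?addr0 mulr1.
  - by move=> x Dx; rewrite lee_fin mulr_ge0 ?mu0//; case/andP: (b01 x Dx).
  - by move=> x Dx; rewrite lee_fin mulr_ge0 ?mu0.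
have k0 : 0 <= k%:R :> R by rewrite ler0n.
have f0 y : D y -> 0 <= f y by move=> /fM/andP[].
suff : (r%:E <= (m + e)%:E + (M * s)%:E)%E.
  by rewrite -EFinD lee_fin; have : M * s <= M * e by [apply: ler_wpM2l => //; lra]; lra.
rewrite -rE (esum_stationary Hp Hst k0 f0).
apply: (@le_trans _ _ (\esum_(x in D) ((m + e)%:E * (mu x)%:E + M%:E * (mu x * b x)%:E))%E).
  apply: le_esum => x Dx; rewrite (PtE Hp fM k0 Dx) -!EFinM -EFinD lee_fin.
  have /andP[P0 PM] := Pt_bound Hp fM k0 Dx; have mux := mu0 x Dx.
  rewrite /b; have [xA|xA] /= := boolP (x \in A).
    rewrite !mulr0 addr0 mulrC; apply: ler_wpM2r => //.
    exact: le_trans (fu k x Dx) (kA x xA).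
  rewrite mulr1 mulrC -[leLHS]add0r; apply: lerD; last exact: ler_wpM2r.
  by rewrite mulr_ge0// addr_ge0// ltW.
rewrite esumD; last 2 first.
- by move=> x Dx; rewrite -EFinM lee_fin mulr_ge0 ?mu0// addr_ge0// ltW.
- by move=> x Dx; rewrite -EFinM lee_fin !mulr_ge0 ?mu0//; case/andP: (b01 x Dx).
rewrite !esumZl// ?addr_ge0 ?(ltW e0)//.
- by rewrite mu1 mule1 sE.
- by move=> x Dx; rewrite lee_fin mulr_ge0 ?mu0//; case/andP: (b01 x Dx).
Qed.

Lemma esum_Et (R : realType) (n : nat) (sigma : int) (G : geometry R n)
    (thetaL thetaR : R) (ph : R -> dconfig n -> dconfig n -> R) (t : R)
    (mu M : config n -> R) (c : config n) :
  sigma \in [:: -1; 0; 1] -> Theta sigma thetaL -> Theta sigma thetaR ->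
  markov_semigroup (dconfs sigma G) ph (dgen sigma G) -> 0 <= t ->
  (forall x, confs sigma G x -> 0 <= mu x) -> confs sigma G c ->
  (forall e, confs sigma G e ->
    (\esum_(x in confs sigma G) (mu x * Dcl sigma G e x)%:E = (M e)%:E)%E) ->
  (\esum_(x in confs sigma G)
     ((mu x)%:E * (Et sigma G ph t (rpow thetaL thetaR (Dcl sigma G ^~ x)) (c, 0%N, 0%N))%:E) =
   (Et sigma G ph t (rpow thetaL thetaR M) (c, 0%N, 0%N))%:E)%E.
Proof.
move=> hs hL hR Hph t0 mu0 Dc ME.
have [tL tR] := (Theta_ge0 hL, Theta_ge0 hR).
pose F := dclass sigma G (dsize ((c, 0%N, 0%N) : dconfig n)).
pose co (z : dconfig n) := thetaL ^+ atL z * thetaR ^+ atR z.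
have co0 z : 0 <= co z by rewrite mulr_ge0// exprn_ge0.
have HF : finite_class (dconfs sigma G) (dgen sigma G) F by exact: dclass_finite_class.
have [uF FD _] := HF.
have ph0 z : z \in F -> 0 <= ph t (c, 0%N, 0%N) z.
  by move=> zF; exact: (semigroup_ge0 Hph t0 _ (FD _ zF)).
rewrite (eq_esum (b := fun x => \sum_(z <- F | z \in F)
    ((ph t (c, 0%N, 0%N) z * co z)%:E * (mu x * Dcl sigma G (bulk z) x)%:E)%E)); last first.
  move=> x Dx; rewrite -big_seq -EFinM /Et /Qt mulr_sumr -sumEFin.
  by apply: eq_bigr => z _; rewrite -EFinM /rpow /co; congr EFin; ring.
rewrite esum_sum; last first.
  move=> x z Dx zF; rewrite -EFinM lee_fin; apply: mulr_ge0.
    by apply: mulr_ge0 => //; exact: ph0.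
  by apply: mulr_ge0; [exact: mu0|exact: Dcl_ge0].
rewrite /Et /Qt -sumEFin [RHS]big_seq; apply: eq_bigr => z zF.
rewrite esumZl; last 2 first.
- by apply: mulr_ge0 => //; exact: ph0.
- by move=> x Dx; rewrite lee_fin mulr_ge0 ?mu0 ?Dcl_ge0.
by rewrite (ME (bulk z) (FD _ zF)) -EFinM /rpow /co; congr EFin; ring.
Qed.

Lemma stationary_moment (R : realType) (n : nat) (sigma : int) (G : geometry R n)
    (thetaL thetaR : R) (b : 'I_n.+1 -> R) (p : R -> config n -> config n -> R)
    (ph : R -> dconfig n -> dconfig n -> R) (mu : config n -> R)
    (d : measure_display) (Omega : measurableType d)
    (Ph : dconfig n -> probability Omega R) (Z : R -> Omega -> dconfig n)
    (Zinf : Omega -> dconfig n) :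
  sigma \in [:: -1; 0; 1] -> 0 < Num.max (omegaL G) (omegaR G) ->
  Theta sigma thetaL -> Theta sigma thetaR ->
  markov_semigroup (confs sigma G) p (gen sigma G thetaL thetaR) ->
  stationary (confs sigma G) p mu ->
  markov_semigroup (dconfs sigma G) ph (dgen sigma G) ->
  (forall zeta, dconfs sigma G zeta ->
    markov_process (dconfs sigma G) ph (fun z => (z == zeta)%:R) (Ph zeta) Z) ->
  dual_limit sigma G Ph Z Zinf ->
  forall c, confs sigma G c -> exists2 M,
    (\esum_(eta in confs sigma G) (mu eta * Dcl sigma G c eta)%:E = M%:E)%E &
    Et sigma G ph k%:R (rpow thetaL thetaR (cpow b)) (c, 0%N, 0%N) @[k --> \oo] --> M.
Proof.
move=> hs hm hL hR Hp Hst Hph HZ [mZ Zcvg].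
have [tL tR] := (Theta_ge0 hL, Theta_ge0 hR); have [[mu0 mu1] _] := Hst.
set D := confs sigma G in Hp Hst mu0 mu1 *.
pose F (c : config n) := dclass sigma G (dsize ((c, 0%N, 0%N) : dconfig n)).
pose co (z : dconfig n) := thetaL ^+ atL z * thetaR ^+ atR z.
pose m c := \sum_(z <- F c) fine (Ph (c, 0%N, 0%N) [set w | Zinf w = z]) * co z.
have co0 z : 0 <= co z by rewrite mulr_ge0// exprn_ge0.
(* In the limit only the value of [g] at the empty configuration counts. This serves for duality
   functions, for [cpow b], and for the moments [M] themselves. *)
have cvg_co c (g : config n -> R) : D c ->
    (forall e : config n, (forall x, e x = 0%N) -> g e = 1) ->
    Et sigma G ph k%:R (rpow thetaL thetaR g) (c, 0%N, 0%N) @[k --> \oo] --> m c.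
  move=> Dc g1; have Dz : dconfs sigma G (c, 0%N, 0%N) by [].
  have := Et_cvg (HZ _ Dz) Dz mZ (Zcvg _ Dz) (f := rpow thetaL thetaR g).
  suff -> : m c = \sum_(z <- F c) fine (Ph (c, 0%N, 0%N) [set w | Zinf w = z]) *
      rpow thetaL thetaR g z by [].
  rewrite /m [LHS]big_seq [RHS]big_seq; apply: eq_bigr => z /mem_dclass[Dz' _].
  have [->|lz] := eqVneq (fine (Ph (c, 0%N, 0%N) [set w | Zinf w = z])) 0.
    by rewrite !mul0r.
  have z0 := limit_empty hs hm Hph (HZ _ Dz) Dz mZ (Zcvg _ Dz) Dz' lz.
  by rewrite /rpow g1// mulr1.
have Dcl1 eta (e : config n) : (forall x, e x = 0%N) -> Dcl sigma G e eta = 1.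
  move=> e0; rewrite /Dcl big1// => x _; rewrite e0 d_clE ffactn0.
  rewrite /w_ subn0 addn0 expr0.
  by do 2?case: ifP => _; rewrite !divff ?divr1// pnatr_eq0 -lt0n fact_gt0.
have m0 c : 0 <= m c.
  by apply: sumr_ge0 => z _; rewrite mulr_ge0// fine_ge0.
(* Finiteness comes first: a partial sum over a finite set is the integral of a bounded function
   below [Dcl], whose evolution is controlled by duality, so the Fatou-type bound applies. *)
have upper c : D c -> (\esum_(eta in D) (mu eta * Dcl sigma G c eta)%:E <= (m c)%:E)%E.
  move=> Dc; apply: ge_ereal_sup => /= _ [X [finX XD] <-].
  have [s Xs] : exists s : seq (config n), X = [set` s] by apply/finite_seqP.
  pose f y : R := if y \in s then Dcl sigma G c y else 0.
  have fM y : D y -> 0 <= f y <= \sum_(y <- undup s) Dcl sigma G c y.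
    move=> _; rewrite /f; case: ifPn => ys; last by rewrite lexx sumr_ge0// => ? _; exact: Dcl_ge0.
    rewrite Dcl_ge0 (bigD1_seq y) ?mem_undup ?undup_uniq//= lerDl.
    by apply: sumr_ge0 => ? _; exact: Dcl_ge0.
  rewrite (@eq_fsbigr _ _ _ _ _ (fun y => (mu y * f y)%:E)); last first.
    by move=> y /set_mem; rewrite Xs /f /= => ->.
  apply: (@le_trans _ _ (\esum_(y in D) (mu y * f y)%:E)%E).
    by apply: ereal_sup_ubound; exists X.
  apply: (@stationary_bound R _ D p _ mu f _ (m c) (fun k eta =>
    Et sigma G ph k%:R (rpow thetaL thetaR (Dcl sigma G ^~ eta)) (c, 0%N, 0%N)) Hp Hst) => //.
  - exact: fM.
  - move=> k eta De; have k0 : 0 <= k%:R :> R by rewrite ler0n.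
    rewrite -lee_fin -(PtE Hp fM k0 De) -(duality hs hL hR Hp Hph k0 Dc De).
    apply: le_esum => y Dy; rewrite lee_fin; apply: ler_wpM2l.
      exact: (semigroup_ge0 Hp k0 De Dy).
    by rewrite /f; case: ifP => // _; exact: Dcl_ge0.
  - by move=> eta De; apply: cvg_co => // e e0; exact: Dcl1.
have Mex c : exists M, D c -> (\esum_(eta in D) (mu eta * Dcl sigma G c eta)%:E = M%:E)%E.
  have [Dc|nDc] := pselect (D c); last by exists 0.
  exists (fine (\esum_(eta in D) (mu eta * Dcl sigma G c eta)%:E)%E) => _.
  rewrite fineK// ge0_fin_numE; first exact: le_lt_trans (upper c Dc) (ltry _).
  by apply: esum_ge0 => eta De; rewrite lee_fin mulr_ge0 ?mu0// Dcl_ge0.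
have {Mex}[M ME] : exists M : config n -> R, forall c, D c ->
    (\esum_(eta in D) (mu eta * Dcl sigma G c eta)%:E = (M c)%:E)%E.
  by have [M MP] := choice Mex; exists M.
move=> c Dc; exists (M c); first exact: ME.
(* Stationarity and duality make [M] invariant under the dual evolution, so the limit in time is
   both [M c] and [m c]. *)
have MEt k : M c = Et sigma G ph k%:R (rpow thetaL thetaR M) (c, 0%N, 0%N).
  have k0 : 0 <= k%:R :> R by rewrite ler0n.
  apply: EFin_inj; rewrite -ME// (esum_stationary Hp Hst k0); last by move=> y _; exact: Dcl_ge0.
  rewrite -(esum_Et hs hL hR Hph k0 mu0 Dc ME); apply: eq_esum => x Dx.
  by rewrite (duality hs hL hR Hp Hph k0 Dc Dx).
suff -> : M c = m c by apply: cvg_co => // e e0; exact: cpow0.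
have M1 (e : config n) : (forall x, e x = 0%N) -> M e = 1.
  move=> e0; have De : D e by move=> s1 x; rewrite e0.
  apply: EFin_inj; rewrite -ME// -mu1; apply: eq_esum => eta _.
  by rewrite Dcl1// mulr1.
have H1 := cvg_co c M Dc M1.
have H2 : Et sigma G ph k%:R (rpow thetaL thetaR M) (c, 0%N, 0%N) @[k --> \oo] --> M c.
  by under eq_fun do rewrite -MEt; exact: cvg_cst.
exact: cvg_unique H2 H1.
Qed.

(** Used with [E] the pairs of states at times 0 and [t], and with [E] the state space under the
    stationary measure. The sum of mixed signs becomes a finite combination of nonnegative sums. *)
Lemma hassum_D_or (R : realType) (n : nat) (sigma : int) (G : geometry R n)
    (T : countType) (E : set T) (X : T -> config n) (lam : T -> R) (M : config n -> R)
    (thetaL thetaR : R) (beta : 'I_n.+1 -> R) (xi : dconfig n) :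
  dconfs0 sigma G xi -> (forall q, E q -> 0 <= lam q) ->
  (forall c, confs sigma G c ->
    (\esum_(q in E) (lam q * Dcl sigma G c (X q))%:E = (M c)%:E)%E) ->
  hassum E (fun q => lam q * D_or sigma G thetaL thetaR beta xi (X q))
    (msum (csize (bulk xi)) (fun x => - interp thetaL thetaR beta x) M (bulk xi)).
Proof.
move=> [Dxi l0 r0] lam0 ME; have xim := leq_csize (bulk xi).
rewrite msum_below.
apply: (@eq_hassum _ _ _ (fun q =>
  \sum_(z : {ffun 'I_n.+1 -> 'I_(csize (bulk xi)).+1} | [forall x, (z x <= bulk xi x)%N])
    (\prod_x ('C(bulk xi x, z x)%:R * (- interp thetaL thetaR beta x) ^+ (bulk xi x - z x))) *
    (lam q * Dcl sigma G (cfg z) (X q)))).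
  move=> q Eq; rewrite (@D_or_msum R n sigma G thetaL thetaR beta xi _ _ l0 r0 xim).
  rewrite msum_below mulr_sumr.
  by apply: eq_bigr => z _; rewrite mulrCA.
apply: hassum_sum => z /forallP zx; apply: hassumZ; apply: ge0_hassum.
  by move=> q Eq; rewrite mulr_ge0 ?lam0// Dcl_ge0.
by apply: ME; apply: (confs_le Dxi) => x; rewrite ffunE.
Qed.

(** The inner sum, over the state at time [t], is given by duality; integrating the dual expectation
    over the initial product law turns [Dcl] into powers of the local parameters. *)
Lemma process_Dcl (R : realType) (n : nat) (sigma : int) (G : geometry R n)
    (thetaL thetaR : R) (beta : 'I_n.+1 -> R) (p : R -> config n -> config n -> R)
    (ph : R -> dconfig n -> dconfig n -> R) (t : R) (c : config n) :
  sigma \in [:: -1; 0; 1] -> Theta sigma thetaL -> Theta sigma thetaR ->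
  (forall x, Theta sigma (interp thetaL thetaR beta x)) ->
  markov_semigroup (confs sigma G) p (gen sigma G thetaL thetaR) ->
  markov_semigroup (dconfs sigma G) ph (dgen sigma G) -> 0 <= t -> confs sigma G c ->
  (\esum_(q in confs sigma G `*` confs sigma G)
     (mu_interp sigma G thetaL thetaR beta q.1 * p t q.1 q.2 * Dcl sigma G c q.2)%:E =
   (Et sigma G ph t (rpow thetaL thetaR (cpow (interp thetaL thetaR beta)))
     (c, 0%N, 0%N))%:E)%E.
Proof.
move=> hs hL hR hb Hp Hph t0 Dc.
have mu0 x : 0 <= mu_interp sigma G thetaL thetaR beta x.
  by apply: prodr_ge0 => y _; exact: nu_ge0.
rewrite -(esum_Et (mu := mu_interp sigma G thetaL thetaR beta) hs hL hR Hph t0)//; last first.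
  by move=> e De; exact: esum_mu_interp.
transitivity (\esum_(x in confs sigma G) \esum_(y in confs sigma G)
    (mu_interp sigma G thetaL thetaR beta x * p t x y * Dcl sigma G c y)%:E)%E.
  rewrite (esum_esum (J := fun=> confs sigma G))// => x y Dx Dy.
  by rewrite lee_fin !mulr_ge0 ?Dcl_ge0// (semigroup_ge0 Hp).
apply: eq_esum => x Dx; rewrite -(duality hs hL hR Hp Hph t0 Dc Dx) -esumZl//.
  by apply: eq_esum => y _; rewrite -EFinM mulrA.
by move=> y Dy; rewrite lee_fin mulr_ge0 ?Dcl_ge0// (semigroup_ge0 Hp).
Qed.

Theorem theorem5p6 (R : realType) (n : nat) (sigma : int) (G : geometry R n)
    (hsigma : sigma \in [:: -1; 0; 1])
    (dh : measure_display) (Omegah : measurableType dh)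
    (Ph : dconfig n -> probability Omegah R) (Z : R -> Omegah -> dconfig n)
    (hZ : dual_process sigma G Ph Z) :
  (forall (thetaL thetaR : R) (beta beta' : 'I_n.+1 -> R),
    Theta sigma thetaL -> Theta sigma thetaR ->
    (forall x, Theta sigma (interp thetaL thetaR beta x)) ->
    (forall x, Theta sigma (interp thetaL thetaR beta' x)) ->
    forall p : R -> config n -> config n -> R,
    markov_semigroup (confs sigma G) p (gen sigma G thetaL thetaR) ->
    forall (d : measure_display) (Omega : measurableType d)
      (P : probability Omega R) (eta : R -> Omega -> config n),
    markov_process (confs sigma G) p (mu_interp sigma G thetaL thetaR beta) P eta ->
    forall (xi : dconfig n) (t : R), dconfs0 sigma G xi -> 0 <= t ->
    ('E_P[fun w => D_or sigma G thetaL thetaR beta' xi (eta t w)])%E =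
    ((thetaL - thetaR) ^+ dsize xi * psi Ph Z t beta beta' xi)%:E)
  /\
  (* psi depends only on sigma, G, t, beta, beta' and xi, not on the
     realization of the dual process *)
  (forall (dh2 : measure_display) (Omegah2 : measurableType dh2)
      (Ph2 : dconfig n -> probability Omegah2 R) (Z2 : R -> Omegah2 -> dconfig n),
    dual_process sigma G Ph2 Z2 ->
    forall (t : R) (beta beta' : 'I_n.+1 -> R) (xi : dconfig n),
    0 <= t -> dconfs0 sigma G xi ->
    psi Ph2 Z2 t beta beta' xi = psi Ph Z t beta beta' xi)
  /\
  (0 < Num.max (omegaL G) (omegaR G) ->
   forall Zinf : Omegah -> dconfig n, dual_limit sigma G Ph Z Zinf ->
   (forall (thetaL thetaR : R) (beta' : 'I_n.+1 -> R),
     Theta sigma thetaL -> Theta sigma thetaR ->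
     (forall x, Theta sigma (interp thetaL thetaR beta' x)) ->
     forall p : R -> config n -> config n -> R,
     markov_semigroup (confs sigma G) p (gen sigma G thetaL thetaR) ->
     forall mu : config n -> R, stationary (confs sigma G) p mu ->
     forall xi : dconfig n, dconfs0 sigma G xi ->
     csum (confs sigma G)
       (fun eta => D_or sigma G thetaL thetaR beta' xi eta * mu eta) =
     ((thetaL - thetaR) ^+ dsize xi * psi_inf Ph Zinf beta' xi)%:E)
   /\
   (forall (dh2 : measure_display) (Omegah2 : measurableType dh2)
       (Ph2 : dconfig n -> probability Omegah2 R) (Z2 : R -> Omegah2 -> dconfig n)
       (Zinf2 : Omegah2 -> dconfig n),
     dual_process sigma G Ph2 Z2 -> dual_limit sigma G Ph2 Z2 Zinf2 ->
     forall (beta' : 'I_n.+1 -> R) (xi : dconfig n), dconfs0 sigma G xi ->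
     psi_inf Ph2 Zinf2 beta' xi = psi_inf Ph Zinf beta' xi)).
Proof.
have HZ := hZ; case: HZ => ph Hph HZ.
split; [|split].
- move=> thetaL thetaR beta beta' hL hR hb hb' p Hp d Omega P eta Heta xi t Dxi t0.
  have [Dxib l0 r0] := Dxi; have xim := leq_csize (bulk xi).
  rewrite (process_expectation _ Heta t0).
  have pos q : (confs sigma G `*` confs sigma G) q ->
      0 <= mu_interp sigma G thetaL thetaR beta q.1 * p t q.1 q.2.
    move=> [Dq1 Dq2]; apply: mulr_ge0; last exact: (semigroup_ge0 Hp).
    by apply: prodr_ge0 => x _; exact: nu_ge0.
  rewrite (hassum_csum (hassum_D_or thetaL thetaR beta' Dxi pos
    (fun c Dc => process_Dcl hsigma hL hR hb Hp Hph t0 Dc))).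
  rewrite (Et_interp _ _ _ _ hsigma Hph t0 Dxib xim) -(psiE _ _ hsigma Hph HZ t0 Dxi xim).
  by rewrite dsizeE l0 r0.
- move=> dh2 Omegah2 Ph2 Z2 hZ2 t beta beta' xi t0 Dxi.
  exact: psi_unique hsigma hZ2 hZ t0 Dxi.
move=> hmax Zinf hinf; split.
- move=> thetaL thetaR beta' hL hR hb' p Hp mu Hmu xi Dxi.
  have [Dxib l0 r0] := Dxi; have xim := leq_csize (bulk xi).
  (* The limit in time does not depend on [beta]; the value 0 puts the parameter [thetaR] at every
     site. *)
  pose beta (_ : 'I_n.+1) : R := 0.
  have Mex c : exists M : R, confs sigma G c ->
      (\esum_(eta in confs sigma G) (mu eta * Dcl sigma G c eta)%:E = M%:E)%E /\
      Et sigma G ph k%:R (rpow thetaL thetaR (cpow (interp thetaL thetaR beta)))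
        (c, 0%N, 0%N) @[k --> \oo] --> M.
    have [Dc|nDc] := pselect (confs sigma G c); last by exists 0.
    have [r rE rcvg] := stationary_moment (interp thetaL thetaR beta)
      hsigma hmax hL hR Hp Hmu Hph HZ hinf Dc.
    by exists r.
  have [M MP] := choice Mex.
  have mu0 := Hmu.1.1.
  have H := hassum_D_or (X := id) thetaL thetaR beta' Dxi mu0 (fun c Dc => (MP c Dc).1).
  transitivity (csum (confs sigma G)
      (fun eta => mu eta * D_or sigma G thetaL thetaR beta' xi eta)).
    by congr csum; apply/funext => eta; rewrite mulrC.
  rewrite (hassum_csum H); congr EFin.
  (* One sequence, two limits: the stationary expectation, through the moments [M], and the multiple
     of [psi_inf], through [Et_interp]. *)
  have H1 : msum (csize (bulk xi)) (fun x => - interp thetaL thetaR beta' x) (fun c =>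
      Et sigma G ph k%:R (rpow thetaL thetaR (cpow (interp thetaL thetaR beta)))
        (c, 0%N, 0%N)) (bulk xi) @[k --> \oo] -->
      msum (csize (bulk xi)) (fun x => - interp thetaL thetaR beta' x) M (bulk xi).
    by apply: msum_cvg => c cx; apply: (MP c _).2; exact: confs_le Dxib cx.
  have H2 : msum (csize (bulk xi)) (fun x => - interp thetaL thetaR beta' x) (fun c =>
      Et sigma G ph k%:R (rpow thetaL thetaR (cpow (interp thetaL thetaR beta)))
        (c, 0%N, 0%N)) (bulk xi) @[k --> \oo] -->
      (thetaL - thetaR) ^+ dsize xi * psi_inf Ph Zinf beta' xi.
    under eq_fun do rewrite (Et_interp _ _ _ _ hsigma Hph (ler0n _ _) Dxib xim)
      -(psiE _ _ hsigma Hph HZ (ler0n _ _) Dxi xim).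
    rewrite dsizeE l0 r0; apply: cvgMl_tmp.
    exact: psi_cvg hsigma hmax hZ hinf Dxi.
  exact: cvg_unique H1 H2.
- move=> dh2 Omegah2 Ph2 Z2 Zinf2 hZ2 hinf2 beta' xi Dxi.
  pose beta (_ : 'I_n.+1) : R := 0.
  have H1 := psi_cvg beta (beta' := beta') hsigma hmax hZ2 hinf2 Dxi.
  have H2 := psi_cvg beta (beta' := beta') hsigma hmax hZ hinf Dxi.
  (* The two realizations agree at every integer time, hence in the limit. *)
  have E : (fun k => psi Ph2 Z2 k%:R beta beta' xi) = (fun k => psi Ph Z k%:R beta beta' xi).
    by apply/funext => k; exact: psi_unique hsigma hZ2 hZ (ler0n _ _) Dxi.
  rewrite E in H1; exact: cvg_unique H1 H2.
Qed.
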